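(* Let $X$ be a real Banach space and $n\ge 1$. There exists a constant $C$ such that for every function $f$ in $T^1(X)$ (i.e. every $f:\mathbb{R}^{n+1}_+\to X$ such that $1_{\Gamma(x)}f\in L^2(\mathbb{R}^{n+1}_+)\otimes X$ for almost every $x\in\mathbb{R}^n$ and $\|f\|_{T^1(X)}<\infty$) there exist countably many $T^1(X)$ atoms $a_k$ and real numbers $\lambda_k$ such that $$f=\sum_k \lambda_k a_k \qquad\text{and}\qquad \sum_k|\lambda_k|\le C\,\|f\|_{T^1(X)}.$$
   Context: The upper half-space $\mathbb{R}^{n+1}_+=\mathbb{R}^n\times(0,\infty)$ is equipped with the measure $dy\,dt/t^{n+1}$; $L^2(\mathbb{R}^{n+1}_+)$ is taken with respect to this measure. Functions are identified when equal almost everywhere. Stochastic integral: $W$ is a Gaussian random measure on $(\mathbb{R}^{n+1}_+,dy\,dt/t^{n+1})$, i.e. it assigns to every set $A$ of finite measure a centered real Gaussian random variable $W(A)$ with $\mathbb{E}W(A)^2$ equal to the measure of $A$, such that for disjoint $A,B$ the variables $W(A),W(B)$ are independent and $W(A\cup B)=W(A)+W(B)$ almost surely. Setting $\int 1_A\,dW=W(A)$ and extending by linearity and density gives a linear isometry $h\mapsto\int h\,dW$ from $L^2(\mathbb{R}^{n+1}_+)$ into $L^2(\mathbb{P})$. For $f=\sum_k f_k\otimes\xi_k$ in the algebraic tensor product $L^2(\mathbb{R}^{n+1}_+)\otimes X$ (finite sums) one puts $\int f\,dW=\sum_k\left(\int f_k\,dW\right)\xi_k$, and $\int_A f\,dW=\int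 1_Af\,dW$ for measurable $A$. $B(x,t)$ is the open ball in $\mathbb{R}^n$ with center $x$ and radius $t$. The cone at $x\in\mathbb{R}^n$ is $\Gamma(x)=\{(y,t)\in\mathbb{R}^{n+1}_+:|x-y|<t\}$. The tent over an open set $E\subset\mathbb{R}^n$ is $\widehat{E}=\{(y,t)\in\mathbb{R}^{n+1}_+:B(y,t)\subset E\}$. $T^1(X)$ norm: $\|f\|_{T^1(X)}=\int_{\mathbb{R}^n}\left(\mathbb{E}\left\|\int_{\Gamma(x)}f\,dW\right\|^2\right)^{1/2}dx$. The space $T^1(X)$ is the completion, under this norm, of the space of functions $f:\mathbb{R}^{n+1}_+\to X$ with $1_{\Gamma(x)}f\in L^2(\mathbb{R}^{n+1}_+)\otimes X$ for a.e. $x$ and $\|f\|_{T^1(X)}<\infty$; such functions are the ''functions in $T^1(X)$''. A $T^1(X)$ atom is a function $a:\mathbb{R}^{n+1}_+\to X$ such that for some ball $B\subset\mathbb{R}^n$: $\operatorname{supp}a\subset\widehat{B}$, $1_{\Gamma(x)}a\in L^2(\mathbb{R}^{n+1}_+)\otimes X$ for almost every $x\in B$, and $\int_B\mathbb{E}\left\|\int_{\Gamma(x)}a\,dW\right\|^2dx\le\frac{1}{|B|}$. Every atom satisfies $\|a\|_{T^1(X)}\le1$; the equality $f=\sum_k\lambda_ka_k$ is understood in $T^1(X)$, where the series converges absolutely. *)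

(* Defs.v *)
From HB Require Import structures.
From mathcomp Require Import all_boot all_order all_algebra.
From mathcomp Require Import all_classical all_reals all_analysis.
From mathcomp Require Import measurable_realfun.

Set Implicit Arguments.
Unset Strict Implicit.
Unset Printing Implicit Defensive.

Import Order.TTheory GRing.Theory Num.Theory.
Import numFieldNormedType.Exports.

Local Open Scope classical_set_scope.
Local Open Scope ring_scope.

(* The coordinates are taken in [measurableTypeR R] (which is
   R with the measurable structure that carries [lebesgue_measure]), so that R^n
   has the product (Borel) sigma-algebra. *)
Notation euclidean R n := (n.-tuple (measurableTypeR R)).
Notation space_time R n := (euclidean R n * measurableTypeR R)%type.

Section sigma_finite_pack.
Context {R : realType} {d : measure_display} {T : measurableType d}.
Variable m : {measure set T -> \bar R}.

Definition sf_copy of sigma_finite setT m : set T -> \bar R := m.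

Variable mfin : sigma_finite setT m.

Let m' := sf_copy mfin.

Let m'0 : m' set0 = 0%E. Proof. exact: measure0. Qed.
Let m'_ge0 A : (0 <= m' A)%E. Proof. exact: measure_ge0. Qed.
Let m'_sa : semi_sigma_additive m'. Proof. exact: measure_semi_sigma_additive. Qed.
HB.instance Definition _ := isMeasure.Build _ _ _ (sf_copy mfin) m'0 m'_ge0 m'_sa.
HB.instance Definition _ := Measure_isSigmaFinite.Build _ _ _ (sf_copy mfin) mfin.

Lemma sigma_finite_pack :
  exists m1 : {sigma_finite_measure set T -> \bar R}, m = m1 :> (set T -> \bar R).
Proof. by exists [the {sigma_finite_measure set T -> \bar R} of sf_copy mfin]. Qed.

End sigma_finite_pack.

Section lebesgue_tuple.
Context {R : realType}.

Definition tcons (n : nat) (p : measurableTypeR R * euclidean R n) : euclidean R n.+1 :=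
  [tuple of p.1 :: p.2].

Fixpoint lebesgue_tuple (n : nat) : set (euclidean R n) -> \bar R :=
  match n with
  | 0 => dirac [tuple]
  | m.+1 => pushforward (@lebesgue_measure R \x @lebesgue_tuple m)%E (@tcons m)
  end.

Lemma measurable_tcons (n : nat) : measurable_fun [set: measurableTypeR R * euclidean R n] (@tcons n).
Proof. by apply: measurable_cons; [exact: measurable_fst|exact: measurable_snd]. Qed.

Lemma lebesgue_tuple_measure (n : nat) :
  exists m : {sigma_finite_measure set (euclidean R n) -> \bar R},
    @lebesgue_tuple n = m.
Proof.
elim: n => [|n [m mE]] /=.
  by exists [the {sigma_finite_measure set (euclidean R 0) -> \bar R}
    of dirac [tuple]].
rewrite mE.
pose l : {sigma_finite_measure set (measurableTypeR R) -> \bar R} :=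
  @lebesgue_measure R.
pose p : {measure set (measurableTypeR R * euclidean R n)%type -> \bar R} :=
  (l \x m)%E.
change (exists m0 : {sigma_finite_measure set (euclidean R n.+1) -> \bar R},
  pushforward p (@tcons n) = m0).
pose M : {measure set (euclidean R n.+1) -> \bar R} :=
  measure_function_pushforward__canonical__measure_function_Measure
    p (@measurable_tcons n).
apply: (@sigma_finite_pack _ _ _ M).
  have [G TG Goo] : sigma_finite setT p.
    have /sigma_finiteP[F [TF ndF Foo]] := sigma_finiteT l.
    have /sigma_finiteP[G [TG ndG Goo]] := sigma_finiteT m.
    exists (fun k => F k `*` G k).
      rewrite -setXTT TF TG predeqE => -[x y]; split.
        move=> [/= [i _ Fix] [k _ Gky]]; exists (maxn i k) => //; split.
        - by move: x Fix; exact/subsetPset/ndF/leq_maxl.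
        - by move: y Gky; exact/subsetPset/ndG/leq_maxr.
      by move=> [i _ []/= ? ?]; split; exists i.
    move=> k; have [? ?] := Foo k; have [? ?] := Goo k.
    split; first exact: measurableX.
    by rewrite /p /= product_measure1E// lte_mul_pinfty// ge0_fin_numE.
  pose u (v : euclidean R n.+1) : measurableTypeR R * euclidean R n :=
    (thead v, [tuple of behead v]).
  have mu_ : measurable_fun setT u.
    apply: measurable_fun_pair; first exact: measurable_tnth.
    exact: measurable_behead.
  have uK v : u (tcons v) = v.
    case: v => x v; rewrite /u /tcons /=; congr pair.
    by apply/val_inj.
  exists (fun k => u @^-1` G k).
    by rewrite -preimage_bigcup -TG preimage_setT.
  move=> k; have [mG Gk] := Goo k; split.
    by rewrite -[X in measurable X]setTI; exact: mu_.
  rewrite (_ : M _ = p (G k))//; congr (p _).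
  by apply/seteqP; split => v /=; rewrite uK.
Qed.

Section instances.
Variable n : nat.

Let l0 : @lebesgue_tuple n set0 = 0%E.
Proof. by have [m ->] := lebesgue_tuple_measure n; exact: measure0. Qed.

Let l_ge0 A : (0 <= @lebesgue_tuple n A)%E.
Proof. by have [m ->] := lebesgue_tuple_measure n; exact: measure_ge0. Qed.

Let l_sa : semi_sigma_additive (@lebesgue_tuple n).
Proof.
by have [m ->] := lebesgue_tuple_measure n; exact: measure_semi_sigma_additive.
Qed.

HB.instance Definition _ := isMeasure.Build _ _ _ (@lebesgue_tuple n) l0 l_ge0 l_sa.

Let l_sf : sigma_finite setT (@lebesgue_tuple n).
Proof. by have [m ->] := lebesgue_tuple_measure n; exact: sigma_finiteT. Qed.

HB.instance Definition _ :=
  Measure_isSigmaFinite.Build _ _ _ (@lebesgue_tuple n) l_sf.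

End instances.
End lebesgue_tuple.
Arguments lebesgue_tuple {R} n.

Section half_space.
Context {R : realType} {n : nat}.

Definition edist (x y : euclidean R n) : R :=
  Num.sqrt (\sum_(i < n) ((tnth x i : R) - (tnth y i : R)) ^+ 2).

Definition eball (x : euclidean R n) (r : R) : set (euclidean R n) :=
  [set y | edist x y < r].

(* The half-space is a subset of R^n x R; its measure, below, is carried by it,
   so that a function on the half-space is a function on R^n x R whose values
   at t <= 0 play no role. *)
Definition upper_half : set (space_time R n) := [set p | 0 < (p.2 : R)].

Definition cone (x : euclidean R n) : set (space_time R n) :=
  [set p | upper_half p /\ edist x p.1 < (p.2 : R)].

Definition tent (E : set (euclidean R n)) : set (space_time R n) :=
  [set p | upper_half p /\ eball p.1 p.2 `<=` E].

Definition half_measure (A : set (space_time R n)) : \bar R :=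
  (\int[lebesgue_tuple n \x @lebesgue_measure R]_(p in A `&` upper_half)
     ((p.2 : R) ^- n.+1)%:E)%E.

Let density : space_time R n -> \bar R :=
  (fun p => ((p.2 : R) ^- n.+1)%:E) \_ upper_half.

Let measurable_upper_half : measurable upper_half.
Proof.
rewrite (_ : upper_half = snd @^-1` `]0, +oo[%classic); last first.
  by apply/seteqP; split => -[y t] /=; rewrite in_itv/= andbT.
by rewrite -[X in measurable X]setTI; exact: measurable_snd.
Qed.

Let density_ge0 p : (0 <= density p)%E.
Proof.
rewrite /density patchE; case: ifPn => //; rewrite inE /upper_half /= => p0.
by rewrite lee_fin invr_ge0 exprn_ge0// ltW.
Qed.

Let measurable_density : measurable_fun setT density.
Proof.
apply/(measurable_restrictT (fun p => ((p.2 : R) ^- n.+1)%:E)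
  measurable_upper_half)/measurable_EFinP.
apply: (@eq_measurable_fun _ _ _ _ _ ((fun t : measurableTypeR R => t `^ (- n.+1%:R)) \o snd)).
  by move=> p; rewrite inE /upper_half/= => p0; rewrite powRN powR_mulrn// ltW.
apply: measurable_funTS; apply: measurableT_comp; last exact: measurable_snd.
exact: measurable_powR.
Qed.

Let half_measureE A : half_measure A =
  (\int[lebesgue_tuple n \x @lebesgue_measure R]_(p in A) density p)%E.
Proof. by rewrite /half_measure integral_mkcondr. Qed.

Let h0 : half_measure set0 = 0%E.
Proof. by rewrite half_measureE integral_set0. Qed.

Let h_ge0 A : (0 <= half_measure A)%E.
Proof. by rewrite half_measureE; apply: integral_ge0. Qed.

Let h_sa : semi_sigma_additive half_measure.
Proof.
rewrite (_ : half_measure = fun A =>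
  (\int[lebesgue_tuple n \x @lebesgue_measure R]_(p in A) density p)%E).
  exact: semi_sigma_additive_nng_induced.
by apply/funext => A; rewrite half_measureE.
Qed.

HB.instance Definition _ := isMeasure.Build _ _ _ half_measure h0 h_ge0 h_sa.

End half_space.

Section gaussian_random_measure.
Context {R : realType} {n : nat} {d : measure_display} {Omega : measurableType d}.
Context {P : probability Omega R}.
Local Notation T := (space_time R n).
Local Notation mu := (@half_measure R n).

Definition independent_RV (Y Z : {RV P >-> R}) : Prop :=
  forall U V : set R, measurable U -> measurable V ->
    P (Y @^-1` U `&` Z @^-1` V) = (P (Y @^-1` U) * P (Z @^-1` V))%E.

(* A Gaussian variable may be degenerate (variance 0).  That case is separated
   because the library's [normal_prob 0 0] is the uniform law on [0, 1]. *)
Definition centered_gaussian (Z : {RV P >-> R}) : Prop :=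
  exists s : R, forall U : set R, measurable U ->
    distribution P Z U = if s == 0 then \d_(0 : R) U else normal_prob 0 s U.

Record gaussian_random_measure (W : set T -> {RV P >-> R}) : Prop := {
  grm_gaussian : forall A : set T, measurable A -> (mu A < +oo)%E ->
    centered_gaussian (W A) ;
  grm_variance : forall A : set T, measurable A -> (mu A < +oo)%E ->
    ('E_P[fun w => (W A w ^+ 2)%R] = mu A)%E ;
  grm_independent : forall A B : set T, measurable A -> (mu A < +oo)%E ->
    measurable B -> (mu B < +oo)%E -> A `&` B = set0 ->
    independent_RV (W A) (W B) ;
  grm_additive : forall A B : set T, measurable A -> (mu A < +oo)%E ->
    measurable B -> (mu B < +oo)%E -> A `&` B = set0 ->
    {ae P, forall w, W (A `|` B) w = W A w + W B w} }.

Variable W : set T -> {RV P >-> R}.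

(* A list of pairs (c_i, A_i) encodes the step function sum_i c_i 1_{A_i}. *)
Definition step_fun (s : seq (R * set T)) (p : T) : R :=
  \sum_(i <- s) i.1 * \1_(i.2) p.

Definition step_integral (s : seq (R * set T)) (w : Omega) : R :=
  \sum_(i <- s) i.1 * W i.2 w.

(* I is the image of h under the continuous extension to L^2 of
   1_A |-> W(A). *)
Definition is_wiener_integral (h : T -> R) (I : Omega -> R) : Prop :=
  I \in Lfun P 2%:E /\
  exists s : (seq (R * set T))^nat,
    [/\ forall j i, i \in s j -> measurable i.2 /\ (mu i.2 < +oo)%E,
        ('N[mu]_2%:E[EFin \o (step_fun (s j) \- h)%R])%E @[j --> \oo] --> 0%E &
        ('N[P]_2%:E[EFin \o (step_integral (s j) \- I)%R])%E @[j --> \oo] --> 0%E].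

(* For h in L^2 such an I exists and is unique up to almost sure equality. *)
Definition wiener_integral (h : T -> R) : Omega -> R :=
  xget (cst 0) [set I | is_wiener_integral h I].

Context {X : completeNormedModType R}.

(* f = sum_(k < m) F_k (x) xi_k in L^2 (x) X. *)
Definition tensor_decomp (f : T -> X) (m : nat) (F : 'I_m -> T -> R)
    (xi : 'I_m -> X) : Prop :=
  (forall k, F k \in Lfun mu 2%:E) /\
  {ae mu, forall p, f p = \sum_(k < m) F k p *: xi k}.

Definition in_L2_tensor (f : T -> X) : Prop :=
  exists (m : nat) (F : 'I_m -> T -> R) (xi : 'I_m -> X), tensor_decomp f F xi.

(* Up to almost sure equality the value does not depend on the decomposition. *)
Definition stoch_integral (f : T -> X) : Omega -> X :=
  xget (cst 0) [set Z | exists (m : nat) (F : 'I_m -> T -> R) (xi : 'I_m -> X),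
    tensor_decomp f F xi /\
    Z = fun w => \sum_(k < m) wiener_integral (F k) w *: xi k].

Definition restr (A : set T) (f : T -> X) : T -> X := fun p => \1_A p *: f p.

Definition cone_energy (f : T -> X) (x : euclidean R n) : \bar R :=
  ('E_P[fun w => (`|stoch_integral (restr (cone x) f) w| ^+ 2)%R])%E.

Definition T1_norm (f : T -> X) : \bar R :=
  (\int[lebesgue_tuple n]_x sqrte (cone_energy f x))%E.

Definition T1_function (f : T -> X) : Prop :=
  {ae lebesgue_tuple n, forall x, in_L2_tensor (restr (cone x) f)} /\
  (T1_norm f < +oo)%E.

Definition T1_atom (a : T -> X) : Prop :=
  exists (x0 : euclidean R n) (r : R),
    let B := eball x0 r in
    [/\ 0 < r,
        forall p, upper_half p -> ~ tent B p -> a p = 0,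
        {ae lebesgue_tuple n, forall x, B x -> in_L2_tensor (restr (cone x) a)} &
        (\int[lebesgue_tuple n]_(x in B) cone_energy a x
           <= (lebesgue_tuple n B)^-1)%E].

(* f = sum_k g_k in the T^1 norm; f and the partial sums are functions, so
   the completion is not needed. *)
Definition T1_sums_to (g : nat -> T -> X) (f : T -> X) : Prop :=
  T1_norm (f \- (fun p => \sum_(k < N) g k p)) @[N --> \oo] --> 0%E.

End gaussian_random_measure.

(* Main.v *)
From HB Require Import structures.
From mathcomp Require Import all_boot all_order all_algebra finmap.
From mathcomp Require Import all_classical all_reals all_analysis.
From mathcomp Require Import measurable_realfun.
From mathcomp Require Import ring lra zify.
Require Import Defs.

Set Implicit Arguments.
Unset Strict Implicit.
Unset Printing Implicit Defensive.

Import Order.TTheory GRing.Theory Num.Theory.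
Import numFieldNormedType.Exports.

Local Open Scope classical_set_scope.
Local Open Scope ring_scope.

(** The proof separates what is random from what is geometric.

    For a set [A] put [e(A) = (E ||int_A f dW||^2)^(1/2)].  The probabilistic
    half yields four facts about [e], for sets lying in a cone on which [f] is
    a finite tensor: [e] is monotone ([energy_restr]), subadditive ([energyD]),
    homogeneous in [f] ([energyZ]), and tends to [0] along a sequence of sets
    which every point eventually leaves ([energy_restr_cvg0]).

    Monotonicity is the delicate one.  With [eps = 1] on [A] and [-1] off [A],
    the families [(int F_k dW)_k] and [(int eps F_k dW)_k] have the same joint
    law, because the characteristic function of a linear combination only sees
    the L^2 norm of [sum_k u_k F_k]: this is [mean_cos_wiener],
    [E cos(theta + int h dW) = cos theta * exp(- ||h||^2 / 2)].  As
    [1_A = (1 + eps) / 2], the triangle inequality in L^2 concludes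
    ([norm2_wiener_restrict]).  The hypotheses on [W] give the independence of
    two variables [W(A)], [W(B)] at a time and say nothing directly about
    joint laws of three of them, so the formula for characteristic functions is itself
    obtained indirectly ([cos_mean_total]).  For disjoint [A], [B] the variables
    [W(A) - W(B)] and [W(A u B)] have the same characteristic function, by
    independence of the pair and symmetry.  Hence flipping the signs of [W] on
    some of the cells of a partition of [A] does not change
    [E cos(u W(A))].  Choose these signs at random, with mean [kappa_i] on the
    [i]-th cell, and average: as the mesh tends to [0] the average of the cosine
    becomes [cos(u sum_i kappa_i W(A_i))] times
    [exp(- u^2/2 * sum_i (1 - kappa_i^2) |A_i|)], by a quantitative central
    limit theorem and the convergence of [sum_i W(A_i)^2].  Taking
    [kappa = 0] identifies [E cos(u W(A))], and then general [kappa] gives the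
    characteristic function of an arbitrary step function.

    Equality of characteristic functions is turned into equality of the laws of
    [||sum_k Y_k xi_k||] by smoothing one coordinate at a time
    ([transfer_coordinate]): a normal density is an average of cosines with
    respect to a Gaussian variable, so the smoothed expectation of a Lipschitz
    function is expressed by means that are already known to agree.

    The geometric half is a stopping time argument on dyadic cubes.  A cube is
    heavy at the threshold [2^k] if [e(Gamma(z)) > 2^k] for all good [z] in it;
    [heavy_region k] consists of the points whose dyadic cell is near a heavy
    cube.  The key estimate is [mass_light]: if [S], contained in the cone at
    [x], avoids [heavy_region k], then [e(S) <= N 2^k] with [N] depending on
    the dimension only.  Indeed take the lowest dyadic level met by [S], and
    move from [x] towards the foot [y] of [(y,t)] by a fixed distance comparable
    to this level: the small cube reached there lies inside [B(y,t)], is one of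
    [N] possible cubes, and contains a [z] with [e(Gamma(z)) <= 2^k].  So [N]
    cones with small energy cover [S].

    The sets [heavy_region k \ heavy_region (k+1)] fill the half-space up to a
    set on which [e] vanishes.  Each is cut according to the maximal heavy cube
    [r] lying above the point; a piece sits in the tent over a dilate of [r]
    ([piece_tent]) and has energy at most [N 2^(k+1)], so it is a multiple of an
    atom with a coefficient comparable to [2^k |r|].  Above a point [x] there is
    at most one maximal cube for each [k], and only for [2^k < e(Gamma(x))]; the
    geometric sum is at most [2 e(Gamma(x))] ([sum_selected_le]) and integrating
    in [x] bounds the coefficients ([sum_coefficient_le]).  The energy is only
    ever compared pointwise with measurable functions.  Convergence
    follows by dominating the remainder pointwise by the tail of the series of
    the bounds [N 2^(k+1) 1_B] ([mass_remainder], [sum_atoms]). *)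

(** * Square-integrable functions *)

Section square_integrable.
Context {R : realType} {d : measure_display} {T : measurableType d}.
Variable m : {measure set T -> \bar R}.
Local Open Scope ereal_scope.
Implicit Types f g : T -> R.

Definition norm2 f : \bar R := 'N[m]_2%:E[EFin \o f].

Lemma norm2E f : norm2 f = sqrte (\int[m]_x (f x ^+ 2)%:E).
Proof.
rewrite /norm2 unlock poweR12_sqrt; last first.
  by apply: integral_ge0 => x _; exact: poweR_ge0.
congr sqrte; apply: eq_integral => x _.
by rewrite /= powR_mulrn// real_normK// num_real.
Qed.

Lemma norm2_sqr f : norm2 f ^+ 2 = \int[m]_x (f x ^+ 2)%:E.
Proof.
by rewrite norm2E sqr_sqrte//; apply: integral_ge0 => x _; rewrite lee_fin sqr_ge0.
Qed.

Lemma norm2_ge0 f : 0 <= norm2 f. Proof. exact: Lnorm_ge0. Qed.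

Lemma norm2_lty f : (norm2 f < +oo) = (\int[m]_x (f x ^+ 2)%:E < +oo).
Proof.
have I0 : 0 <= \int[m]_x (f x ^+ 2)%:E.
  by apply: integral_ge0 => x _; rewrite lee_fin sqr_ge0.
by rewrite -!ge0_fin_numE ?norm2_ge0// norm2E sqrte_fin_num.
Qed.

Lemma Lfun2P f : (f \in Lfun m 2%:E) <->
  measurable_fun [set: T] f /\ norm2 f < +oo.
Proof.
split.
  by move=> /[dup]/sub_Lfun_mfun/set_mem mf /sub_Lfun_finLfun/set_mem.
by move=> [mf nf]; apply/andP; split; exact: mem_set.
Qed.

Lemma Lfun2_measurable f : f \in Lfun m 2%:E -> measurable_fun [set: T] f.
Proof. by case/Lfun2P. Qed.

Lemma measurable_sqr f : measurable_fun [set: T] f ->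
  measurable_fun [set: T] (fun x => (f x ^+ 2)%:E).
Proof. by move=> mf; apply/measurable_EFinP; exact: measurable_funX. Qed.

Lemma le_norm2 f g : measurable_fun [set: T] f -> measurable_fun [set: T] g ->
  (forall x, (`|f x| <= `|g x|)%R) -> norm2 f <= norm2 g.
Proof.
move=> mf mg fg; rewrite !norm2E lee_sqrt; last first.
  by apply: integral_ge0 => x _; rewrite lee_fin sqr_ge0.
apply: ge0_le_integral => //.
- by move=> x _; rewrite lee_fin sqr_ge0.
- exact: measurable_sqr.
- exact: measurable_sqr.
- move=> x _; rewrite lee_fin -[leLHS]real_normK ?num_real//.
  by rewrite -[leRHS]real_normK ?num_real// lerXn2r ?nnegrE.
Qed.

Lemma norm2D f g : measurable_fun [set: T] f -> measurable_fun [set: T] g ->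
  norm2 (f \+ g)%R <= norm2 f + norm2 g.
Proof. by move=> mf mg; apply: minkowski_EFin => //; rewrite ler1n. Qed.

Lemma norm2Z (c : R) f : measurable_fun [set: T] f ->
  norm2 (fun x => c * f x)%R = `|c|%:E * norm2 f.
Proof.
move=> mf; rewrite !norm2E.
under eq_integral do rewrite exprMn EFinM.
rewrite ge0_integralZl//; last 3 first.
- exact: measurable_sqr.
- by move=> x _; rewrite lee_fin sqr_ge0.
- by rewrite lee_fin sqr_ge0.
rewrite sqrteM ?lee_fin ?sqr_ge0//; congr (_ * _).
by rewrite /= sqrtr_sqr.
Qed.

Lemma norm2N f : norm2 (fun x => - f x)%R = norm2 f.
Proof. by rewrite !norm2E; under eq_integral do rewrite sqrrN. Qed.

Lemma norm2BC f g : norm2 (f \- g)%R = norm2 (g \- f)%R.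
Proof.
by rewrite -norm2N; congr norm2; apply/funext => x /=; rewrite opprB.
Qed.

Lemma norm2_triangle f g h : measurable_fun [set: T] f ->
  measurable_fun [set: T] g -> measurable_fun [set: T] h ->
  norm2 (f \- h)%R <= norm2 (f \- g)%R + norm2 (g \- h)%R.
Proof.
move=> mf mg mh.
rewrite (_ : (f \- h)%R = (f \- g) \+ (g \- h))%R; last first.
  by apply/funext => x /=; rewrite addrA subrK.
by apply: norm2D; exact: measurable_funB.
Qed.

Lemma norm2_sum (I : Type) (r : seq I) (F : I -> T -> R) :
  (forall i, measurable_fun [set: T] (F i)) ->
  norm2 (fun x => \sum_(i <- r) F i x)%R <= \sum_(i <- r) norm2 (F i).
Proof.
move=> mF; elim: r => [|i r IH].
  rewrite big_nil norm2E; under eq_integral do rewrite big_nil expr0n.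
  by rewrite integral0 sqrte0.
rewrite big_cons; under eq_fun do rewrite big_cons.
apply: le_trans (leeD2l _ IH).
by apply: norm2D => //; exact: measurable_sum.
Qed.

Lemma norm2_ae_eq f g : measurable_fun [set: T] f -> measurable_fun [set: T] g ->
  {ae m, forall x, f x = g x} -> norm2 f = norm2 g.
Proof.
move=> mf mg fg; rewrite !norm2E; congr sqrte.
apply: ge0_ae_eq_integral => //.
- exact: measurable_sqr.
- exact: measurable_sqr.
- by move=> x _; rewrite lee_fin sqr_ge0.
- by move=> x _; rewrite lee_fin sqr_ge0.
- by apply: filterS fg => x ->.
Qed.

Lemma norm2_eq0 f : measurable_fun [set: T] f -> norm2 f = 0 ->
  {ae m, forall x, f x = 0%R}.
Proof.
move=> mf f0.
have : \int[m]_x `|(f x ^+ 2)%:E| = 0.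
  under eq_integral do rewrite gee0_abs ?lee_fin ?sqr_ge0//.
  by rewrite -norm2_sqr f0 expe2 mule0.
move/ae_eq_integral_abs => /(_ measurableT (measurable_sqr mf)).
apply: filterS => x /(_ Logic.I) /= [] /eqP.
by rewrite sqrf_eq0 => /eqP.
Qed.

Lemma Lfun2D f g : f \in Lfun m 2%:E -> g \in Lfun m 2%:E ->
  (fun x => f x + g x)%R \in Lfun m 2%:E.
Proof.
move=> /Lfun2P[mf nf] /Lfun2P[mg ng]; apply/Lfun2P; split.
  exact: measurable_funD.
by apply: (le_lt_trans (norm2D mf mg)); rewrite lte_add_pinfty.
Qed.

Lemma Lfun2Z (c : R) f : f \in Lfun m 2%:E ->
  (fun x => c * f x)%R \in Lfun m 2%:E.
Proof.
move=> /Lfun2P[mf nf]; apply/Lfun2P; split; first exact: measurable_funM.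
by rewrite norm2Z// lte_mul_pinfty// ?lee_fin.
Qed.

Lemma Lfun2B f g : f \in Lfun m 2%:E -> g \in Lfun m 2%:E ->
  (fun x => f x - g x)%R \in Lfun m 2%:E.
Proof.
move=> Hf Hg; have := Lfun2D Hf (Lfun2Z (-1)%R Hg).
by under eq_fun do rewrite mulN1r.
Qed.

Lemma Lfun2_0 : (fun=> 0%R) \in Lfun m 2%:E.
Proof.
apply/Lfun2P; split => //; rewrite norm2_lty.
by under eq_integral do rewrite expr0n; rewrite integral0.
Qed.

Lemma Lfun2_sum (I : Type) (r : seq I) (F : I -> T -> R) :
  (forall i, F i \in Lfun m 2%:E) ->
  (fun x => \sum_(i <- r) F i x)%R \in Lfun m 2%:E.
Proof.
move=> HF; elim: r => [|i r IH].
  by under eq_fun do rewrite big_nil; exact: Lfun2_0.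
under eq_fun do rewrite big_cons.
exact: Lfun2D.
Qed.

Lemma Lfun2_le f g : measurable_fun [set: T] f -> g \in Lfun m 2%:E ->
  (forall x, (`|f x| <= `|g x|)%R) -> f \in Lfun m 2%:E.
Proof.
move=> mf /Lfun2P[mg ng] fg; apply/Lfun2P; split => //.
exact: le_lt_trans (le_norm2 mf mg fg) ng.
Qed.

Lemma Lfun2_indic (S : set T) f : measurable S -> f \in Lfun m 2%:E ->
  (fun x => \1_S x * f x)%R \in Lfun m 2%:E.
Proof.
move=> mS Hf; have mf := Lfun2_measurable Hf.
apply: (Lfun2_le _ Hf); first by apply: measurable_funM => //.
move=> x; rewrite normrM; rewrite -[leRHS]mul1r ler_wpM2r//.
by rewrite indicE; case: (x \in S); rewrite ?normr1 ?normr0.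
Qed.

End square_integrable.

(** * Completeness of L^2 *)

Section square_integrable_limits.
Context {R : realType} {d : measure_display} {T : measurableType d}.
Variable m : {measure set T -> \bar R}.
Local Open Scope ereal_scope.

Lemma norm2_fatou (F : nat -> T -> R) (f : T -> R) (c : R) :
  (forall n, measurable_fun [set: T] (F n)) -> (0 <= c)%R ->
  (forall x, F n x @[n --> \oo] --> f x) ->
  (\forall n \near \oo, norm2 m (F n) <= c%:E) -> norm2 m f <= c%:E.
Proof.
move=> mF c0 Ff Fc.
suff I : \int[m]_x (f x ^+ 2)%:E <= (c ^+ 2)%:E.
  rewrite norm2E -(ger0_norm c0) -sqrtr_sqr.
  rewrite -[X in _ <= X]/(sqrte (c ^+ 2)%:E).
  by rewrite lee_sqrt// lee_fin sqr_ge0.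
have -> : \int[m]_x (f x ^+ 2)%:E =
    \int[m]_x limn_einf (fun n => (F n x ^+ 2)%:E).
  apply: eq_integral => x _; apply/esym.
  have H : (F n x ^+ 2)%:E @[n --> \oo] --> (f x ^+ 2)%:E.
    apply: cvg_EFin; first by apply: nearW.
    by under eq_cvg do rewrite /=; apply: cvgM; exact: Ff.
  by rewrite is_cvg_limn_einfE; [exact/cvg_lim|apply/cvg_ex; exists (f x ^+ 2)%:E].
apply: le_trans; first apply: fatou => //.
- by move=> n; exact: measurable_sqr.
- by move=> n x _; rewrite lee_fin sqr_ge0.
rewrite limn_einf_lim; apply: lime_le; first exact: is_cvg_einfs.
apply: nearW => n.
case: Fc => N _ FN.
apply: le_trans (_ : \int[m]_x (F (maxn n N) x ^+ 2)%:E <= _).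
  apply: ereal_inf_lbound; exists (maxn n N) => //=.
  exact: leq_maxl.
rewrite -norm2_sqr EFin_expe.
have := FN (maxn n N) (leq_maxr _ _) => /= H.
by rewrite ?expe2 lee_pmul// norm2_ge0.
Qed.

(** A geometric rate makes the series of increments converge absolutely
    almost everywhere; the limit is also the limit in L^2, by Fatou. *)
Lemma L2_complete (Y : nat -> T -> R) :
  (forall j, Y j \in Lfun m 2%:E) ->
  (forall j, norm2 m (Y j.+1 \- Y j)%R <= (2^-1 ^+ j)%:E) ->
  exists I, I \in Lfun m 2%:E /\ norm2 m (Y j \- I)%R @[j --> \oo] --> 0.
Proof.
move=> LY dY.
have mY j : measurable_fun [set: T] (Y j) by exact: Lfun2_measurable (LY j).
pose D j x := (`|Y j.+1 x - Y j x|)%R.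
have mD j : measurable_fun [set: T] (D j).
  by apply: measurableT_comp => //; exact: measurable_funB.
have nD j : norm2 m (D j) <= (2^-1 ^+ j)%:E.
  rewrite (le_trans _ (dY j))// le_norm2//; first exact: measurable_funB.
  by move=> x; rewrite /D normr_id.
have geo (a b : nat) : (\sum_(a <= j < b) (2^-1 : R) ^+ j <= 2 * 2^-1 ^+ a)%R.
  have [ab|ba] := leqP a b; last first.
    by rewrite big_geq ?mulr_ge0 ?exprn_ge0// ltnW.
  suff -> : (\sum_(a <= j < b) (2^-1 : R) ^+ j = 2 * 2^-1 ^+ a - 2 * 2^-1 ^+ b)%R.
    by rewrite gerBl mulr_ge0// exprn_ge0.
  elim: b ab => [|b IH].
    by rewrite leqn0 => /eqP ->; rewrite big_geq// subrr.
  rewrite leq_eqVlt => /predU1P[->|]; first by rewrite big_geq// subrr.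
  rewrite ltnS => ab; rewrite big_nat_recr//= IH// exprS.
  by field.
pose G N x := (\sum_(j < N) D j x)%R.
have mG N : measurable_fun [set: T] (G N) by exact: measurable_sum.
have nG N : norm2 m (G N) <= 2%:E.
  apply: le_trans (norm2_sum _ _ _) _ => //.
  apply: (@le_trans _ _ (\sum_(j < N) (2^-1 ^+ j)%:E)).
    by apply: lee_sum => j _; exact: nD.
  rewrite sumEFin lee_fin -(big_mkord xpredT (fun i => (2^-1 : R) ^+ i)%R).
  by rewrite (le_trans (geo 0%N N))// expr0 mulr1.
pose h N x := (G N x ^+ 2)%:E.
have G0 N x : (0 <= G N x)%R by apply: sumr_ge0 => j _; exact: normr_ge0.
have ndh x : nondecreasing_seq (h ^~ x).
  move=> a b ab; rewrite lee_fin lerXn2r ?nnegrE//.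
  rewrite /G -(subnKC ab) big_split_ord/= lerDl.
  by apply: sumr_ge0 => j _; exact: normr_ge0.
have mh N : measurable_fun [set: T] (h N) by exact: measurable_sqr.
pose H x := limn (h ^~ x).
have cvgh x : cvgn (h ^~ x) by exact: ereal_nondecreasing_is_cvgn.
have mH : measurable_fun [set: T] H by apply: emeasurable_fun_cvg mh _ => x _.
have IH : \int[m]_x H x < +oo.
  rewrite /H (monotone_convergence m measurableT mh)//; last first.
    by move=> n x _; rewrite lee_fin sqr_ge0.
  apply: (le_lt_trans _ (ltry (4 : R))); apply: lime_le.
    apply: ereal_nondecreasing_is_cvgn => a b ab.
    apply: ge0_le_integral => //; first by move=> x _; rewrite lee_fin sqr_ge0.
    by move=> x _; exact: ndh.
  apply: nearW => n; rewrite -norm2_sqr.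
  have -> : (4%:E = (2%:E : \bar R) ^+ 2) by rewrite -EFin_expe; congr EFin; lra.
  by rewrite ?expe2 lee_pmul// norm2_ge0.
have H0 x : 0 <= H x.
  by apply: lime_ge => //; apply: nearW => n; rewrite lee_fin sqr_ge0.
pose A := [set x | H x < +oo].
have mA : measurable A.
  rewrite -[A]setTI; exact: emeasurable_fun_infty_o.
have aeA : {ae m, forall x, A x}.
  have iH : m.-integrable setT H.
    apply/integrableP; split => //.
    by under eq_integral do rewrite gee0_abs//.
  apply: filterS (integrable_ae measurableT iH) => x /(_ Logic.I).
  by rewrite /A/= ge0_fin_numE.
have cvgY x : A x -> cvgn (Y ^~ x).
  move=> Ax; have Hf : H x \is a fin_num by rewrite ge0_fin_numE.
  have Gb N : (G N x <= fine (H x) + 1)%R.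
    have : (G N x ^+ 2 <= fine (H x))%R.
      rewrite -lee_fin fineK//; apply: lime_ge => //.
      by exists N => // k /= Nk; exact: ndh.
    move=> GH; rewrite leNgt; apply/negP => GH1.
    have : (0 <= fine (H x))%R by apply: le_trans GH; rewrite sqr_ge0.
    by nra.
  have cs : cvgn (series (telescope (Y ^~ x))).
    apply: normed_cvg; apply: nondecreasing_is_cvgn.
      by apply/nondecreasing_seqP => k; rewrite [leRHS]seriesSr lerDl; exact: normr_ge0.
    exists (fine (H x) + 1)%R => _ [N _ <-].
    by have := Gb N; rewrite /G -(big_mkord xpredT (D ^~ x)).
  rewrite (_ : Y ^~ x = fun n => (Y 0%N x + series (telescope (Y ^~ x)) n)%R).
    by apply: (@is_cvgD _ _ _ _ _ (cst (Y 0%N x))) => //; exact: is_cvg_cst.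
  by apply/funext => n; rewrite -eq_sum_telescope.
pose Z j x := (\1_A x * Y j x)%R.
have mZ j : measurable_fun [set: T] (Z j) by apply: measurable_funM => //.
have cvgZ x : cvgn (Z ^~ x).
  rewrite /Z indicE; case: (boolP (x \in A)) => xA.
    by under eq_fun do rewrite mul1r; exact/cvgY/set_mem.
  by under eq_fun do rewrite mul0r; exact: is_cvg_cst.
pose I x := limn (Z ^~ x).
have mI : measurable_fun [set: T] I.
  by apply: measurable_fun_cvg mZ _ => x _; exact: cvgZ.
have ZY j : norm2 m (Y j \- I)%R = norm2 m (Z j \- I)%R.
  apply: norm2_ae_eq; [exact: measurable_funB|exact: measurable_funB|].
  apply: filterS aeA => x Ax; rewrite /= /Z indicE mem_set//.
  by rewrite mul1r.
have nI j : norm2 m (Y j \- I)%R <= (2 * 2^-1 ^+ j)%:E.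
  rewrite ZY; apply: (@norm2_fatou (fun N => Z j \- Z N)%R).
  - by move=> n; exact: measurable_funB.
  - by rewrite mulr_ge0// exprn_ge0.
  - by move=> x; apply: cvgB; [exact: cvg_cst|exact: cvgZ].
  exists j => // N /= jN.
  apply: (@le_trans _ _ (norm2 m (fun x => \sum_(j <= i < N) D i x)%R)).
    apply: le_norm2; [exact: measurable_funB|exact: measurable_sum|].
    move=> x; rewrite /= /Z -mulrBr normrM.
    rewrite [leRHS]ger0_norm; last by apply: sumr_ge0 => i _; exact: normr_ge0.
    rewrite distrC -(telescope_sumr (Y ^~ x) jN) -[leRHS]mul1r ler_pM//.
      by rewrite indicE; case: (x \in A); rewrite ?normr1 ?normr0.
    exact: ler_norm_sum.
  apply: le_trans (norm2_sum _ _ _) _ => //.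
  apply: (@le_trans _ _ (\sum_(j <= i < N) (2^-1 ^+ i)%:E)).
    by apply: lee_sum => i _; exact: nD.
  by rewrite sumEFin lee_fin; exact: geo.
exists I; split.
  have LI : (fun x => Y 0%N x - (Y 0%N x - I x))%R \in Lfun m 2%:E.
    apply: Lfun2B => //; apply/Lfun2P; split; first exact: measurable_funB.
    exact: le_lt_trans (nI 0%N) (ltry _).
  by move: LI; under eq_fun do rewrite opprB addrC subrK.
apply: (@squeeze_cvge _ _ _ _ (cst 0) _ (fun j => (2 * 2^-1 ^+ j)%:E)).
- by apply: nearW => j; rewrite norm2_ge0 nI.
- exact: cvg_cst.
- apply: cvg_EFin; first exact: nearW.
  rewrite -[X in _ --> X](mulr0 2%R); apply: cvgM; first exact: cvg_cst.
  by apply: cvg_expr; rewrite ger0_norm//; lra.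
Qed.

End square_integrable_limits.

(** * Density of step functions in L^2 *)

Section cvge0.
Context {R : realType}.
Local Open Scope ereal_scope.
Implicit Type u : nat -> \bar R.

Lemma cvge0_le u : (forall n, 0 <= u n) ->
  (forall e : R, (0 < e)%R -> \forall n \near \oo, u n <= e%:E) ->
  u n @[n --> \oo] --> 0.
Proof.
move=> u0 ue; apply/fine_cvgP; split.
  apply: filterS (ue 1%R ltr01) => n un.
  by rewrite ge0_fin_numE// (le_lt_trans un) ?ltry.
apply/cvgrPdist_le => e e0; apply: filterS (ue e e0) => n un.
rewrite sub0r normrN ger0_norm ?fine_ge0//.
by rewrite -lee_fin fineK// ge0_fin_numE// (le_lt_trans un) ?ltry.
Qed.

Lemma cvge0_near u (e : R) : u n @[n --> \oo] --> 0 -> (0 < e)%R ->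
  \forall n \near \oo, u n <= e%:E.
Proof.
move=> /fine_cvgP[fu /cvgrPdist_le/(_ e)] H e0.
apply: filterS2 fu (H e0) => n fn; rewrite /= sub0r normrN => le.
by rewrite -(fineK fn) lee_fin (le_trans _ le)// ler_norm.
Qed.

Lemma cvge0_squeeze u (v : nat -> \bar R) : (forall n, 0 <= u n) ->
  (forall n, u n <= v n) -> v n @[n --> \oo] --> 0 -> u n @[n --> \oo] --> 0.
Proof.
move=> u0 uv v0; apply: cvge0_le => // e e0.
by apply: filterS (cvge0_near v0 e0) => n; exact: le_trans.
Qed.

End cvge0.

Section dominated.
Context {R : realType} {d : measure_display} {T : measurableType d}.
Variable m : {measure set T -> \bar R}.
Local Open Scope ereal_scope.

Lemma norm2_le_sqr (f : T -> R) (c : R) : (0 <= c)%R ->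
  (norm2 m f <= c%:E) = (\int[m]_x (f x ^+ 2)%:E <= (c ^+ 2)%:E).
Proof.
move=> c0; rewrite norm2E -[in LHS](ger0_norm c0) -sqrtr_sqr.
rewrite -[X in _ <= X]/(sqrte (c ^+ 2)%:E).
by rewrite lee_sqrt// lee_fin sqr_ge0.
Qed.

(** Dominated convergence applied to the squares. *)
Lemma norm2_dominated (F : nat -> T -> R) (g : T -> R) :
  (forall n, measurable_fun [set: T] (F n)) -> g \in Lfun m 2%:E ->
  (forall n x, (`|F n x| <= `|g x|)%R) ->
  (forall x, F n x @[n --> \oo] --> 0%R) ->
  norm2 m (F n) @[n --> \oo] --> 0.
Proof.
move=> mF Lg Fg F0; have mg := Lfun2_measurable Lg.
have g2 : m.-integrable setT (fun x => (g x ^+ 2)%:E).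
  exact: Lfun2_integrable_sqr.
have [//|||||_ _] := @dominated_convergence _ _ _ m setT measurableT
  (fun n x => (F n x ^+ 2)%:E) (cst 0) (fun x => (g x ^+ 2)%:E).
- by move=> n; exact: measurable_sqr.
- exact: measurable_cst.
- apply: aeW => x _; apply: cvg_EFin; first exact: nearW.
  have : (F n x * F n x)%R @[n --> \oo] --> (0 * 0 : R)%R by apply: cvgM; exact: F0.
  by rewrite mulr0.
- exact: g2.
- apply: aeW => x n _; rewrite gee0_abs ?lee_fin ?sqr_ge0//.
  rewrite -(real_normK (num_real (F n x))) -(real_normK (num_real (g x))).
  by rewrite lerXn2r ?nnegrE.
rewrite integral0 => I0; apply: cvge0_le => [n|e e0]; first exact: norm2_ge0.
have e2 : (0 < e ^+ 2)%R by rewrite exprn_gt0.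
by apply: filterS (cvge0_near I0 e2) => n; rewrite norm2_le_sqr// ltW.
Qed.

End dominated.

Section step_approximation.
Import HBSimple.
Context {R : realType} {n : nat}.
Local Notation T := (space_time R n).
Local Notation mu := (@half_measure R n).
Local Open Scope ereal_scope.
Implicit Types (s : seq (R * set T)).

Definition finite_steps s :=
  forall i, i \in s -> measurable i.2 /\ (mu i.2 < +oo).

Fixpoint disjoint_steps s : Prop :=
  if s is i :: s' then
    (forall j, j \in s' -> i.2 `&` j.2 = set0) /\ disjoint_steps s'
  else True.

Lemma measurable_step_fun s : finite_steps s -> measurable_fun [set: T] (step_fun s).
Proof.
elim: s => [|i s IH] fs.
  rewrite (_ : step_fun [::] = cst 0%R); first exact: measurable_cst.
  by apply/funext => x; rewrite /step_fun big_nil.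
rewrite /step_fun; under eq_fun do rewrite big_cons.
apply: measurable_funD; last first.
  by apply: IH => j js; apply: fs; rewrite inE js orbT.
apply: measurable_funM => //; apply: measurable_indic.
by have [] := fs i (mem_head _ _).
Qed.

(** A simple function is recorded by its nonzero values only: these are the
    ones taken on sets of finite measure. *)
Lemma sfun_steps (g : {sfun T >-> R}) : (g : T -> R) \in Lfun mu 2%:E ->
  exists s, [/\ finite_steps s, disjoint_steps s & step_fun s = g :> (T -> R)].
Proof.
move=> Lg.
pose cs := [seq c <- fset_set (range g) | c != 0%R].
have ucs : uniq cs by rewrite filter_uniq// fset_uniq.
exists [seq (c, g @^-1` [set c]) | c <- cs]; split.
- move=> _ /mapP[c + ->]; rewrite mem_filter => /andP[c0 _] /=.
  have mc : measurable (g @^-1` [set c]) by exact: measurable_sfunP.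
  split => //.
  have H : norm2 mu (fun x => c * \1_(g @^-1` [set c]) x)%R < +oo.
    have /Lfun2P[mg] := Lg; apply: le_lt_trans; apply: le_norm2 => //.
      by apply: measurable_funM.
    move=> x; rewrite indicE; case: (boolP (x \in _)); rewrite ?mulr0 ?normr0//.
    by rewrite inE/= => ->; rewrite mulr1.
  rewrite norm2Z// in H.
  have : norm2 mu (\1_(g @^-1` [set c])) < +oo.
    rewrite ltNge leye_eq; apply/negP => /eqP Hy; move: H.
    by rewrite Hy gt0_muley ?ltxx// lte_fin normr_gt0.
  rewrite norm2_lty (_ : \int[mu]_x _ = mu (g @^-1` [set c]))//.
  transitivity (\int[mu]_x (\1_(g @^-1` [set c]) x)%:E); last first.
    by rewrite integral_indic// setIT.
  by apply: eq_integral => x _; rewrite indicE; case: (_ \in _); rewrite ?expr1n ?expr0n.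
- elim: cs ucs => //= c cs IH /andP[ccs ucs]; split; last exact: IH.
  move=> _ /mapP[c' c'cs ->] /=; rewrite -subset0 => x [/= -> E].
  by move: ccs; rewrite E c'cs.
- apply/funext => x; rewrite /step_fun big_map big_filter fimfunE fsbig_finite//=.
  rewrite big_mkcond; apply: eq_bigr => c _ /=.
  by case: eqVneq => //= ->; rewrite mul0r.
Qed.

(** The simple approximations of [h] are truncated to the set where they are
    dominated by [2 |h|], so that dominated convergence applies. *)
Lemma step_dense (h : T -> R) : h \in Lfun mu 2%:E ->
  exists s : nat -> seq (R * set T),
    (forall j, finite_steps (s j) /\ disjoint_steps (s j)) /\
    norm2 mu (step_fun (s j) \- h)%R @[j --> \oo] --> 0.
Proof.
move=> Lh; have mh := Lfun2_measurable Lh.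
have [g gh] := approximation_sfun measurableT
  ((measurable_EFinP _ _).2 mh : measurable_fun [set: T] (EFin \o h)).
(* the approximation is kept only where it is dominated by [h] *)
pose C j := [set x | (`|g j x| <= 2 * `|h x|)%R].
have mC j : measurable (C j).
  rewrite -[C j]setTI; apply: measurable_fun_le => //.
    exact: measurableT_comp.
  by apply: measurable_funM => //; exact: measurableT_comp.
pose G j : {sfun T >-> R} := (indic_sfun _ (mC j) * g j)%R.
have GE j x : G j x = (\1_(C j) x * g j x)%R by [].
have Gb j x : (`|G j x| <= 2 * `|h x|)%R.
  rewrite GE indicE; case: (boolP (x \in C j)); rewrite ?inE ?mul1r//.
  by rewrite mul0r normr0 mulr_ge0.
have L2h : (fun x => 3 * h x)%R \in Lfun mu 2%:E by exact: Lfun2Z.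
have LG j : (G j : T -> R) \in Lfun mu 2%:E.
  apply: (@Lfun2_le _ _ _ _ _ (fun x => 2 * h x)%R) => //; first exact: Lfun2Z.
  by move=> x; rewrite [leRHS]normrM (@ger0_norm _ 2%R).
have /choice[s Hs] : forall j, exists s,
    [/\ finite_steps s, disjoint_steps s & step_fun s = G j :> (T -> R)].
  by move=> j; exact: sfun_steps.
exists s; split; first by move=> j; have [] := Hs j.
have E j : (step_fun (s j) \- h = (G j : T -> R) \- h)%R by have [_ _ ->] := Hs j.
under eq_cvg do rewrite E.
apply: (@norm2_dominated _ _ _ _ _ (fun x => 3 * h x)%R) => //.
- by move=> j; apply: measurable_funB.
- move=> j x; rewrite [leRHS]normrM (@ger0_norm _ 3%R)//.
  rewrite (le_trans (ler_normB _ _))//.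
  rewrite (_ : 3 = 2 + 1)%R; last by lra.
  by rewrite mulrDl mul1r lerD2r.
move=> x; rewrite -(subrr (h x)); apply: cvgB; last exact: cvg_cst.
have gx : g j x @[j --> \oo] --> h x.
  by have /fine_cvg := gh x Logic.I.
have [hx0|hx0] := eqVneq (h x) 0%R.
  rewrite hx0; rewrite (_ : (fun j => _) = cst 0%R); first exact: cvg_cst.
  apply/funext => j /=; apply/eqP; rewrite -normr_le0.
  by rewrite (le_trans (Gb j x))// hx0 normr0 mulr0.
apply: cvg_trans (gx); apply: near_eq_cvg.
have : \forall j \near \oo, (`|h x - g j x| <= `|h x|)%R.
  by move/cvgrPdist_le : gx; apply; rewrite normr_gt0.
apply: filterS => j H; rewrite GE indicE mem_set ?mul1r// /C/=.
rewrite (_ : g j x = h x - (h x - g j x))%R; last by ring.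
rewrite (le_trans (ler_normB _ _))//; lra.
Qed.

End step_approximation.

(** * Expectations of real random variables *)

Section mean.
Context {R : realType} {d : measure_display} {T : measurableType d}.
Variable P : probability T R.
Implicit Types X Y : T -> R.

(** Expectation as a real number, with [has_mean] for integrability, so that
    algebra on expectations takes place in a field. *)
Definition mean X : R := fine (\int[P]_w (X w)%:E)%E.

Definition has_mean X := P.-integrable [set: T] (EFin \o X).

Lemma mean_EFin X : has_mean X -> (mean X)%:E = (\int[P]_w (X w)%:E)%E.
Proof. by move=> iX; rewrite fineK//; exact: integrable_fin_num. Qed.

Lemma has_mean_bounded (M : R) X : measurable_fun [set: T] X ->
  (forall w, `|X w| <= M) -> has_mean X.
Proof.
move=> mX XM; apply: measurable_bounded_integrable => //.
  by rewrite -ge0_fin_numE// fin_num_measure.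
exists M; split; first exact: num_real.
by move=> N MN w _ /=; rewrite (le_trans (XM w))// ltW.
Qed.

Lemma has_mean_le X Y : measurable_fun [set: T] X -> has_mean Y ->
  (forall w, `|X w| <= `|Y w|) -> has_mean X.
Proof.
move=> mX iY XY; apply: le_integrable iY => //; first exact/measurable_EFinP.
by move=> w _; rewrite /= lee_fin.
Qed.

Lemma has_meanD X Y : has_mean X -> has_mean Y -> has_mean (fun w => X w + Y w).
Proof. by move=> iX iY; exact: (integrableD measurableT iX iY). Qed.

Lemma has_meanZ c X : has_mean X -> has_mean (fun w => c * X w).
Proof. by move=> iX; exact: (integrableZl measurableT c iX). Qed.

Lemma has_meanB X Y : has_mean X -> has_mean Y -> has_mean (fun w => X w - Y w).
Proof. by move=> iX iY; exact: (integrableB measurableT iX iY). Qed.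

Lemma has_mean_abs X : has_mean X -> has_mean (fun w => `|X w|).
Proof. by move=> iX; exact: (integrable_norm iX). Qed.

Lemma has_mean_cst c : has_mean (fun=> c).
Proof. by apply: (has_mean_bounded (M := `|c|)). Qed.

Lemma has_mean_sum (I : Type) (r : seq I) (F : I -> T -> R) :
  (forall i, has_mean (F i)) -> has_mean (fun w => \sum_(i <- r) F i w).
Proof.
move=> iF; elim: r => [|i r IH].
  by under eq_fun do rewrite big_nil; exact: has_mean_cst.
by under eq_fun do rewrite big_cons; exact: has_meanD.
Qed.

Lemma mean_cst c : mean (fun=> c) = c.
Proof. by rewrite /mean integral_cst//= [X in (_ * X)%E]probability_setT mule1. Qed.

Lemma meanD X Y : has_mean X -> has_mean Y ->
  mean (fun w => X w + Y w) = mean X + mean Y.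
Proof.
move=> iX iY; apply: EFin_inj; rewrite EFinD !mean_EFin//; last exact: has_meanD.
by rewrite -integralD//.
Qed.

Lemma meanZ c X : has_mean X -> mean (fun w => c * X w) = c * mean X.
Proof.
move=> iX; apply: EFin_inj; rewrite EFinM !mean_EFin//; last exact: has_meanZ.
by rewrite -integralZl//.
Qed.

Lemma meanB X Y : has_mean X -> has_mean Y ->
  mean (fun w => X w - Y w) = mean X - mean Y.
Proof.
move=> iX iY; apply: EFin_inj; rewrite EFinB !mean_EFin//; last exact: has_meanB.
by rewrite -integralB//.
Qed.

Lemma mean_sum (I : Type) (r : seq I) (F : I -> T -> R) :
  (forall i, has_mean (F i)) ->
  mean (fun w => \sum_(i <- r) F i w) = \sum_(i <- r) mean (F i).
Proof.
move=> iF; elim: r => [|i r IH].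
  by under eq_fun do rewrite big_nil; rewrite big_nil mean_cst.
under eq_fun do rewrite big_cons.
by rewrite big_cons -IH meanD//; exact: has_mean_sum.
Qed.

Lemma le_mean X Y : has_mean X -> has_mean Y -> (forall w, X w <= Y w) ->
  mean X <= mean Y.
Proof.
move=> iX iY XY; rewrite -lee_fin !mean_EFin//.
by apply: le_integral => // w _; rewrite lee_fin.
Qed.

Lemma ler_norm_mean X : has_mean X -> `|mean X| <= mean (fun w => `|X w|).
Proof.
move=> iX; rewrite ler_norml; apply/andP; split.
  rewrite lerNl -mulN1r -meanZ//; apply: le_mean.
  - exact: has_meanZ.
  - exact: has_mean_abs.
  - by move=> w; rewrite mulN1r -normrN ler_norm.
apply: le_mean => //; first exact: has_mean_abs.
by move=> w; rewrite ler_norm.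
Qed.

Lemma mean_ge0 X : (forall w, 0 <= X w) -> 0 <= mean X.
Proof.
by move=> X0; rewrite fine_ge0// integral_ge0// => w _; rewrite lee_fin.
Qed.

Lemma mean_ae_eq X Y : measurable_fun [set: T] X -> measurable_fun [set: T] Y ->
  {ae P, forall w, X w = Y w} -> mean X = mean Y.
Proof.
move=> mX mY XY; congr fine; apply: ae_eq_integral => //.
- exact/measurable_EFinP.
- exact/measurable_EFinP.
- by apply: filterS XY => w ->.
Qed.

Lemma has_mean_sqr X : X \in Lfun P 2%:E -> has_mean (fun w => X w ^+ 2).
Proof. exact: Lfun2_integrable_sqr. Qed.

Lemma has_mean_mul X Y : X \in Lfun P 2%:E -> Y \in Lfun P 2%:E ->
  has_mean (fun w => X w * Y w).
Proof.
by move=> LX LY; apply/Lfun1_integrable; exact: Lfun2_mul_Lfun1.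
Qed.

Lemma has_mean_Lfun2 X : X \in Lfun P 2%:E -> has_mean X.
Proof.
move=> LX; have mX := Lfun2_measurable LX.
apply: (@has_mean_le _ (fun w => X w ^+ 2 + 1)) => //.
  by apply: has_meanD; [exact: has_mean_sqr|exact: has_mean_cst].
move=> w; rewrite [leRHS]ger0_norm ?addr_ge0 ?sqr_ge0//.
have := real_normK (num_real (X w)) => <-.
by have := sqr_ge0 (`|X w| - 1); have := normr_ge0 (X w); nra.
Qed.

Lemma Lfun2_bounded (M : R) X : measurable_fun [set: T] X ->
  (forall w, `|X w| <= M) -> X \in Lfun P 2%:E.
Proof.
move=> mX XM; apply: (@Lfun2_le _ _ _ _ _ (cst M)) => //.
  exact: Lfun_cst.
by move=> w; rewrite /= (le_trans (XM w))// ler_norm.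
Qed.

Lemma norm2_mean_sqr X : X \in Lfun P 2%:E ->
  (norm2 P X ^+ 2 = (mean (fun w => X w ^+ 2))%:E)%E.
Proof. by move=> LX; rewrite norm2_sqr mean_EFin//; exact: has_mean_sqr. Qed.

(** Cauchy-Schwarz against the constant [1], in the form
    [|X| <= (X^2 / c + c) / 2] with [c] slightly above [e]. *)
Lemma mean_abs_norm2 X (e : R) : X \in Lfun P 2%:E -> 0 <= e ->
  (norm2 P X <= e%:E)%E -> mean (fun w => `|X w|) <= e.
Proof.
move=> LX e0; rewrite norm2_le_sqr// -(mean_EFin (has_mean_sqr LX)) lee_fin => XE.
apply/ler_addgt0Pr => t t0.
pose c := e + t.
have c0 : 0 < c by rewrite ltr_wpDl.
apply: (@le_trans _ _ (mean (fun w => (2 * c)^-1 * X w ^+ 2 + c / 2))).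
  apply: le_mean.
  - exact/has_mean_abs/has_mean_Lfun2.
  - by apply: has_meanD; [exact/has_meanZ/has_mean_sqr|exact: has_mean_cst].
  - move=> w; rewrite -(real_normK (num_real (X w))).
    rewrite -subr_ge0 (_ : _ - _ = (2 * c)^-1 * (`|X w| - c) ^+ 2).
      by rewrite mulr_ge0 ?sqr_ge0// invr_ge0 mulr_ge0// ltW.
    by field; rewrite gt_eqF.
rewrite meanD; [|exact/has_meanZ/has_mean_sqr|exact: has_mean_cst].
rewrite mean_cst meanZ; last exact: has_mean_sqr.
have ec : e ^+ 2 <= c ^+ 2 by rewrite lerXn2r ?nnegrE// /c; lra.
have : (2 * c)^-1 * mean (fun w => X w ^+ 2) <= (2 * c)^-1 * c ^+ 2.
  by rewrite ler_wpM2l// ?invr_ge0 ?mulr_ge0// ?(ltW c0)// (le_trans XE).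
rewrite (_ : (2 * c)^-1 * c ^+ 2 = c / 2); last by field; rewrite gt_eqF.
by rewrite /c; lra.
Qed.

End mean.

Section independence.
Context {R : realType} {d : measure_display} {T : measurableType d}.
Variable P : probability T R.

Lemma independent_mean (X Y : {RV P >-> R}) (h k : R -> R) :
  independent_RV X Y -> measurable_fun [set: R] h -> measurable_fun [set: R] k ->
  has_mean P (h \o X) -> has_mean P (k \o Y) ->
  mean P (fun w => h (X w) * k (Y w)) = mean P (h \o X) * mean P (k \o Y).
Proof.
move=> XY mh mk ih ik.
pose phi w : (R * R)%type := (X w, Y w).
have mphi : measurable_fun [set: T] phi.
  by apply: measurable_fun_pair; [exact: (measurable_funPT X)|exact: (measurable_funPT Y)].
pose law : {measure set (R * R)%type -> \bar R} :=
  measure_function_pushforward__canonical__measure_function_Measure P mphi.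
pose dX := [the probability _ _ of distribution P X].
pose dY := [the probability _ _ of distribution P Y].
have lawE A : measurable A -> (dX \x dY)%E A = law A.
  by apply: product_measure_unique => U V mU mV; exact: XY.
pose g (z : R * R) := (h z.1 * k z.2)%:E.
have mg : measurable_fun setT g.
  apply/measurable_EFinP; apply: measurable_funM.
    by apply: measurableT_comp => //; exact: measurable_fst.
  by apply: measurableT_comp => //; exact: measurable_snd.
have Ih : dX.-integrable setT (EFin \o h).
  by apply: integrable_pushforward => //; exact/measurable_EFinP.
have Ik : dY.-integrable setT (EFin \o k).
  by apply: integrable_pushforward => //; exact/measurable_EFinP.
have Eh : (\int[dX]_x (h x)%:E = (mean P (h \o X))%:E)%E.
  by rewrite mean_EFin// /dX [LHS]integral_pushforward//; exact/measurable_EFinP.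
have Ek : (\int[dY]_x (k x)%:E = (mean P (k \o Y))%:E)%E.
  by rewrite mean_EFin// /dY [LHS]integral_pushforward//; exact/measurable_EFinP.
have Nh : (\int[dX]_x (`|h x|)%:E < +oo)%E.
  by have /integrableP[_] := Ih.
have Nk : (\int[dY]_x (`|k x|)%:E < +oo)%E.
  by have /integrableP[_] := Ik.
have k0 : (0 <= \int[dY]_x (`|k x|)%:E)%E by exact: integral_ge0.
have LE f : (\int[law]_z f z = \int[dX \x dY]_z f z)%E.
  by apply: eq_measure_integral => A mA _; exact/esym/lawE.
have ig : (dX \x dY)%E.-integrable setT g.
  apply/integrable12ltyP => //.
  have E x : (\int[dY]_y `|g (x, y)| = `|h x|%:E * \int[dY]_y (`|k y|)%:E)%E.
    rewrite -ge0_integralZl//; last first.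
      by apply/measurable_EFinP; exact: measurableT_comp.
    by apply: eq_integral => y _; rewrite /g/= normrM EFinM.
  under eq_integral do rewrite E.
  rewrite ge0_integralZr//; last first.
    by apply/measurable_EFinP; exact: measurableT_comp.
  rewrite lte_mul_pinfty//; first exact: integral_ge0.
  by rewrite ge0_fin_numE//; exact: integral_ge0.
have igl : P.-integrable setT (g \o phi).
  apply/integrableP; split; first exact: measurableT_comp.
  rewrite -(@ge0_integral_pushforward _ _ _ _ _ phi mphi P setT (fun z => `|g z|)%E)//; last first.
    exact: measurableT_comp.
  rewrite LE.
  by have /integrableP[] := ig.
rewrite -[RHS]/(fine (_ * _)%:E) EFinM -Eh -Ek; congr fine.
transitivity (\int[law]_z g z)%E; first by rewrite [RHS]integral_pushforward.
rewrite LE.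
rewrite -(integral12_prod_meas1 ig).
have E x : (\int[dY]_y g (x, y) = (h x)%:E * \int[dY]_y (k y)%:E)%E.
  by rewrite -integralZl.
rewrite /fubini_F; under eq_integral do rewrite E Ek.
by rewrite integralZr// Ek.
Qed.

End independence.

(** * Moments of the normal law *)

Section density.
Context {R : realType} {d : measure_display} {T : measurableType d}.
Import HBNNSimple.
Local Open Scope ereal_scope.

(** Integration against a measure with density, checked on simple functions
    and passed to the limit by monotone convergence. *)
Lemma ge0_integral_density (nu m : {measure set T -> \bar R}) (g f : T -> R) :
  measurable_fun [set: T] g -> (forall x, (0 <= g x)%R) ->
  (forall A, measurable A -> nu A = \int[m]_(x in A) (g x)%:E) ->
  measurable_fun [set: T] f -> (forall x, (0 <= f x)%R) ->
  \int[nu]_x (f x)%:E = \int[m]_x (f x * g x)%:E.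
Proof.
move=> mg g0 nuE mf f0.
have mf' : measurable_fun [set: T] (EFin \o f) by exact/measurable_EFinP.
pose h := nnsfun_approx measurableT mf'.
have hf x : (h k x)%:E @[k --> \oo] --> (f x)%:E.
  by apply: (@cvg_nnsfun_approx _ _ _ _ measurableT _ mf') => // y _; rewrite lee_fin.
have ndh x : {homo (fun k => (h k x)%:E) : a b / (a <= b)%N >-> a <= b}.
  by move=> a b ab; rewrite lee_fin; exact/lefP/nd_nnsfun_approx.
have hE k : \int[nu]_x (h k x)%:E = \int[m]_x (h k x * g x)%:E.
  rewrite integralT_nnsfun sintegralE.
  under [RHS]eq_integral.
    move=> x _; rewrite fimfunE -mulrC EFinM -fsumEFin// ge0_mule_fsumr; last first.
      by move=> y; rewrite EFinM nnfun_muleindic_ge0.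
    over.
  rewrite ge0_integral_fsum//; last 2 first.
  - move=> y; apply: emeasurable_funM; first exact/measurable_EFinP.
    by apply/measurable_EFinP; apply: measurable_funM.
  - by move=> y x _; apply: mule_ge0; [rewrite lee_fin|rewrite EFinM nnfun_muleindic_ge0].
  apply: eq_fsbigr => y; rewrite inE => -[/= t _ <-{y}].
  rewrite nuE; last exact: measurable_sfunP.
  rewrite integral_mkcond.
  rewrite -ge0_integralZl//; last 3 first.
  - apply/(measurable_restrictT _ _).1; first exact: measurable_sfunP.
    by apply/measurable_EFinP; exact: measurable_funTS.
  - by move=> x _; rewrite patchE; case: ifPn; rewrite ?lee_fin.
  - by rewrite lee_fin.
  apply: eq_integral => x _; rewrite patchE indicE.
  by case: ifPn => _; rewrite ?mulr1 ?mulr0 ?mule0// muleC.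
transitivity (limn (fun k => \int[nu]_x (h k x)%:E)).
  rewrite -monotone_convergence//.
  - by apply: eq_integral => x _; apply/esym/cvg_lim => //; exact: hf.
  - by move=> k; exact/measurable_EFinP.
  - by move=> k x _; rewrite lee_fin.
rewrite (_ : (fun k => _) = (fun k => \int[m]_x (h k x * g x)%:E)); last first.
  by apply/funext => k; exact: hE.
rewrite -monotone_convergence//.
- apply: eq_integral => x _; apply/cvg_lim => //.
  have H : (h k x)%:E * (g x)%:E @[k --> \oo] --> (f x)%:E * (g x)%:E.
    by apply: cvgeZr => //; exact: hf.
  exact: H.
- by move=> k; apply/measurable_EFinP; exact: measurable_funM.
- by move=> k x _; rewrite lee_fin mulr_ge0.
- by move=> x _ a b ab; rewrite lee_fin ler_wpM2r// -lee_fin; exact: ndh.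
Qed.

End density.

Section normal.
Context {R : realType}.
Local Open Scope ereal_scope.
Implicit Types (m s : R) (phi : R -> R).

Lemma ge0_integral_normal_prob m s phi : measurable_fun [set: R] phi ->
  (forall x, (0 <= phi x)%R) ->
  \int[normal_prob m s]_x (phi x)%:E =
  \int[lebesgue_measure]_x (phi x * normal_pdf m s x)%:E.
Proof.
move=> mphi phi0; apply: ge0_integral_density => //.
- exact: measurable_normal_pdf.
- exact: normal_pdf_ge0.
Qed.

(** The density of [N(m, s^2)] times [exp((x - m)^2 / (4 s^2))] is [sqrt 2]
    times the density of [N(m, 2 s^2)], so its integral is at most [2].  All
    moments needed below follow, without integrating any of them exactly. *)
Lemma normal_prob_domin m s phi (K : R) : s != 0%R -> (0 <= K)%R ->
  measurable_fun [set: R] phi -> (forall x, (0 <= phi x)%R) ->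
  (forall x, (phi x <= K * expR ((x - m) ^+ 2 / (4 * s ^+ 2)))%R) ->
  \int[normal_prob m s]_x (phi x)%:E <= (2 * K)%:E.
Proof.
move=> s0 K0 mphi phi0 phiK; rewrite ge0_integral_normal_prob//.
pose t := (Num.sqrt 2 * s)%R.
have t2 : (t ^+ 2 = 2 * s ^+ 2)%R by rewrite exprMn sqr_sqrtr.
have t0 : t != 0%R by rewrite mulf_neq0// gt_eqF// sqrtr_gt0.
have s2 : (0 < s ^+ 2)%R by rewrite exprn_even_gt0.
have peak : (normal_peak s <= 2 * normal_peak t)%R.
  rewrite /normal_peak t2.
  set u := (s ^+ 2 * pi *+ 2)%R.
  have u0 : (0 < u)%R by rewrite pmulrn_lgt0// mulr_gt0// pi_gt0.
  have -> : (2 * s ^+ 2 * pi *+ 2 = 2 * u)%R by rewrite /u mulrnAr mulrA.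
  rewrite sqrtrM// invfM mulrA -[leLHS]mul1r ler_wpM2r ?invr_ge0//.
  rewrite ler_pdivlMr ?sqrtr_gt0// mul1r.
  rewrite -[leRHS](@ger0_norm _ 2%R)// -sqrtr_sqr ler_wsqrtr//; lra.
apply: (@le_trans _ _
    (\int[lebesgue_measure]_x ((2 * K) * normal_pdf m t x)%:E)); last first.
  under eq_integral do rewrite EFinM.
  rewrite ge0_integralZl// ?lee_fin ?mulr_ge0//.
  - by rewrite integral_normal_pdf mule1.
  - by apply/measurable_EFinP; exact: measurable_normal_pdf.
  - by move=> x _; rewrite lee_fin normal_pdf_ge0.
apply: ge0_le_integral => //.
- by move=> x _; rewrite lee_fin mulr_ge0// normal_pdf_ge0.
- apply/measurable_EFinP; apply: measurable_funM => //.
  exact: measurable_normal_pdf.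
- apply/measurable_EFinP; apply: measurable_funM => //.
  exact: measurable_normal_pdf.
move=> x _; rewrite lee_fin !normal_pdfE// /normal_fun t2.
set z := ((x - m) ^+ 2 / (4 * s ^+ 2))%R.
have -> : (- (x - m) ^+ 2 / (s ^+ 2 *+ 2) = - z - z)%R.
  by rewrite /z -mulr_natl; field.
have -> : (- (x - m) ^+ 2 / (2 * s ^+ 2 *+ 2) = - z)%R.
  by rewrite /z -mulr_natl; field.
rewrite expRD.
apply: (@le_trans _ _ (K * expR z * (normal_peak s * (expR (- z) * expR (- z)))))%R.
  by rewrite ler_wpM2r ?phiK// mulr_ge0 ?normal_peak_ge0 ?mulr_ge0 ?expR_ge0.
have -> : (K * expR z * (normal_peak s * (expR (- z) * expR (- z))) =
    K * expR (- z) * normal_peak s * (expR z * expR (- z)))%R by ring.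
rewrite -expRD subrr expR0 mulr1.
have -> : (2 * K * (normal_peak t * expR (- z)) =
    K * expR (- z) * (2 * normal_peak t))%R by ring.
by rewrite ler_wpM2l// mulr_ge0// expR_ge0.
Qed.

Lemma integral_normal_prob_abs m s : s != 0%R ->
  \int[normal_prob m s]_x (`|x - m|)%:E <= (4 * `|s|)%:E.
Proof.
move=> s0; have ns0 : (0 < `|s|)%R by rewrite normr_gt0.
rewrite (_ : 4 * `|s| = 2 * (2 * `|s|))%R; last by ring.
apply: normal_prob_domin => //; rewrite ?mulr_ge0//.
  by apply: measurableT_comp => //; exact: measurable_funB.
move=> x; have := expR_ge1Dx ((x - m) ^+ 2 / (4 * s ^+ 2)).
rewrite -[in (_ ^+ 2)%R](real_normK (num_real (x - m))).
rewrite -(real_normK (num_real s)).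
set a := `|x - m|%R; set b := `|s|%R => H.
have {}H : (1 + a ^+ 2 / (4 * b ^+ 2) <= expR (a ^+ 2 / (4 * b ^+ 2)))%R by [].
apply: le_trans (_ : 2 * b * (1 + a ^+ 2 / (4 * b ^+ 2)) <= _)%R; last first.
  by rewrite ler_wpM2l// mulr_ge0// ltW.
have -> : (2 * b * (1 + a ^+ 2 / (4 * b ^+ 2)) = 2 * b + a ^+ 2 / (2 * b))%R.
  by field; rewrite gt_eqF.
rewrite -subr_ge0 (_ : (2 * b + a ^+ 2 / (2 * b) - a =
  ((a - b) ^+ 2 + 3 * b ^+ 2) / (2 * b)))%R; last by field; rewrite gt_eqF.
by rewrite divr_ge0 ?mulr_ge0// ?(ltW ns0)// addr_ge0 ?sqr_ge0// mulr_ge0// sqr_ge0.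
Qed.

Lemma integral_normal_prob_exp4 s : s != 0%R ->
  \int[normal_prob 0 s]_x (x ^+ 4)%:E <= (64 * s ^+ 4)%:E.
Proof.
move=> s0; have s2 : (0 < s ^+ 2)%R by rewrite exprn_even_gt0.
rewrite (_ : 64 * s ^+ 4 = 2 * (32 * s ^+ 4))%R; last by ring.
apply: normal_prob_domin => //.
- by rewrite mulr_ge0// exprn_even_ge0.
- by move=> x; rewrite exprn_even_ge0.
move=> x; rewrite subr0; set z := (x ^+ 2 / (4 * s ^+ 2))%R.
have z0 : (0 <= z)%R by rewrite divr_ge0 ?sqr_ge0// mulr_ge0// sqr_ge0.
have := expR_ge1Dxn 1 z0; rewrite (_ : 2`!%:R = 2 :> R)%R// => H.
have -> : (x ^+ 4 = 32 * s ^+ 4 * (z ^+ 2 / 2))%R.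
  by rewrite /z; field.
apply: ler_wpM2l.
  by apply: mulr_ge0 => //; exact: exprn_even_ge0.
by apply: le_trans H; rewrite lerDr.
Qed.

(** Half of the mass at least lies at distance [s / 2] or more from the mean,
    since the density is at most its peak. *)
Lemma integral_normal_prob_exp2_ge s : s != 0%R ->
  (s ^+ 2 / 8)%:E <= \int[normal_prob 0 s]_x (x ^+ 2)%:E.
Proof.
move=> s0; have s2 : (0 < s ^+ 2)%R by rewrite exprn_even_gt0.
pose A := [set` `[- (`|s| / 2), `|s| / 2]%R] : set R.
have mA : measurable A by exact: measurable_itv.
have PA : normal_prob 0 s A <= (2^-1)%:E.
  apply: (@le_trans _ _ (\int[lebesgue_measure]_(x in A) (normal_peak s)%:E)).
    apply: ge0_le_integral => //.
    - by move=> x _; rewrite lee_fin normal_pdf_ge0.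
    - by apply/measurable_EFinP/measurable_funTS; exact: measurable_normal_pdf.
    - by move=> x _; rewrite lee_fin normal_pdf_ub.
  rewrite integral_cst// /A [X in _ * X]lebesgue_measure_itv/= lte_fin.
  have ns0 : (0 < `|s|)%R by rewrite normr_gt0.
  rewrite ifT; last by lra.
  rewrite -EFinB -EFinM lee_fin opprK -splitr.
  rewrite /normal_peak mulrC ler_pdivrMr ?sqrtr_gt0; last first.
    by rewrite pmulrn_lgt0// mulr_gt0// pi_gt0.
  rewrite mulrC ler_pdivlMr// -[leLHS]ger0_norm ?mulr_ge0// -sqrtr_sqr ler_wsqrtr//.
  rewrite exprMn (real_normK (num_real s)) -mulr_natl.
  have : (s ^+ 2 * 2 <= s ^+ 2 * pi)%R by rewrite ler_wpM2l ?pi_ge2// ltW.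
  by move: (s ^+ 2 * pi)%R => p; lra.
have NA : 1 - (2^-1)%:E <= normal_prob 0 s (~` A).
  rewrite probability_setC// leeB//.
apply: (@le_trans _ _ (\int[normal_prob 0 s]_(x in ~` A) (s ^+ 2 / 4)%:E)).
  rewrite integral_cst; last exact: measurableC.
  apply: le_trans (_ : (s ^+ 2 / 4)%:E * (1 - (2^-1)%:E) <= _); last first.
    by rewrite lee_pmul2l// lte_fin divr_gt0.
  by rewrite -EFinB -EFinM lee_fin; lra.
apply: le_trans (_ : \int[normal_prob 0 s]_(x in ~` A) (x ^+ 2)%:E <= _).
  apply: ge0_le_integral => //.
  - exact: measurableC.
  - by move=> x _; rewrite lee_fin divr_ge0// ltW.
  - by apply/measurable_EFinP/measurable_funTS; exact: measurable_funX.
  move=> x; rewrite /A/= in_itv/= => /negP; rewrite -ler_norml -ltNge => sx.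
  rewrite lee_fin -(real_normK (num_real x)) -(real_normK (num_real s)).
  by have := normr_ge0 s; nra.
apply: ge0_subset_integral => //.
- exact: measurableC.
- by apply/measurable_EFinP; exact: measurable_funX.
- by move=> x _; rewrite lee_fin sqr_ge0.
Qed.

Lemma normal_probN s (U : set R) : s != 0%R -> measurable U ->
  normal_prob 0 s (-%R @^-1` U) = normal_prob 0 s U.
Proof.
move=> s0 mU; rewrite /normal_prob.
have mN : measurable_fun [set: measurableTypeR R] (-%R : _ -> measurableTypeR R).
  exact: oppr_measurable.
transitivity (\int[lebesgue_measure]_(x in (-%R : _ -> measurableTypeR R) @^-1` U)
    ((fun y => (normal_pdf 0 s y)%:E) \o -%R) x).
  apply: eq_integral => x _ /=; rewrite !normal_pdfE// /normal_fun.
  by rewrite !subr0 sqrrN.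
rewrite -(ge0_integral_pushforward mN)//.
- by apply: eq_measure_integral => A mA _; exact: lebesgue_measureN.
- by apply/measurable_EFinP/measurable_funTS; exact: measurable_normal_pdf.
- by move=> x _; rewrite lee_fin normal_pdf_ge0.
Qed.

End normal.

(** * The Gaussian random measure *)

Section gaussian_moments.
Context {R : realType} {n : nat} {d : measure_display} {Omega : measurableType d}.
Context {P : probability Omega R}.
Local Notation T := (space_time R n).
Local Notation mu := (@half_measure R n).
Variable W : set T -> {RV P >-> R}.
Hypothesis HW : gaussian_random_measure W.
Implicit Types (A B : set T) (u : R).

Definition finite_set_of A := measurable A /\ (mu A < +oo)%E.

Definition vol A : R := fine (mu A).

Lemma vol_ge0 A : 0 <= vol A. Proof. by rewrite fine_ge0. Qed.

Lemma volE A : finite_set_of A -> (vol A)%:E = mu A.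
Proof. by move=> [mA fA]; rewrite fineK// ge0_fin_numE. Qed.

Lemma finite_set_ofS A B : measurable B -> B `<=` A -> finite_set_of A ->
  finite_set_of B.
Proof.
move=> mB BA [mA fA]; split=> //; apply: le_lt_trans fA.
by apply: le_measure => //; rewrite inE.
Qed.

Lemma finite_set_ofU A B : finite_set_of A -> finite_set_of B ->
  finite_set_of (A `|` B).
Proof.
move=> [mA fA] [mB fB]; split; first exact: measurableU.
by apply: (le_lt_trans (measureU2 _ mA mB)); rewrite lte_add_pinfty.
Qed.

Lemma set_split A B : A `&` B `|` A `\` B = A.
Proof.
apply/seteqP; split => [x [[]|[]]//|x Ax].
by have [Bx|nBx] := pselect (B x); [left|right].
Qed.

Lemma volU A B : finite_set_of A -> finite_set_of B -> A `&` B = set0 ->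
  vol (A `|` B) = vol A + vol B.
Proof.
move=> [mA fA] [mB fB] AB0; rewrite /vol measureU// fineD// ge0_fin_numE//.
Qed.

Lemma measurable_W A : measurable_fun [set: Omega] (W A).
Proof. exact: measurable_funPT. Qed.
Hint Resolve measurable_W : core.

Lemma Lfun2_W A : finite_set_of A -> (W A : Omega -> R) \in Lfun P 2%:E.
Proof.
move=> [mA fA]; apply/Lfun2P; split => //.
rewrite norm2_lty; have := grm_variance HW mA fA; rewrite unlock => ->.
exact: fA.
Qed.

Lemma mean_W2 A : finite_set_of A -> mean P (fun w => W A w ^+ 2) = vol A.
Proof.
move=> [mA fA]; congr fine.
by have := grm_variance HW mA fA; rewrite unlock.
Qed.

Lemma ge0_integral_W A s (phi : R -> R) :
  (forall U, measurable U -> distribution P (W A) U = normal_prob 0 s U) ->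
  measurable_fun [set: R] phi -> (forall x, 0 <= phi x) ->
  (\int[P]_w (phi (W A w))%:E = \int[normal_prob 0 s]_x (phi x)%:E)%E.
Proof.
move=> sE mphi phi0.
have mW : measurable_fun [set: Omega] (W A : Omega -> measurableTypeR R).
  exact: measurable_W.
rewrite -[LHS](@ge0_integral_pushforward _ _ _ _ _ _ mW P setT (EFin \o phi))//.
- by apply: eq_measure_integral => U mU _; exact: sE.
- exact/measurable_EFinP.
- by move=> x _; rewrite lee_fin.
Qed.

(** The parameter of the law of [W A] is only compared with the variance: this
    suffices for the bound of fourth moments, and the exact characteristic
    function comes later from [cos_meanE]. *)
Lemma W_law A : finite_set_of A -> (vol A = 0 /\ {ae P, forall w, W A w = 0}) \/
  exists s : R, [/\ s != 0, s ^+ 2 <= 8 * vol A &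
  forall U, measurable U -> distribution P (W A) U = normal_prob 0 s U].
Proof.
move=> fA; have [mA lA] := fA; have [s Hs] := grm_gaussian HW mA lA.
have [s0|s0] := eqVneq s 0; [left|right].
  have W0 : {ae P, forall w, W A w = 0}.
    exists (W A @^-1` (~` [set 0])); split.
    - by rewrite -[X in measurable X]setTI; apply: measurable_W => //; exact: measurableC.
    - have := Hs (~` [set 0]) (measurableC (measurable_set1 _)).
      by rewrite s0 eqxx diracE memNset//= => /(_ erefl).
    - by move=> w.
  split => //; rewrite -mean_W2// -(mean_cst P 0); apply: mean_ae_eq => //.
    exact: measurable_funX.
  by apply: filterS W0 => w ->; rewrite expr0n.
exists s; split => //; last by move=> U mU; rewrite Hs// (negbTE s0).
have : ((s ^+ 2 / 8)%:E <= (vol A)%:E)%E.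
  rewrite -mean_W2// mean_EFin; last exact/has_mean_sqr/Lfun2_W.
  rewrite (@ge0_integral_W A s (fun x => x ^+ 2)).
  - exact: integral_normal_prob_exp2_ge.
  - by move=> U mU; rewrite Hs// (negbTE s0).
  - exact: measurable_funX.
  - by move=> x; rewrite sqr_ge0.
by rewrite lee_fin; lra.
Qed.

Lemma W_exp4 A : finite_set_of A ->
  has_mean P (fun w => W A w ^+ 4) /\
  mean P (fun w => W A w ^+ 4) <= 64 * (64 * vol A ^+ 2).
Proof.
move=> fA; have mW4 : measurable_fun [set: Omega] (fun w => W A w ^+ 4).
  exact: measurable_funX.
have [[A0 W0]|[s [s0 s8 sE]]] := W_law fA.
  have E : {ae P, forall w, W A w ^+ 4 = 0}.
    by apply: filterS W0 => w ->; rewrite expr0n.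
  split.
    apply/integrableP; split; first exact/measurable_EFinP.
    rewrite (ae_eq_integral (cst 0)%E)//; first by rewrite integral0.
    - by apply: measurableT_comp => //; exact/measurable_EFinP.
    - by apply: filterS E => w Ew _ /=; rewrite Ew normr0.
  rewrite (@mean_ae_eq _ _ _ _ _ (cst 0))// mean_cst.
  by do 2 apply: mulr_ge0 => //; exact: sqr_ge0.
have I4 : (\int[P]_w (W A w ^+ 4)%:E <= (64 * s ^+ 4)%:E)%E.
  rewrite (@ge0_integral_W _ _ (fun x => x ^+ 4) sE).
  - exact: integral_normal_prob_exp4.
  - exact: measurable_funX.
  - by move=> x; rewrite exprn_even_ge0.
have H : has_mean P (fun w => W A w ^+ 4).
  apply/integrableP; split; first exact/measurable_EFinP.
  apply: le_lt_trans (ltry (64 * s ^+ 4)); apply: le_trans I4.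
  apply: ge0_le_integral => //.
  - by apply: measurableT_comp => //; exact/measurable_EFinP.
  - exact/measurable_EFinP.
  - by move=> w _; rewrite lee_fin ger0_norm// exprn_even_ge0.
split => //; rewrite -lee_fin mean_EFin//; apply: (le_trans I4).
rewrite lee_fin; apply: ler_wpM2l => //.
have := sqr_ge0 s; have -> : s ^+ 4 = (s ^+ 2) ^+ 2 by ring.
by move: (s ^+ 2) s8 => v v8 v0; nra.
Qed.

Lemma Lfun2_W2 A : finite_set_of A -> (fun w => W A w ^+ 2) \in Lfun P 2%:E.
Proof.
move=> fA; apply/Lfun2P; split; first exact: measurable_funX.
rewrite norm2_lty; have [/integrableP[_ W4] _] := W_exp4 fA.
rewrite (_ : (\int[P]_w _)%E = (\int[P]_w `|(EFin \o (fun w => W A w ^+ 4)%R) w|)%E)//.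
by apply: eq_integral => w _; rewrite /= -exprM ger0_norm// exprn_even_ge0.
Qed.

Lemma has_mean_cos (X : Omega -> R) : measurable_fun [set: Omega] X ->
  has_mean P (fun w => cos (X w)).
Proof.
move=> mX; apply: (@has_mean_bounded _ _ _ _ 1).
  apply: measurableT_comp => //; apply: continuous_measurable_fun.
  exact: continuous_cos.
by move=> w; rewrite ler_norml cos_geN1 cos_le1.
Qed.

Lemma has_mean_sin (X : Omega -> R) : measurable_fun [set: Omega] X ->
  has_mean P (fun w => sin (X w)).
Proof.
move=> mX; apply: (@has_mean_bounded _ _ _ _ 1).
  apply: measurableT_comp => //; apply: continuous_measurable_fun.
  exact: continuous_sin.
by move=> w; rewrite ler_norml sin_geN1 sin_le1.
Qed.

(** A centered normal law is symmetric. *)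
Lemma mean_sin_W A u : finite_set_of A -> mean P (fun w => sin (u * W A w)) = 0.
Proof.
move=> fA; pose f x := sin (u * x).
have mf : measurable_fun [set: R] f.
  apply: measurableT_comp; last exact: measurable_funM.
  by apply: continuous_measurable_fun; exact: continuous_sin.
have [[A0 W0]|[s [s0 s8 sE]]] := W_law fA.
  rewrite -[RHS](mean_cst P 0); apply: mean_ae_eq => //.
    exact: (measurableT_comp mf (measurable_W A)).
  by apply: filterS W0 => w ->; rewrite mulr0 sin0.
have iW : has_mean P (f \o W A).
  by apply: has_mean_sin; exact: measurable_funM.
have iN : has_mean P (fun w => f (- W A w)).
  by apply: has_mean_sin; apply: measurable_funM => //; exact: measurableT_comp.
suff : mean P (f \o W A) = mean P (fun w => f (- W A w)).
  have -> : (fun w => f (- W A w)) = (fun w => (-1) * (f \o W A) w).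
    by apply/funext => w; rewrite /f/= mulrN sinN mulN1r.
  by rewrite meanZ// => H; rewrite -[LHS]/(mean P (f \o W A)); lra.
have mW : measurable_fun [set: Omega] (W A : Omega -> measurableTypeR R).
  exact: measurable_W.
have mNW : measurable_fun [set: Omega] (fun w => - W A w : measurableTypeR R).
  by apply: measurableT_comp.
have mEf : measurable_fun [set: measurableTypeR R] (EFin \o f).
  exact/measurable_EFinP.
rewrite /mean; congr fine.
have E1 := @integral_pushforward _ _ _ _ _ _ mW P setT (EFin \o f) mEf iW measurableT.
have E2 := @integral_pushforward _ _ _ _ _ _ mNW P setT (EFin \o f) mEf iN measurableT.
rewrite -[LHS]E1 -[RHS]E2.
apply: eq_measure_integral => U mU _.
have HU : P (W A @^-1` U) = normal_prob 0 s U by exact: sE.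
have HN : P (W A @^-1` (-%R @^-1` U)) = normal_prob 0 s (-%R @^-1` U).
  by apply: sE; rewrite -[X in measurable X]setTI; exact: oppr_measurable.
apply: (etrans HU); rewrite -normal_probN//; exact: (esym HN).
Qed.

Lemma W_additive A B : finite_set_of A -> finite_set_of B -> A `&` B = set0 ->
  {ae P, forall w, W (A `|` B) w = W A w + W B w}.
Proof. by move=> [mA fA] [mB fB]; exact: (grm_additive HW). Qed.

Lemma W_independent A B : finite_set_of A -> finite_set_of B -> A `&` B = set0 ->
  independent_RV (W A) (W B).
Proof. by move=> [mA fA] [mB fB]; exact: (grm_independent HW). Qed.

Lemma mean_W_orthogonal A B : finite_set_of A -> finite_set_of B ->
  A `&` B = set0 -> mean P (fun w => W A w * W B w) = 0.
Proof.
move=> fA fB AB0; have LA := Lfun2_W fA; have LB := Lfun2_W fB.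
have H : mean P (fun w => W (A `|` B) w ^+ 2) =
    mean P (fun w => W A w ^+ 2 + W B w ^+ 2 + 2 * (W A w * W B w)).
  apply: mean_ae_eq.
  - exact: measurable_funX.
  - by apply: measurable_funD; [apply: measurable_funD; exact: measurable_funX|
      apply: measurable_funM => //; exact: measurable_funM].
  - by apply: filterS (W_additive fA fB AB0) => w ->; ring.
move: H; rewrite mean_W2; last exact: finite_set_ofU.
rewrite volU// meanD; last 2 first.
- by apply: has_meanD; exact: has_mean_sqr.
- exact/has_meanZ/has_mean_mul.
rewrite meanD ?meanZ ?mean_W2//; try exact: has_mean_sqr; last exact: has_mean_mul.
by lra.
Qed.

(** Decompose [A] and [B] into [A `&` B] and the two differences. *)
Lemma mean_W_cov A B : finite_set_of A -> finite_set_of B ->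
  mean P (fun w => W A w * W B w) = vol (A `&` B).
Proof.
move=> fA fB; have [mA _] := fA; have [mB _] := fB.
have fI : finite_set_of (A `&` B).
  by apply: finite_set_ofS fA; [exact: measurableI|exact: subIsetl].
have fAB : finite_set_of (A `\` B).
  by apply: finite_set_ofS fA; [exact: measurableD|exact: subDsetl].
have fBA : finite_set_of (B `\` A).
  by apply: finite_set_ofS fB; [exact: measurableD|exact: subDsetl].
have d1 : A `&` B `&` (A `\` B) = set0.
  by rewrite -subset0 => x [[_ Bx] [_]].
have d2 : A `&` B `&` (B `\` A) = set0.
  by rewrite -subset0 => x [[Ax _] [_]].
have d3 : (A `\` B) `&` (B `\` A) = set0.
  by rewrite -subset0 => x [[Ax _] [_]].
have EA : {ae P, forall w, W A w = W (A `&` B) w + W (A `\` B) w}.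
  by have := W_additive fI fAB d1; rewrite set_split.
have EB : {ae P, forall w, W B w = W (A `&` B) w + W (B `\` A) w}.
  by have := W_additive fI fBA d2; rewrite (setIC A B) set_split.
have LI := Lfun2_W fI; have LA := Lfun2_W fAB; have LB := Lfun2_W fBA.
transitivity (mean P (fun w => W (A `&` B) w ^+ 2 +
   (W (A `&` B) w * W (B `\` A) w + (W (A `&` B) w * W (A `\` B) w +
    W (A `\` B) w * W (B `\` A) w)))).
  apply: mean_ae_eq.
  - exact: measurable_funM.
  - by apply: measurable_funD; [exact: measurable_funX|
      apply: measurable_funD; [exact: measurable_funM|
      apply: measurable_funD; exact: measurable_funM]].
  - by apply: filterS2 EA EB => w -> ->; ring.
rewrite meanD; [|exact: has_mean_sqr|by do ! apply: has_meanD; exact: has_mean_mul].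
rewrite meanD; [|exact: has_mean_mul|by apply: has_meanD; exact: has_mean_mul].
rewrite meanD; [|exact: has_mean_mul|exact: has_mean_mul].
by rewrite mean_W2// !mean_W_orthogonal// !addr0.
Qed.

End gaussian_moments.

(** * The isometry on step functions *)

Section step_isometry.
Context {R : realType} {n : nat} {d : measure_display} {Omega : measurableType d}.
Context {P : probability Omega R}.
Local Notation T := (space_time R n).
Local Notation mu := (@half_measure R n).
Variable W : set T -> {RV P >-> R}.
Hypothesis HW : gaussian_random_measure W.
Implicit Types (s t : seq (R * set T)).

Lemma nth_finite_steps s (k : 'I_(size s)) : finite_steps s ->
  finite_set_of (nth (0, set0) s k).2.
Proof. by move=> fs; apply: fs; rewrite mem_nth. Qed.

Lemma step_funE s p : step_fun s p =
  \sum_(k < size s) (nth (0, set0) s k).1 * \1_((nth (0, set0) s k).2) p.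
Proof. by rewrite /step_fun (big_nth (0, set0)) big_mkord. Qed.

Lemma step_integralE s w : step_integral W s w =
  \sum_(k < size s) (nth (0, set0) s k).1 * W (nth (0, set0) s k).2 w.
Proof. by rewrite /step_integral (big_nth (0, set0)) big_mkord. Qed.

Lemma Lfun2_step_integral s : finite_steps s -> step_integral W s \in Lfun P 2%:E.
Proof.
move=> fs; rewrite (_ : step_integral W s = fun w =>
  \sum_(k < size s) (nth (0, set0) s k).1 * W (nth (0, set0) s k).2 w); last first.
  by apply/funext => w; rewrite step_integralE.
by apply: Lfun2_sum => k; apply: Lfun2Z; apply: Lfun2_W => //; exact: nth_finite_steps.
Qed.

Lemma measurable_step_integral s : measurable_fun [set: Omega] (step_integral W s).
Proof.
rewrite /step_integral; apply: measurable_sum => i.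
by apply: measurable_funM => //; exact: measurable_funPT.
Qed.

Lemma mean_sqr_sum (N : nat) (c : 'I_N -> R) (A : 'I_N -> set T) :
  (forall k, finite_set_of (A k)) ->
  mean P (fun w => (\sum_k c k * W (A k) w) ^+ 2) =
  \sum_k \sum_l c k * c l * vol (A k `&` A l).
Proof.
move=> fA.
have H k l : has_mean P (fun w => c k * c l * (W (A k) w * W (A l) w)).
  by apply/has_meanZ/has_mean_mul; exact: Lfun2_W.
transitivity (mean P (fun w => \sum_k \sum_l c k * c l * (W (A k) w * W (A l) w))).
  congr (mean P _); apply/funext => w; rewrite expr2 big_distrlr/=.
  by apply: eq_bigr => k _; apply: eq_bigr => l _; ring.
rewrite mean_sum; last by move=> k; apply: has_mean_sum => l; exact: H.
apply: eq_bigr => k _; rewrite mean_sum//; apply: eq_bigr => l _.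
by rewrite meanZ ?mean_W_cov//; apply: has_mean_mul; exact: Lfun2_W.
Qed.

Lemma integral_sqr_sum (N : nat) (c : 'I_N -> R) (A : 'I_N -> set T) :
  (forall k, finite_set_of (A k)) ->
  (\int[mu]_p ((\sum_k c k * \1_(A k) p) ^+ 2)%:E =
  (\sum_k \sum_l c k * c l * vol (A k `&` A l))%:E)%E.
Proof.
move=> fA.
have fI k l : finite_set_of (A k `&` A l).
  apply: finite_set_ofS (fA k); last exact: subIsetl.
  by apply: measurableI; [case: (fA k)|case: (fA l)].
have I1 k l : mu.-integrable setT (fun p => (\1_(A k `&` A l) p : R)%:E).
  apply/integrableP; have [mI lI] := fI k l; split.
    by apply/measurable_EFinP; exact: measurable_indic.
  under eq_integral do rewrite gee0_abs ?lee_fin//.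
  by rewrite integral_indic// setIT.
have I2 k l : mu.-integrable setT (fun p => (c k * c l * \1_(A k `&` A l) p)%:E).
  exact: (integrableZl measurableT (c k * c l) (I1 k l)).
transitivity (\int[mu]_p (\sum_k \sum_l (c k * c l * \1_(A k `&` A l) p)%:E))%E.
  apply: eq_integral => p _.
  under [RHS]eq_bigr do rewrite sumEFin.
  rewrite sumEFin; congr EFin; rewrite expr2 big_distrlr/=.
  by apply: eq_bigr => k _; apply: eq_bigr => l _; rewrite indicI/=; ring.
rewrite integral_sum//; last by move=> k; apply: integrable_sum.
rewrite -sumEFin; apply: eq_bigr => k _.
rewrite integral_sum//; rewrite -sumEFin; apply: eq_bigr => l _.
under eq_integral do rewrite EFinM.
rewrite integralZl// integral_indic//; last by case: (fI k l).
rewrite setIT [RHS]EFinM; congr (_ * _)%E; exact/esym/volE.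
Qed.

(** Both sides are the quadratic form with matrix [vol (A k `&` A l)]. *)
Lemma step_isometry s : finite_steps s ->
  norm2 P (step_integral W s) = norm2 mu (step_fun s).
Proof.
move=> fs; rewrite !norm2E; congr sqrte.
rewrite -mean_EFin; last exact/has_mean_sqr/Lfun2_step_integral.
under eq_fun do rewrite step_integralE.
rewrite mean_sqr_sum; last by move=> k; exact: nth_finite_steps.
rewrite -integral_sqr_sum; last by move=> k; exact: nth_finite_steps.
by apply: eq_integral => p _; rewrite step_funE.
Qed.

Lemma Lfun2_step_fun s : finite_steps s -> step_fun s \in Lfun mu 2%:E.
Proof.
move=> fs; apply/Lfun2P; split; first exact: measurable_step_fun.
by rewrite -step_isometry//; case/Lfun2P: (Lfun2_step_integral fs).
Qed.

Definition step_scale (a : R) s := [seq (a * i.1, i.2) | i <- s].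

Lemma finite_steps_scale a s : finite_steps s -> finite_steps (step_scale a s).
Proof. by move=> fs _ /mapP[i is_ ->] /=; exact: fs. Qed.

Lemma finite_steps_cat s t : finite_steps s -> finite_steps t -> finite_steps (s ++ t).
Proof. by move=> fs ft i; rewrite mem_cat => /orP[/fs|/ft]. Qed.

Lemma step_fun_scale a s p : step_fun (step_scale a s) p = a * step_fun s p.
Proof.
by rewrite /step_fun big_map mulr_sumr; apply: eq_bigr => i _; rewrite mulrA.
Qed.

Lemma step_integral_scale a s w :
  step_integral W (step_scale a s) w = a * step_integral W s w.
Proof.
by rewrite /step_integral big_map mulr_sumr; apply: eq_bigr => i _; rewrite mulrA.
Qed.

Lemma step_fun_cat s t p : step_fun (s ++ t) p = step_fun s p + step_fun t p.
Proof. by rewrite /step_fun big_cat. Qed.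

Lemma step_integral_cat s t w :
  step_integral W (s ++ t) w = step_integral W s w + step_integral W t w.
Proof. by rewrite /step_integral big_cat. Qed.

Lemma step_isometryB s t : finite_steps s -> finite_steps t ->
  norm2 P (step_integral W s \- step_integral W t) =
  norm2 mu (step_fun s \- step_fun t).
Proof.
move=> fs ft; have := @step_isometry (s ++ step_scale (-1) t).
have -> : step_fun (s ++ step_scale (-1) t) = step_fun s \- step_fun t.
  by apply/funext => p; rewrite step_fun_cat step_fun_scale mulN1r.
have -> : step_integral W (s ++ step_scale (-1) t) = step_integral W s \- step_integral W t.
  by apply/funext => p; rewrite step_integral_cat step_integral_scale mulN1r.
by apply; apply: finite_steps_cat => //; exact: finite_steps_scale.
Qed.

End step_isometry.

(** * The Wiener integral *)

Section wiener.
Context {R : realType} {n : nat} {d : measure_display} {Omega : measurableType d}.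
Context {P : probability Omega R}.
Local Notation T := (space_time R n).
Local Notation mu := (@half_measure R n).
Variable W : set T -> {RV P >-> R}.
Hypothesis HW : gaussian_random_measure W.
Implicit Types (s t : seq (R * set T)) (h : T -> R) (I : Omega -> R).
Local Open Scope ereal_scope.

(** By the isometry the integrals of a Cauchy sequence form a Cauchy
    sequence; a subsequence converges geometrically. *)
Lemma norm2_step_cvg (sj : nat -> seq (R * set T)) h :
  (forall j, finite_steps (sj j)) -> h \in Lfun mu 2%:E ->
  norm2 mu (step_fun (sj j) \- h)%R @[j --> \oo] --> 0 ->
  exists I, I \in Lfun P 2%:E /\
    norm2 P (step_integral W (sj j) \- I)%R @[j --> \oo] --> 0.
Proof.
move=> fs Lh sh; have mh := Lfun2_measurable Lh.
have msj j := measurable_step_fun (fs j).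
have mIj j := measurable_step_integral W (sj j).
have dist i j : norm2 P (step_integral W (sj i) \- step_integral W (sj j))%R <=
    norm2 mu (step_fun (sj i) \- h)%R + norm2 mu (step_fun (sj j) \- h)%R.
  rewrite (step_isometryB HW)// (norm2BC mu (step_fun (sj j))).
  exact: norm2_triangle.
pose e k : R := (2^-1 * 2^-1 ^+ k)%R.
have e0 k : (0 < e k)%R by rewrite mulr_gt0// exprn_gt0.
have /choice[N HN] : forall k, exists N : nat, forall j, (N <= j)%N ->
    norm2 mu (step_fun (sj j) \- h)%R <= (e k)%:E.
  by move=> k; have [N _ HN] := cvge0_near sh (e0 k); exists N => j /HN.
pose phi k := (\max_(i < k.+1) N i)%N.
have phiN k j : (k <= j)%N -> (N k <= phi j)%N.
  move=> kj; rewrite -ltnS in kj.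
  exact: (@leq_bigmax _ (fun i : 'I_j.+1 => N i) (Ordinal kj)).
have ephi k : norm2 mu (step_fun (sj (phi k)) \- h)%R <= (e k)%:E.
  by apply: HN; exact: phiN.
have [||I [LI YI]] := @L2_complete _ _ _ P (fun k => step_integral W (sj (phi k))).
- by move=> k; exact: Lfun2_step_integral.
- move=> k; apply: (le_trans (dist _ _)).
  apply: (@le_trans _ _ ((e k)%:E + (e k)%:E)).
    by apply: leeD => //; apply: HN; exact: phiN.
  by rewrite -EFinD lee_fin /e; move: (2^-1 ^+ k)%R => v; lra.
exists I; split => //; have mI := Lfun2_measurable LI.
apply: cvge0_le => [j|u u0]; first exact: norm2_ge0.
have u3 : (0 < u / 3)%R by rewrite divr_gt0.
have [N1 _ H1] := cvge0_near sh u3.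
have [N2 _ H2] := cvge0_near YI u3.
near=> j.
have [k [kN2 kphi]] : exists k, (N2 <= k)%N /\ norm2 mu (step_fun (sj (phi k)) \- h)%R <= (u / 3)%:E.
  have [K _ HK] : \forall k \near \oo, (e k <= u / 3)%R.
    have : (fun k => (2^-1 : R) ^+ k)%R @ \oo --> (0 : R)%R.
      by apply: cvg_expr; rewrite ger0_norm//; lra.
    move/cvgrPdist_le => /(_ _ u3); apply: filterS => k.
    rewrite sub0r normrN ger0_norm ?exprn_ge0// => H.
    by rewrite /e (le_trans _ H)// ler_piMl ?exprn_ge0//; lra.
  exists (maxn N2 K); split; first exact: leq_maxl.
  by apply: (le_trans (ephi _)); rewrite lee_fin; apply: HK; exact: leq_maxr.
apply: le_trans (norm2_triangle P (mIj j) (mIj (phi k)) mI) _.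
apply: (@le_trans _ _ (((u / 3)%:E + (u / 3)%:E) + (u / 3)%:E)).
  apply: leeD; last by apply: H2.
  apply: (le_trans (dist _ _)); apply: leeD => //.
  by apply: H1; near: j; exists N1.
by rewrite -!EFinD lee_fin; lra.
Unshelve. all: by end_near. Qed.

Lemma is_wienerP h I : is_wiener_integral W h I <-> I \in Lfun P 2%:E /\
  exists sj : nat -> seq (R * set T), [/\ forall j, finite_steps (sj j),
    norm2 mu (step_fun (sj j) \- h)%R @[j --> \oo] --> 0 &
    norm2 P (step_integral W (sj j) \- I)%R @[j --> \oo] --> 0].
Proof. by split=> -[LI [s [? ? ?]]]; split => //; exists s; split. Qed.

(** The isometry passes to the limit, for arbitrary approximating sequences on
    both sides; uniqueness, linearity and continuity of the integral all come
    from here. *)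
Lemma wiener_dist h h' I I' : measurable_fun [set: T] h -> measurable_fun [set: T] h' ->
  is_wiener_integral W h I -> is_wiener_integral W h' I' ->
  norm2 P (I \- I')%R <= norm2 mu (h \- h')%R.
Proof.
move=> mh mh' /is_wienerP[LI [s [fs sh sI]]] /is_wienerP[LI' [s' [fs' sh' sI']]].
have mI := Lfun2_measurable LI; have mI' := Lfun2_measurable LI'.
apply/lee_addgt0Pr => u u0; have u4 : (0 < u / 4)%R by rewrite divr_gt0.
have [N1 _ H1] := cvge0_near sh u4.
have [N2 _ H2] := cvge0_near sI u4.
have [N3 _ H3] := cvge0_near sh' u4.
have [N4 _ H4] := cvge0_near sI' u4.
pose N := maxn (maxn N1 N2) (maxn N3 N4).
have {}H1 := H1 N (leq_trans (leq_maxl _ _) (leq_maxl _ _)).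
have {}H2 := H2 N (leq_trans (leq_maxr _ _) (leq_maxl _ _)).
have {}H3 := H3 N (leq_trans (leq_maxl _ _) (leq_maxr _ _)).
have {}H4 := H4 N (leq_trans (leq_maxr _ _) (leq_maxr _ _)).
have mS := measurable_step_integral W (s N).
have mS' := measurable_step_integral W (s' N).
have ms := measurable_step_fun (fs N).
have ms' := measurable_step_fun (fs' N).
apply: le_trans (norm2_triangle P mI mS mI') _.
apply: le_trans (leeD2l _ (norm2_triangle P mS mS' mI')) _.
rewrite norm2BC (step_isometryB HW)//.
apply: le_trans (leeD2l _ (leeD2r _ (norm2_triangle mu ms mh ms'))) _.
apply: le_trans (leeD2l _ (leeD2r _ (leeD2l _ (norm2_triangle mu mh mh' ms')))) _.
rewrite (norm2BC mu h').
apply: le_trans (leeD H2 (leeD (leeD H1 (leeD2l _ H3)) H4)) _.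
have := norm2_ge0 mu (h \- h')%R.
case: (norm2 mu (h \- h')%R) => [r _| |]; last by [].
  by rewrite -!EFinD lee_fin; lra.
by move=> _; rewrite addye// leey.
Qed.

Lemma wiener_comb h h' I I' (a b : R) : measurable_fun [set: T] h ->
  measurable_fun [set: T] h' ->
  is_wiener_integral W h I -> is_wiener_integral W h' I' ->
  is_wiener_integral W (fun p => a * h p + b * h' p)%R (fun w => a * I w + b * I' w)%R.
Proof.
move=> mh mh' /is_wienerP[LI [s [fs sh sI]]] /is_wienerP[LI' [s' [fs' sh' sI']]].
have mI := Lfun2_measurable LI; have mI' := Lfun2_measurable LI'.
have comb (d1 : measure_display) (U : measurableType d1) (m : {measure set U -> \bar R})
    (F F' : nat -> U -> R) (G G' : U -> R) : (forall j, measurable_fun [set: U] (F j)) ->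
    (forall j, measurable_fun [set: U] (F' j)) ->
    measurable_fun [set: U] G -> measurable_fun [set: U] G' ->
    norm2 m (F j \- G)%R @[j --> \oo] --> 0 ->
    norm2 m (F' j \- G')%R @[j --> \oo] --> 0 ->
    norm2 m ((fun x => a * F j x + b * F' j x) \- (fun x => a * G x + b * G' x))%R
      @[j --> \oo] --> 0.
  move=> mF mF' mG mG' FG FG'.
  apply: (@cvge0_squeeze _ _ (fun j => `|a|%:E * norm2 m (F j \- G)%R +
      `|b|%:E * norm2 m (F' j \- G')%R)).
  - by move=> j; exact: norm2_ge0.
  - move=> j; rewrite -!norm2Z; [|exact: measurable_funB|exact: measurable_funB].
    rewrite (_ : (_ \- _)%R = ((fun x => a * (F j \- G) x) \+
      (fun x => b * (F' j \- G') x))%R); last by apply/funext => x /=; ring.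
    by apply: norm2D; apply: measurable_funM => //; exact: measurable_funB.
  have c1 : `|a|%:E * norm2 m (F j \- G)%R @[j --> \oo] --> `|a|%:E * 0.
    exact: cvgeZl.
  have c2 : `|b|%:E * norm2 m (F' j \- G')%R @[j --> \oo] --> `|b|%:E * 0.
    exact: cvgeZl.
  rewrite mule0 in c1; rewrite mule0 in c2.
  by have := cvgeD _ c1 c2; rewrite adde0; exact.
apply/is_wienerP; split; first by apply: Lfun2D; exact: Lfun2Z.
exists (fun j => step_scale a (s j) ++ step_scale b (s' j)); split.
- by move=> j; apply: finite_steps_cat; exact: finite_steps_scale.
- rewrite (_ : (fun j => _) = (fun j => norm2 mu ((fun x => a * step_fun (s j) x +
     b * step_fun (s' j) x) \- (fun x => a * h x + b * h' x))%R)); last first.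
    apply/funext => j; congr (norm2 mu _); apply/funext => p /=.
    by rewrite step_fun_cat !step_fun_scale.
  by apply: comb => // j; exact: measurable_step_fun.
- rewrite (_ : (fun j => _) = (fun j => norm2 P ((fun x => a * step_integral W (s j) x +
     b * step_integral W (s' j) x) \- (fun x => a * I x + b * I' x))%R)); last first.
    apply/funext => j; congr (norm2 P _); apply/funext => p /=.
    by rewrite step_integral_cat !step_integral_scale.
  by apply: comb => // j; exact: measurable_step_integral.
Qed.

Lemma wiener_integralP h : h \in Lfun mu 2%:E ->
  is_wiener_integral W h (wiener_integral W h).
Proof.
move=> Lh; apply: xgetPex.
have [s [fs sh]] := step_dense Lh.
have [I [LI sI]] := norm2_step_cvg (fun j => (fs j).1) Lh sh.
by exists I; apply/is_wienerP; split => //; exists s; split => // j; have [] := fs j.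
Qed.

Lemma Lfun2_wiener h : h \in Lfun mu 2%:E -> wiener_integral W h \in Lfun P 2%:E.
Proof. by move/wiener_integralP => []. Qed.

Lemma measurable_wiener h : h \in Lfun mu 2%:E ->
  measurable_fun [set: Omega] (wiener_integral W h).
Proof. by move/Lfun2_wiener/Lfun2_measurable. Qed.

Lemma wiener_unique h I I' : measurable_fun [set: T] h ->
  is_wiener_integral W h I -> is_wiener_integral W h I' ->
  {ae P, forall w, I w = I' w}.
Proof.
move=> mh HI HI'; have := wiener_dist mh mh HI HI'.
have -> : norm2 mu (h \- h)%R = 0.
  rewrite norm2E; under eq_integral do rewrite /= subrr expr0n.
  by rewrite integral0 sqrte0.
have mI : measurable_fun [set: Omega] I by case: HI => /Lfun2_measurable.
have mI' : measurable_fun [set: Omega] I' by case: HI' => /Lfun2_measurable.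
move=> H; have {H} : norm2 P (I \- I')%R = 0.
  by apply/eqP; rewrite eq_le H norm2_ge0.
move/norm2_eq0 => /(_ (measurable_funB mI mI')).
by apply: filterS => w /= /eqP; rewrite subr_eq0 => /eqP.
Qed.

Lemma wiener_integral_comb h h' (a b : R) : h \in Lfun mu 2%:E -> h' \in Lfun mu 2%:E ->
  {ae P, forall w, wiener_integral W (fun p => a * h p + b * h' p)%R w =
    (a * wiener_integral W h w + b * wiener_integral W h' w)%R}.
Proof.
move=> Lh Lh'; have L : (fun p => a * h p + b * h' p)%R \in Lfun mu 2%:E.
  by apply: Lfun2D; exact: Lfun2Z.
apply: (wiener_unique (Lfun2_measurable L)); first exact: wiener_integralP.
by apply: wiener_comb; [exact: (Lfun2_measurable Lh)|exact: (Lfun2_measurable Lh')|exact: wiener_integralP|exact: wiener_integralP].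
Qed.

Lemma wiener_integral_dist h h' : h \in Lfun mu 2%:E -> h' \in Lfun mu 2%:E ->
  norm2 P (wiener_integral W h \- wiener_integral W h')%R <= norm2 mu (h \- h')%R.
Proof.
by move=> Lh Lh'; apply: wiener_dist;
  [exact: (Lfun2_measurable Lh)|exact: (Lfun2_measurable Lh')|exact: wiener_integralP|exact: wiener_integralP].
Qed.

Lemma is_wiener0 : is_wiener_integral W (fun=> 0%R) (fun=> 0%R).
Proof.
have E (d1 : measure_display) (U : measurableType d1) (m : {measure set U -> \bar R})
    (f : U -> R) : f = (fun=> 0%R) -> norm2 m (f \- (fun=> 0))%R = 0.
  move=> ->; rewrite norm2E; under eq_integral do rewrite /= subrr expr0n.
  by rewrite integral0 sqrte0.
apply/is_wienerP; split; first exact: Lfun2_0.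
exists (fun=> [::]); split => //.
- rewrite (_ : (fun j => _) = cst 0); first exact: cvg_cst.
  by apply/funext => j; apply: E; apply/funext => p; rewrite /step_fun big_nil.
- rewrite (_ : (fun j => _) = cst 0); first exact: cvg_cst.
  by apply/funext => j; apply: E; apply/funext => p; rewrite /step_integral big_nil.
Qed.

Lemma norm2_wiener_le h : h \in Lfun mu 2%:E ->
  norm2 P (wiener_integral W h) <= norm2 mu h.
Proof.
move=> Lh; have := wiener_dist (Lfun2_measurable Lh) (measurable_cst _)
  (wiener_integralP Lh) is_wiener0.
have E (U : Type) (f : U -> R) : (f \- (fun=> 0) = f)%R.
  by apply/funext => x /=; rewrite subr0.
by rewrite !E.
Qed.

Lemma wiener_integral_ae_eq h h' : h \in Lfun mu 2%:E -> h' \in Lfun mu 2%:E ->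
  {ae mu, forall p, h p = h' p} ->
  {ae P, forall w, wiener_integral W h w = wiener_integral W h' w}.
Proof.
move=> Lh Lh' hh'; have := wiener_integral_dist Lh Lh'.
have mh := Lfun2_measurable Lh; have mh' := Lfun2_measurable Lh'.
rewrite [norm2 mu _](@norm2_ae_eq _ _ _ _ _ (fun=> 0%R)) //; last 2 first.
- exact: measurable_funB.
- by apply: filterS hh' => p /= ->; rewrite subrr.
rewrite [norm2 mu _]norm2E; under eq_integral do rewrite expr0n.
rewrite integral0 sqrte0 => H.
have {H} : norm2 P (wiener_integral W h \- wiener_integral W h')%R = 0.
  by apply/eqP; rewrite eq_le H norm2_ge0.
have mI := measurable_wiener Lh; have mI' := measurable_wiener Lh'.
move/norm2_eq0 => /(_ (measurable_funB mI mI')).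
by apply: filterS => w /= /eqP; rewrite subr_eq0 => /eqP.
Qed.

End wiener.

(** * Averages of a cosine over random signs *)

Section trigonometric_estimates.
Context {R : realType}.
Implicit Types x z kappa theta u : R.

Lemma sin_normr x : `|sin `|x| | = `|sin x|.
Proof. by have [x0|x0] := leP 0 x; [rewrite (ger0_norm x0)|rewrite (ltr0_norm x0) sinN normrN]. Qed.

Lemma ler_norm_cos x : `|cos x| <= 1.
Proof. by rewrite ler_norml cos_geN1 cos_le1. Qed.

Lemma ler_norm_sin x : `|sin x| <= 1.
Proof. by rewrite ler_norml sin_geN1 sin_le1. Qed.

Lemma ler_norm_sin_id x : `|sin x| <= `|x|.
Proof.
rewrite -sin_normr; set y := `|x|; have y0 : 0 <= y := normr_ge0 x.
have [c _] := MVT_segment y0 (fun t _ => is_derive_sin t)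
  (continuous_subspaceT (@continuous_sin R)).
rewrite sin0 !subr0 => ->; rewrite normrM (ger0_norm y0).
by rewrite ler_piMl// ler_norm_cos.
Qed.

Lemma cos_half x : cos x = 1 - 2 * sin (x / 2) ^+ 2.
Proof.
rewrite [in LHS](_ : x = (x / 2) *+ 2); last by rewrite -mulr_natr; field.
rewrite cos_mulr2n -mulr_natl.
by have := cos2Dsin2 (x / 2); lra.
Qed.

Lemma cos_ge_sqr x : 1 - cos x <= x ^+ 2 / 2.
Proof.
rewrite cos_half; have := ler_norm_sin_id (x / 2).
rewrite -(real_normK (num_real (sin (x / 2)))).
have -> : x ^+ 2 = 4 * `|x / 2| ^+ 2 by rewrite real_normK ?num_real//; field.
by have := normr_ge0 (sin (x / 2)); nra.
Qed.

Lemma sin_taylor x : `|x - sin x| <= `|x| ^+ 3 / 2.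
Proof.
have -> : `|x - sin x| = `| `|x| - sin `|x| |.
  have [x0|x0] := leP 0 x; first by rewrite (ger0_norm x0).
  by rewrite (ltr0_norm x0) sinN opprK -normrN opprB addrC.
set y := `|x|; have y0 : 0 <= y := normr_ge0 x.
have df t : t \in `]0, y[%R -> is_derive t 1 (fun t => t - sin t) (1 - cos t).
  by move=> _; exact: is_deriveB.
have cf : {within `[0, y], continuous (fun t => t - sin t)}.
  apply: continuous_subspaceT => t; apply: cvgB; first exact: cvg_id.
  exact: continuous_sin.
have [c cy] := MVT_segment y0 df cf.
rewrite sin0 !subr0 => ->.
rewrite normrM (ger0_norm y0) ger0_norm; last by rewrite subr_ge0 cos_le1.
have : 1 - cos c <= y ^+ 2 / 2.
  apply: (le_trans (cos_ge_sqr c)); rewrite ler_pM2r ?invr_gt0//.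
  by move: cy; rewrite in_itv/= => /andP[c0 cy]; rewrite lerXn2r.
have -> : y ^+ 3 / 2 = y ^+ 2 / 2 * y by field.
by move=> H; rewrite ler_wpM2r.
Qed.

Lemma cos_taylor x : `|cos x - (1 - x ^+ 2 / 2)| <= x ^+ 4 / 8.
Proof.
rewrite cos_half; set h := x / 2.
have -> : 1 - 2 * sin h ^+ 2 - (1 - x ^+ 2 / 2) = 2 * ((h - sin h) * (h + sin h)).
  by rewrite /h; field.
have -> : x ^+ 4 / 8 = 2 * ((`|h| ^+ 3 / 2) * (2 * `|h|)).
  have -> : 2 * ((`|h| ^+ 3 / 2) * (2 * `|h|)) = 2 * (`|h| ^+ 2) ^+ 2 by field.
  by rewrite real_normK ?num_real// /h; field.
rewrite normrM (ger0_norm (_ : 0 <= 2))// ler_wpM2l// normrM ler_pM//.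
  exact: sin_taylor.
by rewrite (le_trans (ler_normD _ _))//; have := ler_norm_sin_id h; lra.
Qed.

Lemma expRN_taylor z : 0 <= z -> `|expR (- z) - (1 - z)| <= z ^+ 2.
Proof.
move=> z0; rewrite ger0_norm; last by rewrite subr_ge0 expR_ge1Dx.
have := expR_ge1Dx z => H.
have z1 : 0 < 1 + z by lra.
have : expR (- z) <= 1 - z + z ^+ 2.
  rewrite expRN; apply: (@le_trans _ _ (1 + z)^-1).
    by rewrite lef_pV2// posrE// expR_gt0.
  rewrite -[leLHS]mul1r ler_pdivrMr//.
  have -> : (1 - z + z ^+ 2) * (1 + z) = 1 + z ^+ 3 by ring.
  by rewrite lerDl exprn_ge0.
by lra.
Qed.

Lemma expRN_le1 z : 0 <= z -> expR (- z) <= 1.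
Proof. by move=> z0; rewrite -expR0 ler_expR oppr_le0. Qed.

(** Both estimates compare Taylor expansions; for [|x| > 1] the right-hand side
    exceeds the trivial bound [2]. *)
Lemma cell_estimate kappa x : `|kappa| <= 1 ->
  let e := expR (- ((1 - kappa ^+ 2) * x ^+ 2 / 2)) in
  `|cos x - e * cos (kappa * x)| <= 2 * `|x| ^+ 3 /\
  `|kappa * sin x - e * sin (kappa * x)| <= 2 * `|x| ^+ 3.
Proof.
move=> k1; set z := (1 - kappa ^+ 2) * x ^+ 2 / 2; move=> e.
have k2 : 0 <= kappa ^+ 2 <= 1.
  rewrite sqr_ge0/= -(real_normK (num_real kappa)).
  by have := normr_ge0 kappa; nra.
have /andP[k20 k21] := k2.
have z0 : 0 <= z by rewrite divr_ge0// mulr_ge0 ?sqr_ge0// subr_ge0.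
have e0 : 0 <= e by exact: expR_ge0.
have e1 : e <= 1 by exact: expRN_le1.
have [x1|x1] := leP `|x| 1; last first.
  have x3 : 1 <= `|x| ^+ 3 by rewrite exprn_ege1// ltW.
  have ec : `|e * cos (kappa * x)| <= 1.
    by rewrite normrM (ger0_norm e0) mulr_ile1// ler_norm_cos.
  have es : `|e * sin (kappa * x)| <= 1.
    by rewrite normrM (ger0_norm e0) mulr_ile1// ler_norm_sin.
  have ks : `|kappa * sin x| <= 1.
    by rewrite normrM mulr_ile1// ler_norm_sin.
  have := ler_norm_cos x.
  split; rewrite (le_trans (ler_normB _ _))//; lra.
have zx : z <= x ^+ 2 / 2.
  by rewrite /z ler_pM2r ?invr_gt0// ler_piMl ?sqr_ge0// gerBl.
set y := `|x|; have y0 : 0 <= y := normr_ge0 x.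
have x2 : x ^+ 2 = y ^+ 2 by rewrite real_normK ?num_real.
have x4 : x ^+ 4 = y ^+ 4 by rewrite (exprM x 2 2) x2 -exprM.
have e_t := expRN_taylor z0; rewrite -/e in e_t.
have ky : `|kappa * x| <= y by rewrite normrM ler_piMl.
split.
  have c1 := cos_taylor x; have c2 := cos_taylor (kappa * x).
  set r1 := cos x - _ in c1; set r2 := cos (kappa * x) - _ in c2.
  set r3 := e - _ in e_t.
  have -> : cos x - e * cos (kappa * x) = r1 - e * r2 -
     z * (kappa ^+ 2 * x ^+ 2 / 2) - r3 * (1 - kappa ^+ 2 * x ^+ 2 / 2).
    by rewrite /r1 /r2 /r3 /z; field.
  have b2 : `|e * r2| <= y ^+ 4 / 8.
    rewrite normrM (ger0_norm e0) (le_trans (_ : _ <= `|r2|)) ?ler_piMl//.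
    apply: (le_trans c2); rewrite exprMn x4 ler_pM2r ?invr_gt0//.
    by rewrite ler_piMl ?exprn_ge0// (exprM _ 2 2) exprn_ile1.
  have b3 : `|z * (kappa ^+ 2 * x ^+ 2 / 2)| <= y ^+ 4 / 4.
    rewrite ger0_norm; last by rewrite mulr_ge0// divr_ge0// mulr_ge0// sqr_ge0.
    have -> : y ^+ 4 / 4 = (x ^+ 2 / 2) * (x ^+ 2 / 2) by rewrite x2; field.
    apply: ler_pM => //; first by rewrite divr_ge0// mulr_ge0// sqr_ge0.
    by rewrite ler_wpM2r// ler_piMl// sqr_ge0.
  have b4 : `|r3 * (1 - kappa ^+ 2 * x ^+ 2 / 2)| <= y ^+ 4 / 4.
    rewrite normrM -[leRHS]mulr1 ler_pM//.
      apply: (le_trans e_t).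
      have -> : y ^+ 4 / 4 = (x ^+ 2 / 2) ^+ 2 by rewrite x2; field.
      by rewrite lerXn2r ?nnegrE// divr_ge0 ?sqr_ge0.
    have y2 : 0 <= x ^+ 2 <= 1 by rewrite sqr_ge0 x2 exprn_ile1.
    by rewrite ler_norml; nra.
  rewrite x4 in c1.
  have y43 : y ^+ 4 <= y ^+ 3 by rewrite exprS ler_piMl ?exprn_ge0.
  have := exprn_ge0 3 y0.
  have n4 (a b c d : R) : `|a - b - c - d| <= `|a| + `|b| + `|c| + `|d|.
    apply: (le_trans (ler_normB _ _)); rewrite lerD2r.
    by apply: (le_trans (ler_normB _ _)); rewrite lerD2r; exact: ler_normB.
  by move=> y3; apply: (le_trans (n4 _ _ _ _)); lra.
have q1 := sin_taylor x; have q2 := sin_taylor (kappa * x).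
set p1 := x - sin x in q1; set p2 := kappa * x - sin (kappa * x) in q2.
have -> : kappa * sin x - e * sin (kappa * x) = kappa * x * (1 - e) - kappa * p1 + e * p2.
  by rewrite /p1 /p2; ring.
have b1 : `|kappa * x * (1 - e)| <= y ^+ 3 / 2.
  have e1z : 1 - e <= z by have := expR_ge1Dx (- z); rewrite -/e; lra.
  rewrite normrM (_ : y ^+ 3 / 2 = y * (y ^+ 2 / 2)); last by field.
  rewrite ler_pM// ger0_norm ?subr_ge0//.
  by rewrite -x2 (le_trans e1z).
have b2 : `|kappa * p1| <= y ^+ 3 / 2.
  by rewrite normrM (le_trans _ q1)// ler_piMl.
have b3 : `|e * p2| <= y ^+ 3 / 2.
  rewrite normrM (ger0_norm e0) (le_trans (_ : _ <= `|p2|)) ?ler_piMl//.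
  apply: (le_trans q2); rewrite ler_pM2r ?invr_gt0// lerXn2r ?nnegrE//.
have n3 (a b c : R) : `|a - b + c| <= `|a| + `|b| + `|c|.
  by apply: (le_trans (ler_normD _ _)); rewrite lerD2r; exact: ler_normB.
have y3 := exprn_ge0 3 y0.
by apply: (le_trans (n3 _ _ _)); lra.
Qed.

(** The expectation of [cos (theta + u * sum_i eps_i * w_i)] for independent
    signs [eps_i] with mean [kappa_i], where [s] lists the pairs
    [(kappa_i, w_i)]. *)
Fixpoint sign_average u (s : seq (R * R)) theta : R :=
  if s is (kappa, w) :: s' then
    (1 + kappa) / 2 * sign_average u s' (theta + u * w) +
    (1 - kappa) / 2 * sign_average u s' (theta - u * w)
  else cos theta.

(** A central limit estimate for the signs, one sign at a time: [cell_estimate]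
    replaces a sign of mean [kappa] by [kappa] and a factor
    [exp (- (1 - kappa^2) (u w)^2 / 2)], at the price of a cubic error. *)
Lemma sign_average_estimate u s theta : (forall i, i \in s -> `|i.1| <= 1) ->
  `|sign_average u s theta -
    cos (theta + u * \sum_(i <- s) i.1 * i.2) *
    expR (- (u ^+ 2 / 2 * \sum_(i <- s) (1 - i.1 ^+ 2) * i.2 ^+ 2))| <=
  4 * \sum_(i <- s) `|u * i.2| ^+ 3.
Proof.
elim: s theta => [|[kappa w] s IH] theta Hs.
  by rewrite !big_nil !mulr0 oppr0 expR0 addr0 mulr1 subrr normr0.
have k1 : `|kappa| <= 1 by exact: (Hs (kappa, w) (mem_head _ _)).
have Hs' : forall i, i \in s -> `|i.1| <= 1.
  by move=> i is_; apply: Hs; rewrite inE is_ orbT.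
have {}IH t := IH t Hs'.
rewrite !big_cons/=.
set S := \sum_(i <- s) i.1 * i.2 in IH *.
set V := \sum_(i <- s) (1 - i.1 ^+ 2) * i.2 ^+ 2 in IH *.
set E := \sum_(i <- s) `|u * i.2| ^+ 3 in IH *.
set F := expR (- (u ^+ 2 / 2 * V)) in IH.
have V0 : 0 <= V.
  rewrite /V big_seq; apply: sumr_ge0 => i is_; rewrite mulr_ge0 ?sqr_ge0//.
  have := Hs i; rewrite inE is_ orbT => /(_ isT) i1.
  rewrite subr_ge0 -(real_normK (num_real i.1)).
  by have := normr_ge0 i.1; nra.
have F0 : 0 <= F by exact: expR_ge0.
have F1 : F <= 1 by apply: expRN_le1; rewrite mulr_ge0// divr_ge0// sqr_ge0.
pose x := u * w.
have [c1 c2] := cell_estimate x k1.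
set e := expR _ in c1 c2.
have -> : expR (- (u ^+ 2 / 2 * ((1 - kappa ^+ 2) * w ^+ 2 + V))) = e * F.
  by rewrite /e /F -expRD; congr expR; rewrite /x; field.
have H1 := IH (theta + x); have H2 := IH (theta - x).
set A1 := sign_average _ _ _ in H1; set A2 := sign_average _ _ _ in H2.
rewrite -/x -/A1 -/A2.
set Y := theta + u * S.
have E1 : cos (theta + x + u * S) = cos Y * cos x - sin Y * sin x.
  by rewrite -cosD; congr cos; rewrite /Y; ring.
have E2 : cos (theta - x + u * S) = cos Y * cos x + sin Y * sin x.
  by rewrite -cosB; congr cos; rewrite /Y; ring.
have E3 : cos (theta + u * (kappa * w + S)) =
    cos Y * cos (kappa * x) - sin Y * sin (kappa * x).
  by rewrite -cosD; congr cos; rewrite /Y /x; ring.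
rewrite E1 in H1; rewrite E2 in H2; rewrite E3.
set D1 := A1 - _ in H1; set D2 := A2 - _ in H2.
have -> : (1 + kappa) / 2 * A1 + (1 - kappa) / 2 * A2 -
   (cos Y * cos (kappa * x) - sin Y * sin (kappa * x)) * (e * F) =
   ((1 + kappa) / 2 * D1 + (1 - kappa) / 2 * D2) +
   F * (cos Y * (cos x - e * cos (kappa * x)) -
        sin Y * (kappa * sin x - e * sin (kappa * x))).
  by rewrite /D1 /D2; field.
have [kl ku] : -1 <= kappa /\ kappa <= 1 by move: k1; rewrite ler_norml => /andP[].
have b1 : `|(1 + kappa) / 2 * D1 + (1 - kappa) / 2 * D2| <= 4 * E.
  apply: (le_trans (ler_normD _ _)); rewrite !normrM.
  rewrite (ger0_norm (_ : 0 <= 1 + kappa)); last by lra.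
  rewrite (ger0_norm (_ : 0 <= 1 - kappa)); last by lra.
  rewrite (ger0_norm (_ : 0 <= 2^-1))//.
  by move: `|D1| `|D2| H1 H2 => a b; nra.
have b2 : `|F * (cos Y * (cos x - e * cos (kappa * x)) -
        sin Y * (kappa * sin x - e * sin (kappa * x)))| <= 4 * `|x| ^+ 3.
  rewrite normrM (ger0_norm F0).
  apply: (@le_trans _ _ (1 * (2 * `|x| ^+ 3 + 2 * `|x| ^+ 3))); last by lra.
  rewrite ler_pM//; apply: (le_trans (ler_normB _ _)).
  apply: lerD; rewrite [leLHS]normrM.
    by apply: le_trans c1; rewrite ler_piMl// ler_norm_cos.
  by apply: le_trans c2; rewrite ler_piMl// ler_norm_sin.
apply: (le_trans (ler_normD _ _)); rewrite [leRHS]mulrDr [leRHS]addrC; exact: lerD.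
Qed.

Lemma ler_norm_sign_average u s theta : (forall i, i \in s -> `|i.1| <= 1) ->
  `|sign_average u s theta| <= 1.
Proof.
elim: s theta => [|[kappa w] s IH] theta Hs /=; first exact: ler_norm_cos.
have k1 : `|kappa| <= 1 by exact: (Hs (kappa, w) (mem_head _ _)).
have Hs' : forall i, i \in s -> `|i.1| <= 1.
  by move=> i is_; apply: Hs; rewrite inE is_ orbT.
have {}IH t := IH t Hs'.
have [kl ku] : -1 <= kappa /\ kappa <= 1 by move: k1; rewrite ler_norml => /andP[].
have := IH (theta + u * w); have := IH (theta - u * w).
rewrite !ler_norml; move: (sign_average _ _ _) => a /andP[a1 a2].
by move: (sign_average _ _ _) => b /andP[b1 b2]; apply/andP; split; nra.
Qed.

End trigonometric_estimates.

(** * Sets of half the measure *)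

Section halving.
Context {R : realType} {n : nat}.
Local Notation T := (space_time R n).
Local Notation mu := (@half_measure R n).
Implicit Types (A B : set T) (s : seq (R * set T)).

Definition slab (r : R) : set T := [set p | (p.2 : R) <= r].

Lemma measurable_slab r : measurable (slab r).
Proof.
rewrite (_ : slab r = snd @^-1` `]-oo, r]%classic); last first.
  by apply/seteqP; split => -[y t] /=; rewrite in_itv.
by rewrite -[X in measurable X]setTI; exact: measurable_snd.
Qed.

Lemma measurable_upper_half : measurable (@upper_half R n).
Proof.
rewrite (_ : upper_half = ~` slab 0).
  by apply: measurableC; exact: measurable_slab.
apply/funext => p; apply/propext; rewrite /upper_half /slab /setC/= ltNge.
by split => /negP.
Qed.

Lemma measurable_density : measurable_fun (@upper_half R n)
  (fun p => ((p.2 : R) ^- n.+1)%:E).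
Proof.
apply/measurable_EFinP.
apply: (@eq_measurable_fun _ _ _ _ _
    ((fun t : measurableTypeR R => t `^ (- n.+1%:R)) \o snd)).
  by move=> p; rewrite inE /upper_half/= => p0; rewrite powRN powR_mulrn// ltW.
apply: measurable_funTS; apply: measurableT_comp; last exact: measurable_snd.
exact: measurable_powR.
Qed.

Lemma half_measure_upper A : A `&` upper_half = set0 -> mu A = 0%E.
Proof. by move=> A0; rewrite /half_measure A0 integral_set0. Qed.

Lemma half_measure_null A : measurable A ->
  (lebesgue_tuple n \x @lebesgue_measure R)%E A = 0%E -> mu A = 0%E.
Proof.
move=> mA A0; have mAU := measurableI _ _ mA measurable_upper_half.
apply: null_set_integral => //.
  by apply: measurable_funS measurable_density => //; exact: measurable_upper_half.
apply/eqP; rewrite eq_le measure_ge0 andbT -A0.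
by apply: le_measure; rewrite ?inE//; exact: subIsetl.
Qed.

(** Horizontal slices are null, so the measure of the part of a set below a
    given height varies continuously with the height. *)
Lemma half_measure_level r : mu [set p | (p.2 : R) = r] = 0%E.
Proof.
have E : [set p : T | (p.2 : R) = r] = [set: euclidean R n] `*` [set r].
  by apply/seteqP; split => -[y t] //= [].
apply: half_measure_null; rewrite E.
  by apply: measurableX => //; exact: measurable_set1.
by rewrite product_measure1E// [X in (_ * X)%E]lebesgue_measure_set1 mule0.
Qed.

(** Cut at the supremum [r] of the heights below which at most half of [A]
    lies; the slice at height [r] is null, hence exactly half is below. *)
Lemma exists_half A : finite_set_of A ->
  exists B, [/\ measurable B, B `<=` A & vol B = vol A / 2].
Proof.
move=> fA; have [mA lA] := fA.
have [a0|a0] := leP (vol A) 0.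
  exists set0; split => //; have -> : vol A = 0 by apply/eqP; rewrite eq_le a0 vol_ge0.
  by rewrite /vol measure0 mul0r.
pose F r := A `&` slab r.
have mF r : measurable (F r) by apply: measurableI => //; exact: measurable_slab.
have fF r : finite_set_of (F r) by apply: finite_set_ofS fA => //; exact: subIsetl.
have leF B C : finite_set_of B -> finite_set_of C -> B `<=` C -> vol B <= vol C.
  move=> fB fC BC; rewrite -lee_fin !volE//.
  by apply: le_measure => //; rewrite inE; [case: fB|case: fC].
have F_mono r r' : r <= r' -> vol (F r) <= vol (F r').
  by move=> rr'; apply: leF => // p [Ap pr]; split => //; exact: le_trans rr'.
pose S := [set r : R | vol (F r) <= vol A / 2].
have F0 : vol (F 0) = 0.
  rewrite /vol half_measure_upper// -subset0 => p [[_ p0] pu].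
  by move: p0 pu; rewrite /slab/upper_half/= => p0; rewrite ltNge p0.
have S0 : S 0 by rewrite /S/= F0 divr_ge0// ltW.
have cvgF : vol (F k%:R) @[k --> \oo] --> vol A.
  have : mu \o (fun k : nat => F k%:R) @ \oo --> mu (\bigcup_k F k%:R).
    apply: nondecreasing_cvg_mu => //; first exact: bigcup_measurable.
    move=> i j ij; apply/subsetPset => p [Ap pi]; split => //.
    by apply: (le_trans pi); rewrite ler_nat.
  have -> : \bigcup_k F k%:R = A.
    apply/seteqP; split => [p [k _ []]//|p Ap].
    exists (Num.truncn `|p.2 : R|).+1 => //; split => //; rewrite /slab/=.
    by apply: (le_trans (ler_norm _)); apply: ltW; exact: truncnS_gt.
  by rewrite -volE// => /fine_cvg.
have Sub : has_ubound S.
  have a2 : 0 < vol A / 2 by rewrite divr_gt0.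
  move/cvgrPdist_lt : cvgF => /(_ _ a2)[N _ /(_ N (leqnn N))] H.
  exists N%:R => r Sr; rewrite leNgt; apply/negP => Nr.
  have := F_mono _ _ (ltW Nr); move: Sr H; rewrite /S/=.
  by have := ler_norm (vol A - vol (F N%:R)); lra.
pose r := sup S.
have Hlt r' : r' < r -> vol (F r') <= vol A / 2.
  move=> r'r; have [|s Ss r's] := @sup_adherent _ S (r - r') _ (conj (ex_intro _ _ S0) Sub).
    by rewrite subr_gt0.
  by rewrite -/r subKr in r's; apply: le_trans (F_mono _ _ (ltW r's)) Ss.
have Hgt r' : r < r' -> vol A / 2 < vol (F r').
  move=> rr'; rewrite ltNge; apply/negP => H.
  by have := ub_le_sup Sub H; rewrite -/r leNgt rr'.
pose e (k : nat) : R := k.+1%:R^-1.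
have e0 k : 0 < e k by rewrite invr_gt0.
have e_mono i j : (i <= j)%N -> e j <= e i.
  by move=> ij; rewrite lef_pV2 ?posrE// ler_nat ltnS.
have e_small (x : R) : 0 < x -> exists k, e k < x.
  move=> x0; exists (Num.truncn (x^-1)).
  by rewrite invf_plt ?posrE// truncnS_gt.
exists (F r); split => //; first exact: subIsetl.
apply/eqP; rewrite eq_le; apply/andP; split; last first.
  have : mu \o (fun k : nat => F (r + e k)) @ \oo --> mu (\bigcap_k F (r + e k)).
    apply: nonincreasing_cvg_mu => //.
    - by case: (fF (r + e 0%N)).
    - by apply: bigcap_measurable; [exists 0%N|move=> k _; exact: mF].
    - move=> i j ij; apply/subsetPset => p [Ap pi]; split => //.
      by apply: (le_trans pi); rewrite lerD2l e_mono.
  have -> : \bigcap_k F (r + e k) = F r.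
    apply/seteqP; split => [p H|p [Ap pr] k _]; last first.
      by split => //; rewrite /slab/= (le_trans pr)// lerDl ltW.
    split; first by case: (H 0%N Logic.I).
    rewrite /slab/= leNgt; apply/negP => rp.
    have rp0 : 0 < p.2 - r by rewrite subr_gt0.
    have [k ek] := e_small _ rp0.
    by have [_] := H k Logic.I; rewrite /slab/=; lra.
  rewrite -volE// => /fine_cvg H.
  rewrite -(cvg_lim _ H)//; apply: limr_ge; first by apply/cvg_ex; eexists; exact: H.
  by apply: nearW => k; apply/ltW/Hgt; rewrite ltrDl.
have EF : F r = \bigcup_k F (r - e k) `|` (A `&` [set p | (p.2 : R) = r]).
  apply/seteqP; split => [p [Ap pr]|p [[k _ [Ap pr]]|[Ap pr]]].
  - move: pr; rewrite /slab/= le_eqVlt => /predU1P[|pr]; first by right.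
    have rp0 : 0 < r - p.2 by rewrite subr_gt0.
    have [k ek] := e_small _ rp0.
    by left; exists k => //; split => //; rewrite /slab/=; lra.
  - by split => //; rewrite /slab/= (le_trans pr)// gerBl ltW.
  - by split => //; rewrite /slab/= pr.
have mU : measurable (\bigcup_k F (r - e k)) by exact: bigcup_measurable.
have mL : measurable (A `&` [set p : T | (p.2 : R) = r]).
  apply: measurableI => //.
  rewrite (_ : [set p : T | (p.2 : R) = r] = snd @^-1` [set r]).
    by rewrite -[X in measurable X]setTI; apply: measurable_snd => //; exact: measurable_set1.
  by apply/seteqP; split => -[y t].
have L0 : mu (A `&` [set p : T | (p.2 : R) = r]) = 0%E.
  apply/eqP; rewrite eq_le measure_ge0 andbT -(half_measure_level r).
  apply: le_measure; [exact: mem_set|apply: mem_set|exact: subIsetr].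
  rewrite (_ : [set p : T | (p.2 : R) = r] = snd @^-1` [set r]).
    by rewrite -[X in measurable X]setTI; apply: measurable_snd => //; exact: measurable_set1.
  by apply/seteqP; split => -[y t].
rewrite -lee_fin volE// EF.
apply: (le_trans (measureU2 _ mU mL)).
rewrite [X in (_ + X)%E](_ : _ = 0%E) ?adde0//.
have H : mu \o (fun k : nat => F (r - e k)) @ \oo --> mu (\bigcup_k F (r - e k)).
  apply: nondecreasing_cvg_mu => // i j ij; apply/subsetPset => p [Ap pi]; split => //.
  by apply: (le_trans pi); rewrite lerD2l lerN2 e_mono.
have HL : (mu (\bigcup_k F (r - e k)%R) <= (vol A / 2)%:E)%E.
  rewrite -(cvg_lim _ H)//; apply: lime_le; first by apply/cvg_ex; eexists; exact: H.
  apply: nearW => k /=; rewrite -volE// lee_fin; apply: Hlt.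
  by rewrite ltrBlDr ltrDl.
exact: HL.
Qed.

End halving.

(** * Refinement of step functions *)

Section mean_seq.
Context {R : realType} {d : measure_display} {T : measurableType d}.
Variable P : probability T R.

Lemma has_mean_sum_seq (I : eqType) (r : seq I) (F : I -> T -> R) :
  (forall i, i \in r -> has_mean P (F i)) ->
  has_mean P (fun w => \sum_(i <- r) F i w).
Proof.
elim: r => [|i r IH] iF.
  by under eq_fun do rewrite big_nil; exact: has_mean_cst.
under eq_fun do rewrite big_cons; apply: has_meanD.
  by apply: iF; rewrite mem_head.
by apply: IH => j jr; apply: iF; rewrite inE jr orbT.
Qed.

Lemma mean_sum_seq (I : eqType) (r : seq I) (F : I -> T -> R) :
  (forall i, i \in r -> has_mean P (F i)) ->
  mean P (fun w => \sum_(i <- r) F i w) = \sum_(i <- r) mean P (F i).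
Proof.
elim: r => [|i r IH] iF.
  by under eq_fun do rewrite big_nil; rewrite big_nil mean_cst.
have iF' j : j \in r -> has_mean P (F j) by move=> jr; apply: iF; rewrite inE jr orbT.
under eq_fun do rewrite big_cons.
rewrite big_cons -IH// meanD//; last exact: has_mean_sum_seq.
by apply: iF; rewrite mem_head.
Qed.

End mean_seq.

Section refinement.
Context {R : realType} {n : nat}.
Local Notation T := (space_time R n).
Implicit Types (A B : set T) (s : seq (R * set T)).

(** A choice of half of the set, made once so that [refine] is a function. *)
Definition half A : set T :=
  xget set0 [set B | [/\ measurable B, B `<=` A & vol B = vol A / 2]].

Lemma halfP A : finite_set_of A ->
  [/\ measurable (half A), half A `<=` A & vol (half A) = vol A / 2].
Proof. by move=> fA; have := exists_half fA => /xgetPex; exact. Qed.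

Lemma finite_half A : finite_set_of A -> finite_set_of (half A).
Proof. by move=> fA; have [? ? _] := halfP fA; exact: finite_set_ofS fA. Qed.

Lemma finite_halfD A : finite_set_of A -> finite_set_of (A `\` half A).
Proof.
move=> fA; have [mH _ _] := halfP fA; have [mA _] := fA.
by apply: finite_set_ofS fA; [exact: measurableD|exact: subDsetl].
Qed.

Lemma half_disjoint A : half A `&` (A `\` half A) = set0.
Proof. by rewrite -subset0 => x [hx []]. Qed.

Lemma halfU A : finite_set_of A -> half A `|` (A `\` half A) = A.
Proof.
by move=> fA; have [_ hA _] := halfP fA; rewrite -[RHS](set_split A (half A)) (setIidr hA).
Qed.

Lemma vol_halfD A : finite_set_of A -> vol (A `\` half A) = vol A / 2.
Proof.
move=> fA; have [_ _ hA] := halfP fA.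
have := volU (finite_half fA) (finite_halfD fA) (half_disjoint A).
by rewrite halfU// hA; lra.
Qed.

Fixpoint refine s : seq (R * set T) :=
  if s is i :: s' then
    (i.1, half i.2) :: (i.1, i.2 `\` half i.2) :: refine s'
  else [::].

Lemma finite_steps_cons i s : finite_steps (i :: s) ->
  finite_set_of i.2 /\ finite_steps s.
Proof.
move=> fs; split; first by apply: fs; rewrite mem_head.
by move=> j js; apply: fs; rewrite inE js orbT.
Qed.

Lemma refine_sub s j : finite_steps s -> j \in refine s ->
  exists i, [/\ i \in s, j.1 = i.1 & j.2 `<=` i.2].
Proof.
elim: s => //= i s IH /finite_steps_cons[fi fs].
have [_ hi _] := halfP fi.
rewrite !inE => /or3P[/eqP ->|/eqP ->|/(IH fs)[k [ks E S]]].
- by exists i; rewrite mem_head.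
- by exists i; rewrite mem_head; split => //; exact: subDsetl.
- by exists k; rewrite inE ks orbT.
Qed.

Lemma finite_refine s : finite_steps s -> finite_steps (refine s).
Proof.
elim: s => //= i s IH /finite_steps_cons[fi fs] j.
rewrite !inE => /or3P[/eqP ->|/eqP ->|/(IH fs)//].
- exact: finite_half.
- exact: finite_halfD.
Qed.

Lemma disjoint_refine s : finite_steps s -> disjoint_steps s ->
  disjoint_steps (refine s).
Proof.
elim: s => //= i s IH /finite_steps_cons[fi fs] [di ds].
have [_ hi _] := halfP fi; split; last split; last exact: IH.
  move=> j; rewrite inE => /predU1P[->|/(refine_sub fs)[k [ks _ jk]]].
    exact: half_disjoint.
  by rewrite -subset0 -(di k ks) => x [/hi ix /jk kx].
move=> j /(refine_sub fs)[k [ks _ jk]].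
by rewrite -subset0 -(di k ks) => x [[ix _] /jk kx].
Qed.

Lemma sum_refine (g : R -> R) s : finite_steps s ->
  \sum_(i <- refine s) g i.1 * vol i.2 = \sum_(i <- s) g i.1 * vol i.2.
Proof.
elim: s => //= i s IH /finite_steps_cons[fi fs].
rewrite !big_cons IH// vol_halfD//; have [_ _ ->] := halfP fi.
by rewrite addrA -mulrDr -splitr.
Qed.

(** This is what makes the mesh tend to [0]: the sum of squared volumes is
    divided by two at each refinement. *)
Lemma sum_sqr_refine s : finite_steps s ->
  \sum_(i <- refine s) vol i.2 ^+ 2 = (\sum_(i <- s) vol i.2 ^+ 2) / 2.
Proof.
elim: s => [_|i s IH /finite_steps_cons[fi fs]]/=; first by rewrite !big_nil mul0r.
rewrite !big_cons IH// vol_halfD//; have [_ _ ->] := halfP fi.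
by field.
Qed.

Definition total s : set T := \big[setU/set0]_(i <- s) i.2.

Lemma total_refine s : finite_steps s -> total (refine s) = total s.
Proof.
rewrite /total; elim: s => //= i s IH /finite_steps_cons[fi fs].
by rewrite !big_cons IH//= setUA halfU.
Qed.

Lemma finite_total s : finite_steps s -> finite_set_of (total s).
Proof.
rewrite /total; elim: s => [_|i s IH /finite_steps_cons[fi fs]].
  by rewrite big_nil; split; rewrite ?measure0.
by rewrite big_cons; apply: finite_set_ofU => //; exact: IH.
Qed.

Lemma disjoint_total s B : (forall i, i \in s -> i.2 `&` B = set0) ->
  total s `&` B = set0.
Proof.
rewrite /total; elim: s => [|i s IH] H; first by rewrite big_nil set0I.
rewrite big_cons setIUl H ?mem_head// set0U IH// => j js.
by apply: H; rewrite inE js orbT.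
Qed.

Lemma vol_total s : finite_steps s -> disjoint_steps s ->
  vol (total s) = \sum_(i <- s) vol i.2.
Proof.
elim: s => [_ _|i s IH /finite_steps_cons[fi fs] /= [di ds]].
  by rewrite /total !big_nil /vol measure0.
rewrite big_cons -IH// -volU//; first by rewrite /total big_cons.
  exact: finite_total.
rewrite setIC; apply: disjoint_total => j js; rewrite setIC; exact: di.
Qed.

End refinement.

Section sign_mean.
Context {R : realType} {n : nat} {d : measure_display} {Omega : measurableType d}.
Context {P : probability Omega R}.
Local Notation T := (space_time R n).
Variable W : set T -> {RV P >-> R}.
Hypothesis HW : gaussian_random_measure W.
Implicit Types (A B : set T) (u theta : R) (s : seq (R * set T)).

Lemma step_integral_refine s : finite_steps s ->
  {ae P, forall w, step_integral W (refine s) w = step_integral W s w}.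
Proof.
elim: s => [_|i s IH /finite_steps_cons[fi fs]]; first exact: aeW.
have H := W_additive HW (finite_half fi) (finite_halfD fi) (half_disjoint _).
rewrite halfU// in H.
apply: filterS2 H (IH fs) => w E1 E2.
by move: E2; rewrite /step_integral/= !big_cons/= => ->; rewrite E1; ring.
Qed.

Definition cos_mean u A := mean P (fun w => cos (u * W A w)).

Let mW A : measurable_fun [set: Omega] (W A) := measurable_W W A.

Lemma measurable_cosR : measurable_fun [set: R] (@cos R).
Proof. by apply: continuous_measurable_fun; exact: continuous_cos. Qed.

Lemma measurable_sinR : measurable_fun [set: R] (@sin R).
Proof. by apply: continuous_measurable_fun; exact: continuous_sin. Qed.

Lemma mean_cos_cos u A B : finite_set_of A -> finite_set_of B -> A `&` B = set0 ->
  [/\ mean P (fun w => cos (u * W A w) * cos (u * W B w)) = cos_mean u A * cos_mean u B,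
   mean P (fun w => sin (u * W A w) * sin (u * W B w)) = 0,
   mean P (fun w => cos (u * W A w) * sin (u * W B w)) = 0 &
   mean P (fun w => sin (u * W A w) * cos (u * W B w)) = 0].
Proof.
move=> fA fB AB0; have ind := W_independent HW fA fB AB0.
have muR : measurable_fun [set: R] (fun x : R => u * x) by exact: measurable_funM.
have mc : measurable_fun [set: R] (fun x => cos (u * x)).
  exact: (measurableT_comp measurable_cosR muR).
have ms : measurable_fun [set: R] (fun x => sin (u * x)).
  exact: (measurableT_comp measurable_sinR muR).
have ic A' : has_mean P ((fun x => cos (u * x)) \o W A').
  by apply: has_mean_cos; exact: measurable_funM.
have is' A' : has_mean P ((fun x => sin (u * x)) \o W A').
  by apply: has_mean_sin; exact: measurable_funM.
have sA := mean_sin_W HW u fA; have sB := mean_sin_W HW u fB.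
split.
- by rewrite (independent_mean ind mc mc).
- by rewrite (independent_mean ind ms ms)// /comp sA mul0r.
- by rewrite (independent_mean ind mc ms)// /comp sB mulr0.
- by rewrite (independent_mean ind ms mc)// /comp sA mul0r.
Qed.

Lemma has_mean_prod (X Y : Omega -> R) : measurable_fun [set: Omega] X ->
  measurable_fun [set: Omega] Y -> (forall w, `|X w| <= 1) -> (forall w, `|Y w| <= 1) ->
  has_mean P (fun w => X w * Y w).
Proof.
move=> mX mY X1 Y1; apply: (@has_mean_bounded _ _ _ _ 1); first exact: measurable_funM.
by move=> w; rewrite normrM mulr_ile1.
Qed.

(** Independence and symmetry make the characteristic functions of
    [W A - W B] and of [W A + W B] equal. *)
Lemma mean_cos_pair theta u A B : finite_set_of A -> finite_set_of B ->
  A `&` B = set0 ->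
  mean P (fun w => cos (theta + u * (W A w - W B w))) = cos theta * cos_mean u (A `|` B).
Proof.
move=> fA fB AB0; have [cc ss cs sc] := mean_cos_cos u fA fB AB0.
have muW A' : measurable_fun [set: Omega] (fun w => u * W A' w) by exact: measurable_funM.
have mc A' : measurable_fun [set: Omega] (fun w => cos (u * W A' w)).
  exact: (measurableT_comp measurable_cosR (muW A')).
have ms A' : measurable_fun [set: Omega] (fun w => sin (u * W A' w)).
  exact: (measurableT_comp measurable_sinR (muW A')).
have icc : has_mean P (fun w => cos (u * W A w) * cos (u * W B w)).
  by apply: has_mean_prod => // w; exact: ler_norm_cos.
have iss : has_mean P (fun w => sin (u * W A w) * sin (u * W B w)).
  by apply: has_mean_prod => // w; exact: ler_norm_sin.
have ics : has_mean P (fun w => cos (u * W A w) * sin (u * W B w)).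
  by apply: has_mean_prod => // w; [exact: ler_norm_cos|exact: ler_norm_sin].
have isc : has_mean P (fun w => sin (u * W A w) * cos (u * W B w)).
  by apply: has_mean_prod => // w; [exact: ler_norm_sin|exact: ler_norm_cos].
have -> : cos_mean u (A `|` B) = cos_mean u A * cos_mean u B.
  rewrite -cc -[RHS]subr0 -ss -meanB//; apply: mean_ae_eq.
  - exact: mc.
  - by apply: measurable_funB; exact: measurable_funM.
  - by apply: filterS (W_additive HW fA fB AB0) => w ->; rewrite mulrDr cosD.
transitivity (mean P (fun w => cos theta * (cos (u * W A w) * cos (u * W B w) +
    sin (u * W A w) * sin (u * W B w)) +
    (- sin theta) * (sin (u * W A w) * cos (u * W B w) -
      cos (u * W A w) * sin (u * W B w)))).
  congr (mean P _); apply/funext => w.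
  by rewrite mulrBr cosD cosB sinB; ring.
rewrite meanD; [|exact/has_meanZ/has_meanD|exact/has_meanZ/has_meanB].
rewrite !meanZ; [|exact: has_meanB|exact: has_meanD].
by rewrite meanD// meanB// cc ss cs sc; ring.
Qed.

Definition cell_values s w : seq (R * R) := [seq (i.1, W i.2 w) | i <- s].

Lemma measurable_sign_average u s (X : Omega -> R) :
  measurable_fun [set: Omega] X ->
  measurable_fun [set: Omega] (fun w => sign_average u (cell_values s w) (X w)).
Proof.
elim: s X => [|i s IH] X mX /=; first exact: (measurableT_comp measurable_cosR mX).
have muW A' : measurable_fun [set: Omega] (fun w => u * W A' w) by exact: measurable_funM.
apply: measurable_funD; apply: measurable_funM => //; apply: IH.
  exact: measurable_funD.
exact: measurable_funB.
Qed.

Definition small_coefs s := forall i, i \in s -> `|i.1| <= 1.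

Lemma small_coefs_values s w : small_coefs s ->
  forall i, i \in cell_values s w -> `|i.1| <= 1.
Proof. by move=> s1 _ /mapP[i is_ ->] /=; exact: s1. Qed.

Lemma has_mean_sign_average u s (X : Omega -> R) : small_coefs s ->
  measurable_fun [set: Omega] X ->
  has_mean P (fun w => sign_average u (cell_values s w) (X w)).
Proof.
move=> s1 mX; apply: (@has_mean_bounded _ _ _ _ 1).
  exact: measurable_sign_average.
by move=> w; apply: ler_norm_sign_average; exact: small_coefs_values.
Qed.

(** Adding a cell with a plus or a minus sign enlarges [A] or [B], and in both
    cases the union of the two sets is the same; so every pattern of signs
    contributes equally. *)
Lemma mean_sign_average theta u s A B : small_coefs s ->
  finite_steps s -> disjoint_steps s -> finite_set_of A -> finite_set_of B ->
  A `&` B = set0 -> (forall i, i \in s -> i.2 `&` (A `|` B) = set0) ->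
  mean P (fun w => sign_average u (cell_values s w) (theta + u * (W A w - W B w))) =
  cos theta * cos_mean u (A `|` B `|` total s).
Proof.
elim: s A B => [|i s IH] A B s1 fs ds fA fB AB0 sAB.
  by rewrite /total big_nil setU0 -mean_cos_pair.
have [fi fs'] := finite_steps_cons fs; move: ds => /= [di ds].
have s1' : small_coefs s by move=> j js; apply: s1; rewrite inE js orbT.
have iAB : i.2 `&` (A `|` B) = set0 by apply: sAB; rewrite mem_head.
have iA : A `&` i.2 = set0.
  by rewrite -subset0 -iAB => x [Ax ix]; split => //; left.
have iB : B `&` i.2 = set0.
  by rewrite -subset0 -iAB => x [Bx ix]; split => //; right.
have m1 X : measurable_fun [set: Omega] X ->
    measurable_fun [set: Omega] (fun w => sign_average u (cell_values s w) (X w)).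
  by move=> mX; exact: measurable_sign_average.
have mth A' B' : measurable_fun [set: Omega] (fun w => theta + u * (W A' w - W B' w)).
  by apply: measurable_funD => //; apply: measurable_funM => //; exact: measurable_funB.
have E1 : mean P (fun w => sign_average u (cell_values s w)
    (theta + u * (W A w - W B w) + u * W i.2 w)) =
    cos theta * cos_mean u (A `|` B `|` total (i :: s)).
  transitivity (mean P (fun w => sign_average u (cell_values s w)
    (theta + u * (W (A `|` i.2) w - W B w)))).
    apply: mean_ae_eq; [apply: m1|exact: m1|].
      by apply: measurable_funD => //; exact: measurable_funM.
    apply: filterS (W_additive HW fA fi iA) => w ->.
    by congr sign_average; ring.
  rewrite IH//.
  - by rewrite /total big_cons; congr (_ * cos_mean u _); rewrite !setUA (setUAC A).
  - exact: finite_set_ofU.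
  - by rewrite setIUl AB0 set0U setIC.
  - move=> j js; rewrite -subset0 => x [jx [[Ax|ix]|Bx]].
    + by rewrite -(sAB j) ?inE ?js ?orbT//; split => //; left.
    + by rewrite -(di j js); split.
    + by rewrite -(sAB j) ?inE ?js ?orbT//; split => //; right.
have E2 : mean P (fun w => sign_average u (cell_values s w)
    (theta + u * (W A w - W B w) - u * W i.2 w)) =
    cos theta * cos_mean u (A `|` B `|` total (i :: s)).
  transitivity (mean P (fun w => sign_average u (cell_values s w)
    (theta + u * (W A w - W (B `|` i.2) w)))).
    apply: mean_ae_eq; [apply: m1|exact: m1|].
      by apply: measurable_funB => //; exact: measurable_funM.
    apply: filterS (W_additive HW fB fi iB) => w ->.
    by congr sign_average; ring.
  rewrite IH//.
  - by rewrite /total big_cons; congr (_ * cos_mean u _); rewrite !setUA.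
  - exact: finite_set_ofU.
  - by rewrite setIUr AB0 set0U.
  - move=> j js; rewrite -subset0 => x [jx [Ax|[Bx|ix]]].
    + by rewrite -(sAB j) ?inE ?js ?orbT//; split => //; left.
    + by rewrite -(sAB j) ?inE ?js ?orbT//; split => //; right.
    + by rewrite -(di j js); split.
have H1 := @has_mean_sign_average u s _ s1' (measurable_funD (mth A B)
  (measurable_funM (measurable_cst u) (mW i.2))).
have H2 := @has_mean_sign_average u s _ s1' (measurable_funB (mth A B)
  (measurable_funM (measurable_cst u) (mW i.2))).
rewrite /= meanD; [|exact: has_meanZ|exact: has_meanZ].
by rewrite !meanZ// E1 E2; field.
Qed.

End sign_mean.

(** * Characteristic function of the Wiener integral *)

Section characteristic_function.
Context {R : realType} {n : nat} {d : measure_display} {Omega : measurableType d}.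
Context {P : probability Omega R}.
Local Notation T := (space_time R n).
Local Notation mu := (@half_measure R n).
Variable W : set T -> {RV P >-> R}.
Hypothesis HW : gaussian_random_measure W.
Implicit Types (A B : set T) (u theta : R) (s : seq (R * set T)).

Let mW A : measurable_fun [set: Omega] (W A) := measurable_W W A.

Lemma W_exp4_bound : exists2 K : R, 0 <= K & forall A, finite_set_of A ->
  mean P (fun w => W A w ^+ 4) <= K * vol A ^+ 2.
Proof.
exists (64 * 64); first by rewrite mulr_ge0.
by move=> A fA; rewrite -mulrA; case: (W_exp4 HW fA).
Qed.

Lemma expRN_lipschitz (a b : R) : 0 <= a -> 0 <= b ->
  `|expR (- a) - expR (- b)| <= `|a - b|.
Proof.
wlog ab : a b / a <= b.
  move=> H a0 b0; have [ab|/ltW ba] := leP a b; first exact: H.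
  by rewrite distrC (distrC a); exact: H.
move=> a0 b0; rewrite ger0_norm ?subr_ge0 ?ler_expR ?lerN2//.
rewrite distrC (ger0_norm (_ : 0 <= b - a)) ?subr_ge0//.
have -> : expR (- b) = expR (- a) * expR (- (b - a)) by rewrite -expRD; congr expR; ring.
have := expR_ge1Dx (- (b - a)); have := expRN_le1 a0; have := expR_ge0 (- a).
move: (expR (- a)) (expR (- (b - a))) => x y x0 x1 y1.
have ba : 0 <= b - a by rewrite subr_ge0.
move: (b - a) ba y1 => c c0 y1.
have [y2|y2] := leP y 1; nra.
Qed.

(** The fluctuation of the conditional variance of the random signs around its
    deterministic limit. *)
Definition square_defect s w :=
  \sum_(i <- s) (1 - i.1 ^+ 2) * (W i.2 w ^+ 2 - vol i.2).

Lemma Lfun2_defect_cell (c : R) A : finite_set_of A ->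
  (fun w => c * (W A w ^+ 2 - vol A)) \in Lfun P 2%:E.
Proof.
move=> fA; apply: Lfun2Z; apply: Lfun2B; first exact: Lfun2_W2.
exact: Lfun_cst.
Qed.

Lemma Lfun2_square_defect s : finite_steps s -> square_defect s \in Lfun P 2%:E.
Proof.
elim: s => [_|i s IH /finite_steps_cons[fi fs]].
  rewrite (_ : square_defect [::] = fun=> 0); first exact: Lfun2_0.
  by apply/funext => w; rewrite /square_defect big_nil.
rewrite (_ : square_defect (i :: s) = fun w =>
  (1 - i.1 ^+ 2) * (W i.2 w ^+ 2 - vol i.2) + square_defect s w).
  by apply: Lfun2D; [exact: Lfun2_defect_cell|exact: IH].
by apply/funext => w; rewrite /square_defect big_cons.
Qed.

(** Functions of [W A] and of [W B] are uncorrelated for disjoint sets, so the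
    fluctuations add up in L^2. *)
Lemma mean_defect_cell_mul (c c' : R) A B : finite_set_of A -> finite_set_of B ->
  A `&` B = set0 ->
  mean P (fun w => c * (W A w ^+ 2 - vol A) * (c' * (W B w ^+ 2 - vol B))) = 0.
Proof.
move=> fA fB AB0.
have mh (e v : R) : measurable_fun [set: R] (fun x : R => e * (x ^+ 2 - v)).
  by apply: measurable_funM => //; apply: measurable_funB => //; exact: measurable_funX.
have i e A' : finite_set_of A' -> has_mean P (fun w => e * (W A' w ^+ 2 - vol A')).
  by move=> fA'; apply/has_mean_Lfun2/Lfun2_defect_cell.
rewrite (@independent_mean _ _ _ _ _ _ (fun x => c * (x ^+ 2 - vol A))
  (fun x => c' * (x ^+ 2 - vol B)) (W_independent HW fA fB AB0))//; last 2 first.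
- exact: i.
- exact: i.
rewrite /comp meanZ; last first.
  by apply: has_meanB; [exact/has_mean_sqr/Lfun2_W|exact: has_mean_cst].
rewrite meanB; [|exact/has_mean_sqr/Lfun2_W|exact: has_mean_cst].
by rewrite mean_W2// mean_cst subrr mulr0 mul0r.
Qed.

Lemma mean_sqr_defect (K : R) s : 0 <= K ->
  (forall A, finite_set_of A -> mean P (fun w => W A w ^+ 4) <= K * vol A ^+ 2) ->
  small_coefs s -> finite_steps s -> disjoint_steps s ->
  mean P (fun w => square_defect s w ^+ 2) <= K * \sum_(i <- s) vol i.2 ^+ 2.
Proof.
move=> K0 HK; elim: s => [|i s IH] s1 fs ds.
  rewrite (_ : (fun w => _) = fun=> 0) ?mean_cst ?big_nil ?mulr0//.
  by apply/funext => w; rewrite /square_defect big_nil expr0n.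
have [fi fs'] := finite_steps_cons fs; move: ds => /= [di ds].
have s1' : small_coefs s by move=> j js; apply: s1; rewrite inE js orbT.
pose Y w := (1 - i.1 ^+ 2) * (W i.2 w ^+ 2 - vol i.2).
have LY : Y \in Lfun P 2%:E by exact: Lfun2_defect_cell.
have LS := Lfun2_square_defect fs'.
have YS : mean P (fun w => Y w * square_defect s w) = 0.
  under eq_fun do rewrite /square_defect mulr_sumr.
  rewrite mean_sum_seq; last first.
    by move=> j js; apply: has_mean_mul => //; apply: Lfun2_defect_cell; exact: fs'.
  rewrite big_seq big1// => j js.
  by apply: mean_defect_cell_mul => //; [exact: fs'|exact: di].
have -> : (fun w => square_defect (i :: s) w ^+ 2) =
    (fun w => Y w ^+ 2 + (2 * (Y w * square_defect s w) + square_defect s w ^+ 2)).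
  by apply/funext => w; rewrite /square_defect big_cons -/(square_defect s w) -/(Y w); ring.
rewrite meanD; [|exact: has_mean_sqr|apply: has_meanD; [exact/has_meanZ/has_mean_mul|exact: has_mean_sqr]].
rewrite meanD; [|exact/has_meanZ/has_mean_mul|exact: has_mean_sqr].
rewrite meanZ; last exact: has_mean_mul.
rewrite YS mulr0 add0r big_cons mulrDr lerD//; last exact: IH.
have i1 : `|i.1| <= 1 by apply: s1; rewrite mem_head.
have k2 : 0 <= 1 - i.1 ^+ 2 <= 1.
  rewrite subr_ge0 gerBl sqr_ge0 andbT -(real_normK (num_real i.1)).
  by rewrite exprn_ile1.
have iW4 : has_mean P (fun w => W i.2 w ^+ 4) by case: (W_exp4 HW fi).
have iW2 : has_mean P (fun w => W i.2 w ^+ 2) by exact/has_mean_sqr/Lfun2_W.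
have v0 := vol_ge0 i.2.
apply: (@le_trans _ _ (mean P (fun w => W i.2 w ^+ 4 - 2 * vol i.2 * W i.2 w ^+ 2 + vol i.2 ^+ 2))).
  apply: le_mean; first exact: has_mean_sqr.
    by apply: has_meanD; [apply: has_meanB => //; exact: has_meanZ|exact: has_mean_cst].
  move=> w; rewrite /Y exprMn.
  have -> : W i.2 w ^+ 4 - 2 * vol i.2 * W i.2 w ^+ 2 + vol i.2 ^+ 2 =
    (W i.2 w ^+ 2 - vol i.2) ^+ 2 by ring.
  rewrite -[leRHS]mul1r ler_wpM2r ?sqr_ge0//.
  by move/andP: k2 => [k0 k1]; rewrite exprn_ile1.
rewrite meanD; [|by apply: has_meanB => //; exact: has_meanZ|exact: has_mean_cst].
rewrite meanB//; last exact: has_meanZ.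
rewrite meanZ// mean_W2// mean_cst.
have := HK _ fi; have := sqr_ge0 (vol i.2); move: (mean _ _) => a; nra.
Qed.

(** The weight [delta] trades the second moment, of order [vol A], for the fourth
    one, of order [vol A ^+ 2], which becomes small after refinement. *)
Lemma mean_cube (K delta u : R) A : 0 <= K -> 0 < delta ->
  (forall A, finite_set_of A -> mean P (fun w => W A w ^+ 4) <= K * vol A ^+ 2) ->
  finite_set_of A ->
  has_mean P (fun w => `|u * W A w| ^+ 3) /\
  mean P (fun w => `|u * W A w| ^+ 3) <=
    `|u| ^+ 3 / 2 * (delta * vol A + K / delta * vol A ^+ 2).
Proof.
move=> K0 d0 HK fA.
have iW4 : has_mean P (fun w => W A w ^+ 4) by case: (W_exp4 HW fA).
have iW2 : has_mean P (fun w => W A w ^+ 2) by exact/has_mean_sqr/Lfun2_W.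
pose Z w := `|u| ^+ 3 / 2 * (delta * W A w ^+ 2 + delta^-1 * W A w ^+ 4).
have iZ : has_mean P Z by apply: has_meanZ; apply: has_meanD; exact: has_meanZ.
have XZ w : `|u * W A w| ^+ 3 <= Z w.
  rewrite normrM exprMn /Z -[leRHS]mulrA ler_wpM2l ?exprn_ge0//.
  have -> : W A w ^+ 4 = (`|W A w| ^+ 2) ^+ 2 by rewrite real_normK ?num_real// -exprM.
  rewrite -(real_normK (num_real (W A w))); set y := `|W A w|.
  rewrite -subr_ge0.
  have -> : 2^-1 * (delta * y ^+ 2 + delta^-1 * (y ^+ 2) ^+ 2) - y ^+ 3 =
    y ^+ 2 * (delta - y) ^+ 2 / (2 * delta) by field; rewrite gt_eqF.
  apply: divr_ge0; first by apply: mulr_ge0; exact: sqr_ge0.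
  by apply: mulr_ge0 => //; exact: ltW.
have mX : measurable_fun [set: Omega] (fun w => `|u * W A w| ^+ 3).
  by apply: measurable_funX; apply: measurableT_comp => //; exact: measurable_funM.
have iX : has_mean P (fun w => `|u * W A w| ^+ 3).
  apply: has_mean_le mX iZ _ => w; rewrite ger0_norm ?exprn_ge0//.
  by rewrite (le_trans (XZ w))// ler_norm.
split => //; apply: (le_trans (le_mean iX iZ XZ)).
rewrite /Z meanZ; last by apply: has_meanD; exact: has_meanZ.
rewrite meanD ?meanZ ?mean_W2//; try exact: has_meanZ.
rewrite ler_wpM2l// ?divr_ge0 ?exprn_ge0// lerD2l.
rewrite [leRHS](_ : _ = delta^-1 * (K * vol A ^+ 2)); last by ring.
by rewrite ler_wpM2l ?invr_ge0 ?(ltW d0)//; exact: HK.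
Qed.

Lemma iter_refineP m s : finite_steps s -> disjoint_steps s -> small_coefs s ->
  let t := iter m (@refine R n) s in
  [/\ finite_steps t, disjoint_steps t, small_coefs t, total t = total s &
   [/\ {ae P, forall w, step_integral W t w = step_integral W s w},
   (forall g : R -> R, \sum_(i <- t) g i.1 * vol i.2 = \sum_(i <- s) g i.1 * vol i.2) &
   \sum_(i <- t) vol i.2 ^+ 2 = (\sum_(i <- s) vol i.2 ^+ 2) / 2 ^+ m]].
Proof.
move=> fs ds s1; elim: m => [|m [ft dt t1 tt [It gt vt]]] /=.
  by split => //; split; [exact: aeW|by []|rewrite divr1].
set t := iter m _ s in ft dt t1 tt It gt vt *.
split; [exact: finite_refine|exact: disjoint_refine| | |split].
- by move=> j /(refine_sub ft)[i [it -> _]]; exact: t1.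
- by rewrite total_refine.
- by apply: filterS2 (step_integral_refine HW ft) It => w -> ->.
- by move=> g; rewrite sum_refine.
- by rewrite sum_sqr_refine// vt exprS; field; rewrite expf_neq0.
Qed.

Lemma cos_lipschitz (x y : R) : `|cos x - cos y| <= `|x - y|.
Proof.
have H (a b : R) : a <= b -> `|cos b - cos a| <= b - a.
  move=> ab; have cf : {within `[a, b], continuous (@cos R)}.
    by apply: continuous_subspaceT => t; exact: continuous_cos.
  have [c _ ->] := MVT_segment ab (fun t _ => is_derive_cos t) cf.
  rewrite normrM normrN (ger0_norm (_ : 0 <= b - a)) ?subr_ge0//.
  by rewrite ler_piMl ?subr_ge0// ler_norm_sin.
have [xy|/ltW yx] := leP x y.
  by rewrite distrC (le_trans (H _ _ xy))// distrC ler_norm.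
by rewrite (le_trans (H _ _ yx))// ler_norm.
Qed.

(** The mean of the sign average over [s], refined [m] times, is computed in two
    ways: exactly by [mean_sign_average], and asymptotically by
    [sign_average_estimate].  The errors are the cubes of [W] on the cells and
    the square defect; both tend to [0] with the sum of squared volumes. *)
Lemma cos_mean_total theta u s : finite_steps s -> disjoint_steps s -> small_coefs s ->
  cos theta * cos_mean W u (total s) =
  mean P (fun w => cos (theta + u * step_integral W s w)) *
    expR (- (u ^+ 2 / 2 * \sum_(i <- s) (1 - i.1 ^+ 2) * vol i.2)).
Proof.
move=> fs ds s1; have [K K0 HK] := W_exp4_bound.
set V := \sum_(i <- s) _; set F := expR _.
pose V1 := \sum_(i <- s) vol i.2.
pose C := 2 * `|u| ^+ 3 * (V1 + 1) + u ^+ 2 / 2.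
apply/eqP; rewrite -subr_eq0 -normr_le0; apply/ler_addgt0Pr => eta' eta'0.
rewrite add0r.
have V10 : 0 <= V1 by apply: sumr_ge0 => i _; exact: vol_ge0.
have C0 : 0 <= C.
  by rewrite addr_ge0 ?divr_ge0 ?sqr_ge0// mulr_ge0 ?addr_ge0// mulr_ge0// exprn_ge0.
pose eta := eta' / (C + 1).
have C1 : 0 < C + 1 by rewrite ltr_wpDl.
have eta0 : 0 < eta by rewrite divr_gt0.
suff H : `|cos theta * cos_mean W u (total s) -
    mean P (fun w => cos (theta + u * step_integral W s w)) * F| <= C * eta.
  apply: (le_trans H); rewrite /eta mulrCA -[leRHS]mulr1 ler_wpM2l ?(ltW eta'0)//.
  by rewrite ler_pdivrMr// mul1r lerDl.
pose Q := \sum_(i <- s) vol i.2 ^+ 2.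
have Q0 : 0 <= Q by apply: sumr_ge0 => i _; exact: sqr_ge0.
(* refine until fourth moments are negligible *)
have [m Hm] : exists m : nat, K * (Q / 2 ^+ m) <= eta ^+ 2.
  pose q := K * Q / eta ^+ 2.
  exists (Num.truncn q).+1.
  have e2 : 0 < eta ^+ 2 by rewrite exprn_gt0.
  have q2 : q <= 2 ^+ (Num.truncn q).+1.
    apply: (@le_trans _ _ ((Num.truncn q).+1%:R)); first exact/ltW/truncnS_gt.
    by rewrite -natrX ler_nat ltnW// ltn_expl.
  by rewrite mulrA ler_pdivrMr ?exprn_gt0// [leRHS]mulrC -ler_pdivrMr.
have [] := iter_refineP m fs ds s1; set t := iter m _ s.
move=> ft dt t1 tt [It gt vt].
have mI s' : measurable_fun [set: Omega] (fun w => theta + u * step_integral W s' w).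
  by apply: measurable_funD => //; apply: measurable_funM => //; exact: measurable_step_integral.
have -> : mean P (fun w => cos (theta + u * step_integral W s w)) =
    mean P (fun w => cos (theta + u * step_integral W t w)).
  apply: mean_ae_eq.
  - exact: (measurableT_comp measurable_cosR (mI s)).
  - exact: (measurableT_comp measurable_cosR (mI t)).
  - by apply: filterS It => w ->.
have Vt : V = \sum_(i <- t) (1 - i.1 ^+ 2) * vol i.2 by rewrite (gt (fun x => 1 - x ^+ 2)).
have V0 : 0 <= V.
  rewrite /V big_seq; apply: sumr_ge0 => i is_; apply: mulr_ge0; last exact: vol_ge0.
  have := s1 _ is_; rewrite subr_ge0 -(real_normK (num_real i.1)) => i1.
  by rewrite exprn_ile1.
have f0 : @finite_set_of R n set0 by split; rewrite ?measure0.
have E0 : mean P (fun w => sign_average u (cell_values W t w) theta) =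
    cos theta * cos_mean W u (total s).
  rewrite -tt; have := @mean_sign_average _ _ _ _ _ _ HW theta u t set0 set0 t1 ft dt f0 f0.
  rewrite setI0 setU0 set0U => <- //; last by move=> i _; rewrite setI0.
  by congr (mean P _); apply/funext => w; rewrite subrr mulr0 addr0.
rewrite -E0.
pose SA w := sign_average u (cell_values W t w) theta.
pose CI w := cos (theta + u * step_integral W t w).
have iSA : has_mean P SA by apply: has_mean_sign_average.
have iCI : has_mean P CI by apply: has_mean_cos.
have -> : mean P CI * F = mean P (fun w => F * CI w) by rewrite meanZ// mulrC.
rewrite -meanB//; last exact: has_meanZ.
have iD : has_mean P (fun w => SA w - F * CI w) by apply: has_meanB => //; exact: has_meanZ.
apply: (le_trans (ler_norm_mean iD)).
(* pointwise error: the cubes, and the exponents by [expRN_lipschitz] *)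
pose B w := 4 * (\sum_(i <- t) `|u * W i.2 w| ^+ 3) + u ^+ 2 / 2 * `|square_defect t w|.
have icube i : i \in t -> has_mean P (fun w => `|u * W i.2 w| ^+ 3).
  by move=> it; case: (mean_cube u K0 eta0 HK (ft i it)).
have Lsd := Lfun2_square_defect ft.
have isum : has_mean P (fun w => \sum_(i <- t) `|u * W i.2 w| ^+ 3).
  exact: has_mean_sum_seq.
have isd : has_mean P (fun w => `|square_defect t w|).
  exact/has_mean_abs/has_mean_Lfun2.
have iB : has_mean P B by apply: has_meanD; exact: has_meanZ.
have bound w : `|SA w - F * CI w| <= B w.
  pose Vw := \sum_(i <- t) (1 - i.1 ^+ 2) * W i.2 w ^+ 2.
  have Vw0 : 0 <= Vw.
    rewrite /Vw big_seq; apply: sumr_ge0 => i it; apply: mulr_ge0; last exact: sqr_ge0.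
    have := t1 _ it; rewrite subr_ge0 -(real_normK (num_real i.1)) => i1.
    by rewrite exprn_ile1.
  have H1 := @sign_average_estimate _ u (cell_values W t w) theta (small_coefs_values t1).
  rewrite !big_map/= -/Vw in H1.
  have -> : SA w - F * CI w = (SA w - CI w * expR (- (u ^+ 2 / 2 * Vw))) +
     CI w * (expR (- (u ^+ 2 / 2 * Vw)) - F) by ring.
  apply: (le_trans (ler_normD _ _)); apply: lerD; first exact: H1.
  rewrite normrM; apply: (@le_trans _ _ (1 * (u ^+ 2 / 2 * `|square_defect t w|))); last by rewrite mul1r.
  apply: ler_pM => //; first exact: ler_norm_cos.
  have u2 : 0 <= u ^+ 2 / 2 by rewrite divr_ge0// sqr_ge0.
  apply: le_trans (expRN_lipschitz _ _) _; [exact: mulr_ge0|exact: mulr_ge0|].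
  rewrite -mulrBr normrM (ger0_norm u2) ler_wpM2l//.
  rewrite /Vw Vt /square_defect -sumrB.
  by under eq_bigr do rewrite -mulrBr.
apply: (le_trans (le_mean (has_mean_abs iD) iB bound)).
rewrite /B meanD; [|exact: has_meanZ|exact: has_meanZ].
rewrite !meanZ// mean_sum_seq//.
have b1 : \sum_(i <- t) mean P (fun w => `|u * W i.2 w| ^+ 3) <=
    `|u| ^+ 3 / 2 * (eta * V1 + eta).
  apply: (@le_trans _ _ (\sum_(i <- t) `|u| ^+ 3 / 2 *
      (eta * vol i.2 + K / eta * vol i.2 ^+ 2))).
    rewrite big_seq [leRHS]big_seq; apply: ler_sum => i it.
    by case: (mean_cube u K0 eta0 HK (ft i it)).
  rewrite -mulr_sumr ler_wpM2l ?divr_ge0 ?exprn_ge0//.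
  rewrite big_split/= -!mulr_sumr vt.
  have -> : \sum_(i <- t) vol i.2 = V1.
    transitivity (\sum_(i <- t) 1 * vol i.2); first by apply: eq_bigr => i _; rewrite mul1r.
    by rewrite (gt (fun=> 1)); apply: eq_bigr => i _; rewrite mul1r.
  by rewrite -/Q lerD2l mulrAC ler_pdivrMr// -expr2 -mulrA.
have b2 : mean P (fun w => `|square_defect t w|) <= eta.
  apply: mean_abs_norm2 => //; first exact: ltW.
  rewrite norm2_le_sqr; last exact: ltW.
  rewrite -mean_EFin; last exact: has_mean_sqr.
  rewrite lee_fin.
  apply: (le_trans (mean_sqr_defect K0 HK t1 ft dt)).
  by rewrite vt.
have u2 : 0 <= u ^+ 2 / 2 by rewrite divr_ge0// sqr_ge0.
apply: (@le_trans _ _ (4 * (`|u| ^+ 3 / 2 * (eta * V1 + eta)) + u ^+ 2 / 2 * eta)).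
  by apply: lerD; rewrite ler_wpM2l.
by rewrite le_eqVlt; apply/orP; left; apply/eqP; rewrite /C; field.
Qed.

(** The coefficient [0] in [cos_mean_total]. *)
Lemma cos_meanE u A : finite_set_of A -> cos_mean W u A = expR (- (u ^+ 2 / 2 * vol A)).
Proof.
move=> fA; have := @cos_mean_total 0 u [:: (0, A)].
rewrite cos0 mul1r /total big_seq1/= => ->.
- rewrite big_seq1/= expr0n subr0 mul1r.
  rewrite (_ : (fun w => _) = fun=> 1) ?mean_cst ?mul1r//.
  by apply/funext => w; rewrite /step_integral big_seq1/= mul0r mulr0 addr0 cos0.
- by move=> i; rewrite inE => /eqP ->.
- by [].
- by move=> i; rewrite inE => /eqP -> /=; rewrite normr0.
Qed.

Lemma disjoint_scale (a : R) s : disjoint_steps s -> disjoint_steps (step_scale a s).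
Proof.
elim: s => //= i s IH [di ds]; split; last exact: IH.
by move=> _ /mapP[j js ->] /=; exact: di.
Qed.

(** Scale the coefficients into [[-1, 1]] and divide [cos_mean_total] by the
    factor given by [cos_meanE]. *)
Lemma mean_cos_steps theta s : finite_steps s -> disjoint_steps s ->
  mean P (fun w => cos (theta + step_integral W s w)) =
  cos theta * expR (- (2^-1 * \sum_(i <- s) i.1 ^+ 2 * vol i.2)).
Proof.
move=> fs ds.
(* a positive bound of the coefficients, to scale them into [[-1, 1]] *)
pose u := 1 + \sum_(i <- s) `|i.1|.
have u0 : 0 < u by rewrite ltr_pwDl// sumr_ge0.
pose t := step_scale u^-1 s.
have ft : finite_steps t by exact: finite_steps_scale.
have dt : disjoint_steps t by exact: disjoint_scale.
have t1 : small_coefs t.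
  move=> _ /mapP[i is_ ->] /=; rewrite normrM ger0_norm ?invr_ge0 ?(ltW u0)//.
  rewrite mulrC ler_pdivrMr// mul1r /u.
  have : `|i.1| <= \sum_(i <- s) `|i.1| by rewrite (big_rem i)//= lerDl sumr_ge0.
  by lra.
have tot : total t = total s by rewrite /total big_map.
have := cos_mean_total theta u ft dt t1.
rewrite tot cos_meanE; last exact: finite_total.
have -> : (fun w => cos (theta + u * step_integral W t w)) =
    (fun w => cos (theta + step_integral W s w)).
  apply/funext => w; rewrite /t step_integral_scale mulrA divff ?mul1r//.
  by rewrite gt_eqF.
rewrite vol_total// /t big_map/=.
set S1 := \sum_(i <- s) vol i.2; set S2 := \sum_(i <- s) i.1 ^+ 2 * vol i.2.
have -> : \sum_(i <- s) (1 - (u^-1 * i.1) ^+ 2) * vol i.2 = S1 - u^-1 ^+ 2 * S2.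
  by rewrite /S1 /S2 mulr_sumr -sumrB; apply: eq_bigr => i _; ring.
have -> : - (u ^+ 2 / 2 * S1) = - (2^-1 * S2) + - (u ^+ 2 / 2 * (S1 - u^-1 ^+ 2 * S2)).
  by field; rewrite gt_eqF.
rewrite expRD mulrA => /mulIf H; apply/esym/H.
by rewrite gt_eqF// expR_gt0.
Qed.

Lemma mean_sqr_steps s : finite_steps s -> disjoint_steps s ->
  mean P (fun w => step_integral W s w ^+ 2) = \sum_(i <- s) i.1 ^+ 2 * vol i.2.
Proof.
elim: s => [_ _|i s IH /finite_steps_cons[fi fs] /= [di ds]].
  rewrite big_nil (_ : (fun w => _) = fun=> 0) ?mean_cst//.
  by apply/funext => w; rewrite /step_integral big_nil expr0n.
have LI := Lfun2_step_integral HW fs; have LW := Lfun2_W HW fi.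
have -> : (fun w => step_integral W (i :: s) w ^+ 2) =
    (fun w => i.1 ^+ 2 * W i.2 w ^+ 2 + (2 * i.1 * (W i.2 w * step_integral W s w) +
    step_integral W s w ^+ 2)).
  by apply/funext => w; rewrite /step_integral big_cons; ring.
have iX := has_mean_mul LW LI.
rewrite meanD; [|exact/has_meanZ/has_mean_sqr|apply: has_meanD; [exact/has_meanZ|exact: has_mean_sqr]].
rewrite meanD; [|exact/has_meanZ|exact: has_mean_sqr].
rewrite !meanZ//; last exact: has_mean_sqr.
rewrite IH// mean_W2// big_cons.
suff -> : mean P (fun w => W i.2 w * step_integral W s w) = 0 by rewrite mulr0 add0r.
under eq_fun do rewrite /step_integral mulr_sumr.
have E j : (fun w => W i.2 w * (j.1 * W j.2 w)) = (fun w => j.1 * (W i.2 w * W j.2 w)).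
  by apply/funext => w; ring.
rewrite mean_sum_seq; last first.
  by move=> j js; rewrite E; apply/has_meanZ/has_mean_mul => //; apply: Lfun2_W => //; exact: fs.
rewrite big_seq big1// => j js; rewrite E meanZ; last first.
  by apply: has_mean_mul => //; apply: Lfun2_W => //; exact: fs.
by rewrite mean_W_orthogonal ?mulr0//; [exact: fs|exact: di].
Qed.

(** Both sides are continuous in [h] for the L^2 norm, so step functions
    suffice. *)
Lemma mean_cos_wiener theta h : h \in Lfun mu 2%:E ->
  mean P (fun w => cos (theta + wiener_integral W h w)) =
  cos theta * expR (- (2^-1 * fine (norm2 mu h) ^+ 2)).
Proof.
move=> Lh; have mh := Lfun2_measurable Lh.
have [s [fds sh]] := step_dense Lh.
have fs j : finite_steps (s j) by have [] := fds j.
have ds j : disjoint_steps (s j) by have [] := fds j.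
have [I [LI sI]] := norm2_step_cvg HW fs Lh sh.
have wI : is_wiener_integral W h I by split => //; exists s; split.
have LW := Lfun2_wiener HW Lh.
have -> : mean P (fun w => cos (theta + wiener_integral W h w)) =
    mean P (fun w => cos (theta + I w)).
  apply: mean_ae_eq.
  - apply: (measurableT_comp measurable_cosR); apply: measurable_funD => //.
    exact: Lfun2_measurable LW.
  - apply: (measurableT_comp measurable_cosR); apply: measurable_funD => //.
    exact: Lfun2_measurable LI.
  - by apply: filterS (wiener_unique HW mh (wiener_integralP HW Lh) wI) => w ->.
set a := fine (norm2 mu h).
have ha : norm2 mu h = a%:E.
  by rewrite fineK// ge0_fin_numE ?norm2_ge0//; case/Lfun2P: Lh.
have a0 : 0 <= a by rewrite fine_ge0// norm2_ge0.
apply/eqP; rewrite -subr_eq0 -normr_le0; apply/ler_addgt0Pr => eta' eta'0.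
rewrite add0r.
pose e := Num.min 1 (eta' / (a + 2)).
have e0 : 0 < e by rewrite lt_min ltr01 divr_gt0// ltr_wpDl.
have e1 : e <= 1 by rewrite ge_min lexx.
have ea : (a + 2) * e <= eta'.
  rewrite mulrC -ler_pdivlMr; last by rewrite ltr_wpDl.
  by rewrite ge_min lexx orbT.
have [N1 _ H1] := cvge0_near sh e0.
have [N2 _ H2] := cvge0_near sI e0.
pose j := maxn N1 N2.
have {}H1 := H1 j (leq_maxl _ _); have {}H2 := H2 j (leq_maxr _ _).
rewrite /= in H1 H2.
have LIj := Lfun2_step_integral HW (fs j).
have Lsj := Lfun2_step_fun HW (fs j).
set b := fine (norm2 mu (step_fun (s j))).
have hb : norm2 mu (step_fun (s j)) = b%:E.
  by rewrite fineK// ge0_fin_numE ?norm2_ge0//; case/Lfun2P: Lsj.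
have b0 : 0 <= b by rewrite fine_ge0// norm2_ge0.
have msj := Lfun2_measurable Lsj.
have ab : a <= e + b.
  rewrite -lee_fin EFinD -ha -hb.
  have : (norm2 mu h <= norm2 mu (h \- step_fun (s j))%R + norm2 mu (step_fun (s j)))%E.
    rewrite [X in (norm2 _ X <= _)%E](_ : h = (h \- step_fun (s j)) \+ step_fun (s j))%R; last first.
      by apply/funext => p /=; rewrite subrK.
    by apply: norm2D => //; exact: measurable_funB.
  by move/le_trans; apply; rewrite leeD2r// norm2BC.
have ba : b <= e + a.
  rewrite -lee_fin EFinD -ha -hb.
  have : (norm2 mu (step_fun (s j)) <= norm2 mu (step_fun (s j) \- h)%R + norm2 mu h)%E.
    rewrite [X in (norm2 _ X <= _)%E](_ : step_fun (s j) = (step_fun (s j) \- h) \+ h)%R; last first.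
      by apply/funext => p /=; rewrite subrK.
    by apply: norm2D => //; exact: measurable_funB.
  by move/le_trans; apply; rewrite leeD2r.
have E := mean_cos_steps theta (fs j) (ds j).
rewrite -mean_sqr_steps// in E.
have Eb : mean P (fun w => step_integral W (s j) w ^+ 2) = b ^+ 2.
  by apply: EFin_inj; rewrite -norm2_mean_sqr// step_isometry// hb -EFin_expe.
rewrite Eb in E.
have mc X : X \in Lfun P 2%:E -> has_mean P (fun w => cos (theta + X w)).
  move=> LX; apply: has_mean_cos; apply: measurable_funD => //.
  exact: Lfun2_measurable LX.
have D1 : `|mean P (fun w => cos (theta + I w)) -
    mean P (fun w => cos (theta + step_integral W (s j) w))| <= e.
  rewrite -meanB; [|exact: mc|exact: mc].
  apply: (le_trans (ler_norm_mean _)); first by apply: has_meanB; exact: mc.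
  have LD : (fun w => step_integral W (s j) w - I w) \in Lfun P 2%:E by exact: Lfun2B.
  apply: le_trans (mean_abs_norm2 LD (ltW e0) H2).
  apply: le_mean.
  - by apply/has_mean_abs/has_meanB; exact: mc.
  - exact/has_mean_abs/has_mean_Lfun2.
  - move=> w; apply: (le_trans (cos_lipschitz _ _)).
    by rewrite distrC (_ : _ - _ = step_integral W (s j) w - I w)//; ring.
have D2 : `|cos theta * expR (- (2^-1 * b ^+ 2)) - cos theta * expR (- (2^-1 * a ^+ 2))| <=
    2^-1 * (e * (2 * a + e)).
  rewrite -mulrBr normrM; apply: (@le_trans _ _ (1 * `|2^-1 * b ^+ 2 - 2^-1 * a ^+ 2|)).
    apply: ler_pM => //; first exact: ler_norm_cos.
    by apply: expRN_lipschitz; rewrite mulr_ge0// sqr_ge0.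
  rewrite mul1r -mulrBr normrM ger0_norm// ler_wpM2l//.
  by rewrite ler_norml; apply/andP; split; nra.
rewrite (_ : _ - _ = (mean P (fun w => cos (theta + I w)) -
    mean P (fun w => cos (theta + step_integral W (s j) w))) +
   (cos theta * expR (- (2^-1 * b ^+ 2)) - cos theta * expR (- (2^-1 * a ^+ 2)))); last first.
  by rewrite E; ring.
apply: (le_trans (ler_normD _ _)); apply: le_trans (lerD D1 D2) _.
by apply: le_trans ea; nra.
Qed.

End characteristic_function.

(** * Lipschitz functions of several measurable functions *)

Section lipschitz_measurable.
Context {R : realType}.

(** [H < c] at a point iff the Lipschitz upper bound computed from some rational
    vector is below [c]: a countable union of measurable sets. *)
Lemma measurable_lipschitz (N : nat) (H : ('I_N -> R) -> R) (L : R)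
    (d : measure_display) (T : measurableType d) (F : 'I_N -> T -> R) :
  0 <= L -> (forall x y, `|H x - H y| <= L * \sum_j `|x j - y j|) ->
  (forall j, measurable_fun [set: T] (F j)) ->
  measurable_fun [set: T] (fun t => H (F ^~ t)).
Proof.
move=> L0 LH mF _; apply: (measurability _ (RGenInftyO.measurableE R)) => //.
move=> _ [_ [c ->] <-]; rewrite setTI.
pose V (q : {ffun 'I_N -> rat}) : set T :=
  [set t | H (fun j => ratr (q j)) + L * \sum_j `|F j t - ratr (q j)| < c].
have mV q : measurable (V q).
  have mf : measurable_fun [set: T]
      (fun t => H (fun j => ratr (q j)) + L * \sum_j `|F j t - ratr (q j)|).
    apply: measurable_funD => //; apply: measurable_funM => //.
    apply: measurable_sum => j; apply: measurableT_comp => //.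
    exact: measurable_funB.
  rewrite (_ : V q = (fun t => H (fun j => ratr (q j)) +
    L * \sum_j `|F j t - ratr (q j)|) @^-1` `]-oo, c[%classic).
    by rewrite -[X in measurable X]setTI; exact: mf.
  by apply/seteqP; split => t; rewrite /V/= in_itv.
pose U n : set T := oapp V set0 (@choice.unpickle {ffun 'I_N -> rat} n).
rewrite (_ : _ @^-1` _ = \bigcup_n U n).
  by apply: bigcup_measurable => n _; rewrite /U; case: choice.unpickle => [q|] /=.
apply/seteqP; split => [t /=|t [n _]]; rewrite ?in_itv/=; last first.
  rewrite /U; case: choice.unpickle => //= q; rewrite /V/=; apply: le_lt_trans.
  have := le_trans (ler_norm _) (LH (F^~ t) (fun j => ratr (q j))).
  by rewrite lerBlDl.
move=> Htc; pose e := (c - H (F^~ t)) / (2 * (L + 1) * N.+1%:R).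
have L1 : 0 < L + 1 by rewrite ltr_wpDl.
have N0 : 0 < N.+1%:R :> R by [].
have e0 : 0 < e by rewrite divr_gt0 ?subr_gt0// !mulr_gt0.
have /choice[q Hq] : forall j, exists q : rat, `|F j t - ratr q| < e.
  move=> j; have [|q] := @rat_in_itvoo R (F j t - e) (F j t + e).
    by rewrite ltrD2l gtrN.
  by rewrite in_itv/= => /andP[q1 q2]; exists q; rewrite ltr_norml; lra.
exists (choice.pickle [ffun j => q j]) => //; rewrite /U choice.pickleK /V/=.
have Eq : (fun j => ratr ([ffun j => q j] j) : R) = (fun j => ratr (q j)).
  by apply/funext => j; rewrite ffunE.
under eq_bigr do rewrite ffunE.
rewrite Eq.
have S : \sum_j `|F j t - ratr (q j)| <= N%:R * e.
  rewrite -[X in X%:R * _]card_ord mulr_natl -sumr_const.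
  by apply: ler_sum => j _; exact/ltW/Hq.
have := le_trans (ler_norm _) (LH (fun j => ratr (q j)) (F^~ t)).
have LS : L * \sum_j `|F j t - ratr (q j)| <= L * (N%:R * e) by rewrite ler_wpM2l.
have LN : L * (N%:R * e) < (c - H (F^~ t)) / 2.
  rewrite [ltRHS](_ : _ = (L + 1) * (N.+1%:R * e)); last first.
    by rewrite /e; field; rewrite !gt_eqF.
  apply: (@le_lt_trans _ _ (L * (N.+1%:R * e))).
    by rewrite ler_wpM2l// ler_wpM2r ?(ltW e0)// ler_nat.
  by rewrite [ltRHS]mulrDl mul1r ltrDl mulr_gt0.
move: LS LN; set s := \sum_j _; set b := H _; set a := H _ => LS LN.
rewrite (eq_bigr (fun j => `|F j t - ratr (q j)|)); last by move=> j _; rewrite distrC.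
rewrite -/s => ab.
have : a - b <= (c - b) / 2 by apply: (le_trans ab); apply: (le_trans LS); exact: ltW.
by lra.
Qed.

End lipschitz_measurable.

Section fubini_mean.
Context {R : realType} {d : measure_display} {T : measurableType d}.
Variable P : probability T R.

Lemma integrable_bounded_pair (M : R) (f : T * T -> R) : measurable_fun [set: T * T] f ->
  (forall z, `|f z| <= M) -> (P \x P)%E.-integrable setT (EFin \o f).
Proof.
move=> mf fM; apply: measurable_bounded_integrable => //.
  have : ((P \x P) (setT `*` setT) < +oo)%E.
    rewrite product_measure1E// [X in (X * _)%E](_ : _ = 1%E); last exact: probability_setT.
    rewrite mul1e [X in (X < _)%E](_ : _ = 1%E); last exact: probability_setT.
    exact: ltry.
  by rewrite setXTT.
exists M; split; first exact: num_real.
by move=> K MK z _ /=; rewrite (le_trans (fM z))// ltW.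
Qed.

Lemma mean_fubini (M : R) (f : T * T -> R) : measurable_fun [set: T * T] f ->
  (forall z, `|f z| <= M) ->
  mean P (fun w => mean P (fun v => f (w, v))) =
  mean P (fun v => mean P (fun w => f (w, v))).
Proof.
move=> mf fM; have if_ := integrable_bounded_pair mf fM.
have m1 w : measurable_fun [set: T] (fun v => f (w, v)).
  by apply: (measurableT_comp mf); exact: pair1_measurable.
have m2 v : measurable_fun [set: T] (fun w => f (w, v)).
  by apply: (measurableT_comp mf); exact: pair2_measurable.
have i1 w : has_mean P (fun v => f (w, v)) by apply: (@has_mean_bounded _ _ _ _ M _ (m1 w)).
have i2 v : has_mean P (fun w => f (w, v)) by apply: (@has_mean_bounded _ _ _ _ M _ (m2 v)).
rewrite /mean; congr fine.
transitivity (\int[P]_w \int[P]_v (f (w, v))%:E)%E.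
  by apply: eq_integral => w _; rewrite -mean_EFin.
transitivity (\int[P]_v \int[P]_w (f (w, v))%:E)%E; first exact: (Fubini if_).
by apply: eq_integral => w _; rewrite -mean_EFin.
Qed.

End fubini_mean.

(** * Gaussian smoothing of one coordinate *)

Section smoothing.
Context {R : realType} {d : measure_display} {T : measurableType d}.
Variable P : probability T R.
Variables (M L : R) (D : T -> R -> R) (Z : T -> R).
Hypothesis mD : measurable_fun [set: T * measurableTypeR R] (fun p => D p.1 p.2).
Hypothesis D0 : forall w y, 0 <= D w y.
Hypothesis DM : forall w y, D w y <= M.
Hypothesis DL : forall w y y', `|D w y - D w y'| <= L * `|y - y'|.
Hypothesis mZ : measurable_fun [set: T] Z.

Let lam : {sigma_finite_measure set (measurableTypeR R) -> \bar R} := @lebesgue_measure R.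

Lemma measurable_section y : measurable_fun [set: T] (D ^~ y).
Proof. exact: (measurableT_comp mD (pair2_measurable y)). Qed.

Lemma measurable_section2 w : measurable_fun [set: measurableTypeR R] (D w).
Proof. exact: (measurableT_comp mD (pair1_measurable w)). Qed.

Lemma measurable_diagonal : measurable_fun [set: T] (fun w => D w (Z w)).
Proof.
have mp : measurable_fun [set: T] (fun w => (w, Z w) : T * measurableTypeR R).
  by apply: measurable_fun_pair => //.
exact: (measurableT_comp mD mp).
Qed.

Let mpdf s : s != 0 -> measurable_fun [set: T * measurableTypeR R]
  (fun p => normal_pdf (Z p.1) s p.2).
Proof.
move=> s0; rewrite (_ : (fun p => _) = (fun p => normal_peak s *
    expR (- (p.2 - Z p.1) ^+ 2 / (s ^+ 2 *+ 2)))); last first.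
  by apply/funext => p; rewrite normal_pdfE.
apply: measurable_funM => //; apply: measurableT_comp => //.
apply: measurable_funM => //; apply: measurableT_comp => //.
apply: measurable_funX; apply: measurable_funB; first exact: measurable_snd.
by apply: (measurableT_comp mZ); exact: measurable_fst.
Qed.

(** By Tonelli the smoothed expectation is the mean of the average of [D w] under
    the normal law centered at [Z w], which differs from [D w (Z w)] by at most
    [L] times the mean deviation. *)
Lemma smoothing_error s : s != 0 ->
  `|mean P (fun w => D w (Z w)) - fine (\int[lam]_y
     (mean P (fun w => D w y * normal_pdf (Z w) s y))%:E)%E| <= 4 * L * `|s|.
Proof.
move=> s0.
pose f p := (D p.1 p.2 * normal_pdf (Z p.1) s p.2)%:E.
have f0 p : (0 <= f p)%E by rewrite lee_fin mulr_ge0// normal_pdf_ge0.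
have mf : measurable_fun [set: T * measurableTypeR R] f.
  by apply/measurable_EFinP; apply: measurable_funM => //; exact: mpdf.
pose A w := fine (\int[lam]_y f (w, y))%E.
have Aint w : (\int[lam]_y f (w, y) = \int[normal_prob (Z w) s]_y (D w y)%:E)%E.
  by rewrite ge0_integral_normal_prob//; exact: measurable_section2.
have iD w : has_mean (normal_prob (Z w) s) (D w).
  apply: (@has_mean_bounded _ _ _ _ M); first exact: measurable_section2.
  by move=> y; rewrite ger0_norm.
have AE w : A w = mean (normal_prob (Z w) s) (D w) by rewrite /A Aint.
have AEE w : ((A w)%:E = \int[lam]_y f (w, y))%E.
  by rewrite AE mean_EFin.
have A0 w : 0 <= A w by rewrite AE mean_ge0.
have AM w : A w <= M.
  by rewrite AE -[leRHS](mean_cst (normal_prob (Z w) s)) le_mean//; exact: has_mean_cst.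
have mA : measurable_fun [set: T] A.
  apply/measurable_EFinP; rewrite (_ : _ \o _ = fun w => \int[lam]_y f (w, y))%E.
    exact: (@measurable_fun_fubini_tonelli_F _ _ _ _ _ lam f mf f0).
  by apply/funext => w /=; rewrite AEE.
have iA : has_mean P A.
  by apply: (@has_mean_bounded _ _ _ _ M) => // w; rewrite ger0_norm.
have AD w : `|D w (Z w) - A w| <= 4 * L * `|s|.
  rewrite AE -[X in X - _](mean_cst (normal_prob (Z w) s)) -meanB//; last exact: has_mean_cst.
  have iB : has_mean (normal_prob (Z w) s) (fun y => D w (Z w) - D w y).
    by apply: has_meanB => //; exact: has_mean_cst.
  apply: le_trans (ler_norm_mean iB) _.
  rewrite -lee_fin mean_EFin; last exact: has_mean_abs.
  apply: (@le_trans _ _ (\int[normal_prob (Z w) s]_y (L%:E * `|y - Z w|%:E))%E).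
    apply: ge0_le_integral => //.
    - apply/measurable_EFinP; apply: measurableT_comp => //.
      by apply: measurable_funB => //; exact: measurable_section2.
    - apply/measurable_EFinP => /=; apply: measurable_funM => //.
      by apply: measurableT_comp => //; exact: measurable_funB.
    - by move=> y _; rewrite -EFinM lee_fin (distrC y).
  have L0 : 0 <= L.
    have := le_trans (normr_ge0 _) (DL w 1 0).
    by rewrite subr0 normr1 mulr1.
  rewrite ge0_integralZl//; first last.
    apply/measurable_EFinP => /=; apply: measurableT_comp => //.
    exact: measurable_funB.
  rewrite (_ : 4 * L * `|s| = L * (4 * `|s|)); last by ring.
  by rewrite EFinM lee_wpmul2l ?lee_fin//; exact: integral_normal_prob_abs.
have -> : (\int[lam]_y (mean P (fun w => D w y * normal_pdf (Z w) s y))%:E = (mean P A)%:E)%E.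
  rewrite mean_EFin//.
  transitivity (\int[lam]_y \int[P]_w f (w, y))%E.
    apply: eq_integral => y _; rewrite mean_EFin//.
    apply: (@has_mean_bounded _ _ _ _ (M * normal_peak s)).
      apply: measurable_funM; first exact: measurable_section.
      exact: (measurableT_comp (mpdf s0) (pair2_measurable y)).
    move=> w; rewrite ger0_norm ?mulr_ge0 ?normal_pdf_ge0//.
    by rewrite ler_pM ?normal_pdf_ge0//; exact: normal_pdf_ub.
  rewrite -(@fubini_tonelli _ _ _ _ _ P lam f mf f0).
  by apply: eq_integral => w _; rewrite AEE.
rewrite /= -meanB//; last first.
  apply: (@has_mean_bounded _ _ _ _ M); first exact: measurable_diagonal.
  by move=> w; rewrite ger0_norm.
have iB : has_mean P (fun w => D w (Z w) - A w).
  apply: has_meanB => //.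
  apply: (@has_mean_bounded _ _ _ _ M); first exact: measurable_diagonal.
  by move=> w; rewrite ger0_norm.
apply: le_trans (ler_norm_mean iB) _.
rewrite -[leRHS](mean_cst P); apply: le_mean => //; first exact: has_mean_abs.
exact: has_mean_cst.
Qed.

End smoothing.

(** * Transfer of one coordinate *)

Section equal_characteristic.
Context {R : realType} {d : measure_display} {T : measurableType d}.
Variable P : probability T R.
Variables (G : T -> R) (tau : R).
Hypothesis mG : measurable_fun [set: T] G.
Hypothesis tau0 : 0 < tau.
Hypothesis charG : forall v, mean P (fun w => cos (v * G w)) = expR (- (2^-1 * (tau * v ^+ 2))).

(** The Gaussian function is its own Fourier transform; here the transform is an
    expectation of cosines of the Gaussian variable [G]. *)
Lemma gaussian_kernel z s y : 0 < s -> normal_pdf z s y = normal_peak s *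
  mean P (fun w => cos (- (y * (G w / (s * Num.sqrt tau))) + G w / (s * Num.sqrt tau) * z)).
Proof.
move=> s0; have s1 : s != 0 by rewrite gt_eqF.
have t1 : Num.sqrt tau != 0 by rewrite gt_eqF// sqrtr_gt0.
rewrite normal_pdfE//; congr (_ * _).
rewrite (_ : (fun w => _) = fun w => cos ((z - y) / (s * Num.sqrt tau) * G w)); last first.
  by apply/funext => w; congr cos; field; rewrite ?s1 ?t1.
rewrite charG /normal_fun; congr expR.
rewrite -[X in _ * (X * _)](sqr_sqrtr (ltW tau0)).
by field; rewrite ?s1 ?t1.
Qed.

Section transfer.
Variables (M L : R) (D D' : T -> R -> R) (Z Z' : T -> R).
Hypothesis mD : measurable_fun [set: T * measurableTypeR R] (fun p => D p.1 p.2).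
Hypothesis D0 : forall w y, 0 <= D w y.
Hypothesis DM : forall w y, D w y <= M.
Hypothesis DL : forall w y y', `|D w y - D w y'| <= L * `|y - y'|.
Hypothesis mZ : measurable_fun [set: T] Z.
Hypothesis mD' : measurable_fun [set: T * measurableTypeR R] (fun p => D' p.1 p.2).
Hypothesis D'0 : forall w y, 0 <= D' w y.
Hypothesis D'M : forall w y, D' w y <= M.
Hypothesis D'L : forall w y y', `|D' w y - D' w y'| <= L * `|y - y'|.
Hypothesis mZ' : measurable_fun [set: T] Z'.
Hypothesis DD' : forall y theta u, mean P (fun w => D w y * cos (theta + u * Z w)) =
  mean P (fun w => D' w y * cos (theta + u * Z' w)).

Lemma smoothing_kernel (E : T -> R -> R) (V : T -> R) s y :
  measurable_fun [set: T * measurableTypeR R] (fun p => E p.1 p.2) ->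
  (forall w y, 0 <= E w y) -> (forall w y, E w y <= M) -> measurable_fun [set: T] V -> 0 < s ->
  mean P (fun w => E w y * normal_pdf (V w) s y) = normal_peak s * mean P (fun w' =>
    mean P (fun w => E w y * cos (- (y * (G w' / (s * Num.sqrt tau))) +
      G w' / (s * Num.sqrt tau) * V w))).
Proof.
move=> mE E0 EM mV s0.
pose f p := E p.1 y * cos (- (y * (G p.2 / (s * Num.sqrt tau))) +
  G p.2 / (s * Num.sqrt tau) * V p.1).
have fM p : `|f p| <= M.
  rewrite normrM (ger0_norm (E0 _ _)) -[leRHS]mulr1 ler_pM//.
  by rewrite ler_norml cos_geN1 cos_le1.
have mEy : measurable_fun [set: T] (E ^~ y) by exact: (measurable_section mE).
have mc : measurable_fun [set: T * T] (fun p => G p.2 / (s * Num.sqrt tau)).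
  by apply: measurable_funM => //; apply: (measurableT_comp mG); exact: measurable_snd.
have mf : measurable_fun [set: T * T] f.
  apply: measurable_funM.
    by apply: (measurableT_comp mEy); exact: measurable_fst.
  apply: (measurableT_comp (@measurable_cosR R)); apply: measurable_funD.
    by apply: measurableT_comp => //; apply: measurable_funM.
  by apply: measurable_funM => //; apply: (measurableT_comp mV); exact: measurable_fst.
rewrite -(mean_fubini P mf fM) -meanZ.
  congr mean; apply/funext => w; rewrite gaussian_kernel// mulrCA; congr (_ * _).
  rewrite -meanZ//; apply: (@has_mean_bounded _ _ _ _ 1).
    apply: (measurableT_comp (@measurable_cosR R)).
    apply: measurable_funD; last by apply: measurable_funM => //; apply: measurable_funM.
    apply: measurableT_comp => //; apply: measurable_funM => //.
    by apply: measurable_funM.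
  by move=> w'; rewrite ler_norml cos_geN1 cos_le1.
have mfw w : measurable_fun [set: T] (fun w' => f (w, w')).
  exact: (measurableT_comp mf (pair1_measurable w)).
have iP := integrable_bounded_pair P mf fM.
have i1 w : has_mean P (fun w' => f (w, w')) by apply: (@has_mean_bounded _ _ _ _ M _ (mfw w)).
have := @integrable_fubini_F _ _ _ _ _ P P _ iP.
apply: eq_integrable => // w _; rewrite /fubini_F /=.
by rewrite -mean_EFin.
Qed.

(** After smoothing, the two expectations are integrals of means of
    [D w y * cos (a + b * Z w)], which agree by hypothesis; then the smoothing
    parameter tends to [0]. *)
Lemma transfer_coordinate :
  mean P (fun w => D w (Z w)) = mean P (fun w => D' w (Z' w)).
Proof.
have key s : 0 < s ->
    `|mean P (fun w => D w (Z w)) - mean P (fun w => D' w (Z' w))| <= 8 * L * s.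
  move=> s0; have sn0 : s != 0 by rewrite gt_eqF.
  have E y : mean P (fun w => D' w y * normal_pdf (Z' w) s y) =
      mean P (fun w => D w y * normal_pdf (Z w) s y).
    rewrite (smoothing_kernel y mD D0 DM mZ s0) (smoothing_kernel y mD' D'0 D'M mZ' s0).
    by congr (_ * mean P _); apply/funext => w'; rewrite DD'.
  have := smoothing_error P mD' D'0 D'M D'L mZ' sn0.
  have := smoothing_error P mD D0 DM DL mZ sn0.
  rewrite (gtr0_norm s0) (_ : (fun y => (mean P (fun w => D' w y * normal_pdf (Z' w) s y))%:E) =
    (fun y => (mean P (fun w => D w y * normal_pdf (Z w) s y))%:E)); last first.
    by apply/funext => y; rewrite E.
  set I := fine _; move: (mean _ _) (mean _ _) => a b.
  rewrite !ler_norml => /andP[a1 a2] /andP[b1 b2]; apply/andP; split; lra.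
apply/eqP; rewrite -subr_eq0 -normr_le0; apply/ler_addgt0Pr => e e0; rewrite add0r.
have [L0|L0] := leP L 0.
  have := key _ ltr01; move=> /le_trans; apply; rewrite mulr1; lra.
have := key (e / (8 * L)) (divr_gt0 e0 (mulr_gt0 _ L0)).
by rewrite mulrCA divff ?mulr1 ?gt_eqF ?mulr_gt0//; apply.
Qed.

End transfer.

End equal_characteristic.

(** * Bounded Lipschitz functions of vectors with equal characteristic functions *)

Section joint_law.
Context {R : realType} {d : measure_display} {T : measurableType d}.
Variable P : probability T R.
Variables (G : T -> R) (tau : R).
Hypothesis mG : measurable_fun [set: T] G.
Hypothesis tau0 : 0 < tau.
Hypothesis charG : forall v, mean P (fun w => cos (v * G w)) = expR (- (2^-1 * (tau * v ^+ 2))).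
Variables (N : nat) (H : ('I_N -> R) -> R) (M L : R).
Hypothesis L0 : 0 <= L.
Hypothesis HM : forall x, `|H x| <= M.
Hypothesis HL : forall x y, `|H x - H y| <= L * \sum_j `|x j - y j|.

(** The first [k] coordinates are random and the other ones are frozen; [phase]
    keeps the oscillation in the coordinates that are still frozen. *)
Definition mix (k : nat) (V : 'I_N -> T -> R) (x : 'I_N -> R) (w : T) : 'I_N -> R :=
  fun j => if (j < k)%N then V j w else x j.

Definition upd (x : 'I_N -> R) (i : 'I_N) (y : R) : 'I_N -> R :=
  fun j => if j == i then y else x j.

Definition phase (k : nat) (u : 'I_N -> R) (V : 'I_N -> T -> R) (w : T) : R :=
  \sum_(j < N) (if (j < k)%N then 0 else u j) * V j w.

Let slice (V : 'I_N -> T -> R) (i : 'I_N) (x u : 'I_N -> R) (theta : R) (w : T) (y : R) : R :=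
  H (mix i V (upd x i y) w) * cos (theta + phase i.+1 u V w) + M.

Lemma measurable_phase k u V : (forall j, measurable_fun [set: T] (V j)) ->
  measurable_fun [set: T] (phase k u V).
Proof. by move=> mV; apply: measurable_sum => j; apply: measurable_funM. Qed.

Let cos1 (a : R) : `|cos a| <= 1. Proof. by rewrite ler_norml cos_geN1 cos_le1. Qed.

Let Hcos x a : `|H x * cos a| <= M.
Proof. by rewrite normrM -[leRHS]mulr1 ler_pM. Qed.

Let slice_ge0 V i x u theta w y : 0 <= slice V i x u theta w y.
Proof.
have := Hcos (mix i V (upd x i y) w) (theta + phase i.+1 u V w).
by rewrite /slice ler_norml => /andP[]; lra.
Qed.

Let slice_le V i x u theta w y : slice V i x u theta w y <= M + M.
Proof.
have := Hcos (mix i V (upd x i y) w) (theta + phase i.+1 u V w).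
by rewrite /slice ler_norml => /andP[]; lra.
Qed.

Let slice_lip V i x u theta w y y' :
  `|slice V i x u theta w y - slice V i x u theta w y'| <= L * `|y - y'|.
Proof.
rewrite /slice (_ : _ - _ = (H (mix i V (upd x i y) w) - H (mix i V (upd x i y') w)) *
  cos (theta + phase i.+1 u V w)); last by ring.
rewrite normrM -[leRHS]mulr1 ler_pM//.
apply: le_trans (HL _ _) _; rewrite ler_wpM2l//.
rewrite (bigD1 i)//= big1 ?addr0 /mix ?ltnn /upd ?eqxx// => j ji.
by case: ifP => _; rewrite ?(negbTE ji) subrr normr0.
Qed.

Let measurable_mix V (i : 'I_N) x : (forall j, measurable_fun [set: T] (V j)) ->
  measurable_fun [set: T * measurableTypeR R]
    (fun p => H (mix i V (upd x i p.2) p.1)).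
Proof.
move=> mV.
apply: (@measurable_lipschitz _ _ H L _ _ (fun j p => mix i V (upd x i p.2) p.1 j)) => // j.
rewrite /mix /upd; case: (j < i)%N; first exact: (measurableT_comp (mV j) measurable_fst).
by case: (j == i); [exact: measurable_snd|exact: measurable_cst].
Qed.

Let measurable_slice V i x u theta : (forall j, measurable_fun [set: T] (V j)) ->
  measurable_fun [set: T * measurableTypeR R]
    (fun p => slice V i x u theta p.1 p.2).
Proof.
move=> mV; apply: measurable_funD => //; apply: measurable_funM; first exact: measurable_mix.
apply: (measurableT_comp (@measurable_cosR R)); apply: measurable_funD => //.
by apply: (measurableT_comp (measurable_phase i.+1 u mV)); exact: measurable_fst.
Qed.

Let phase_upd V (i : 'I_N) u v w : phase i (upd u i v) V w = v * V i w + phase i.+1 u V w.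
Proof.
rewrite /phase (bigD1 i)//= ltnn /upd eqxx [in RHS](bigD1 i)//= ltnSn mul0r add0r.
congr (_ + _); apply: eq_bigr => j ji; rewrite (negbTE ji) ltnS [in RHS]leq_eqVlt.
by rewrite -val_eqE in ji; rewrite (negbTE ji).
Qed.

(** The product of two cosines is a sum of two cosines, which turns an
    oscillation in the coordinate [i] into two phases containing it. *)
Lemma mean_slice_cos V (i : 'I_N) x u theta y a v : (forall j, measurable_fun [set: T] (V j)) ->
  mean P (fun w => slice V i x u theta w y * cos (a + v * V i w)) =
  2^-1 * (mean P (fun w => H (mix i V (upd x i y) w) *
            cos ((theta + a) + phase i (upd u i v) V w)) +
          mean P (fun w => H (mix i V (upd x i y) w) *
            cos ((theta - a) + phase i (upd u i (- v)) V w))) +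
  M * mean P (fun w => cos (a + phase 0 (upd (fun=> 0) i v) V w)).
Proof.
move=> mV.
have mH : measurable_fun [set: T] (fun w => H (mix i V (upd x i y) w)).
  exact: (measurable_section (D := fun w y => H (mix i V (upd x i y) w)) (measurable_mix _ _ mV)).
have iH b k u' : has_mean P (fun w => H (mix i V (upd x i y) w) * cos (b + phase k u' V w)).
  apply: (@has_mean_bounded _ _ _ _ M) => [|w]; last exact: Hcos.
  apply: measurable_funM => //; apply: (measurableT_comp (@measurable_cosR R)).
  by apply: measurable_funD => //; exact: measurable_phase.
have ic b k u' : has_mean P (fun w => cos (b + phase k u' V w)).
  apply: (@has_mean_bounded _ _ _ _ 1) => [|w]; last exact: cos1.
  apply: (measurableT_comp (@measurable_cosR R)).
  by apply: measurable_funD => //; exact: measurable_phase.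
rewrite -meanD// -!meanZ//; last exact: has_meanD.
rewrite -meanD; [|by apply: has_meanZ; exact: has_meanD|exact: has_meanZ].
congr mean; apply/funext => w; rewrite /slice mulrDl; congr (_ + _); last first.
  congr (_ * cos (_ + _)); rewrite /phase (bigD1 i)//= /upd eqxx big1 ?addr0// => j ji.
  by rewrite (negbTE ji) mul0r.
rewrite !phase_upd mulNr.
rewrite (_ : theta + a + _ = (theta + phase i.+1 u V w) + (a + v * V i w)); last by ring.
rewrite (_ : theta - a + _ = (theta + phase i.+1 u V w) - (a + v * V i w)); last by ring.
move: (theta + phase _ _ _ _) (a + _) (H _) => p q h; rewrite cosD cosB; field => //.
Qed.

Variables (X Y : 'I_N -> T -> R).
Hypothesis mX : forall j, measurable_fun [set: T] (X j).
Hypothesis mY : forall j, measurable_fun [set: T] (Y j).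
Hypothesis XY : forall theta u, mean P (fun w => cos (theta + \sum_j u j * X j w)) =
  mean P (fun w => cos (theta + \sum_j u j * Y j w)).

Let mean_mix (k : nat) : (k <= N)%N -> forall x u theta,
  mean P (fun w => H (mix k X x w) * cos (theta + phase k u X w)) =
  mean P (fun w => H (mix k Y x w) * cos (theta + phase k u Y w)).
Proof.
have phase0 u V w : phase 0 u V w = \sum_j u j * V j w by [].
elim: k => [_ x u theta|k IH kN x u theta].
  have E V : (forall j, measurable_fun [set: T] (V j)) ->
      mean P (fun w => H (mix 0 V x w) * cos (theta + phase 0 u V w)) =
      H x * mean P (fun w => cos (theta + phase 0 u V w)).
    move=> mV; rewrite -meanZ//; apply: (@has_mean_bounded _ _ _ _ 1) => [|w]; last exact: cos1.
    apply: (measurableT_comp (@measurable_cosR R)).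
    by apply: measurable_funD => //; exact: measurable_phase.
  by rewrite !E// XY.
pose i := Ordinal kN.
have E V : (forall j, measurable_fun [set: T] (V j)) ->
    mean P (fun w => H (mix k.+1 V x w) * cos (theta + phase k.+1 u V w)) =
    mean P (fun w => slice V i x u theta w (V i w)) - M.
  move=> mV; rewrite -[X in _ - X](mean_cst P) -meanB//.
  - congr mean; apply/funext => w; rewrite /slice addrK; congr (H _ * _).
    apply/funext => j; rewrite /mix /upd ltnS leq_eqVlt -[(j == k :> nat)]/(j == i).
    by case: eqVneq => [->|_] //=; rewrite ltnn.
  - apply: (@has_mean_bounded _ _ _ _ (M + M)) => [|w].
      exact: (measurable_diagonal (measurable_slice i x u theta mV) (mV i)).
    by rewrite ger0_norm.
  - exact: has_mean_cst.
rewrite !E//; congr (_ - _).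
apply: (transfer_coordinate mG tau0 charG (measurable_slice i x u theta mX)
  (@slice_ge0 _ _ _ _ _) (@slice_le _ _ _ _ _) (@slice_lip _ _ _ _ _) (mX i)
  (measurable_slice i x u theta mY)
  (@slice_ge0 _ _ _ _ _) (@slice_le _ _ _ _ _) (@slice_lip _ _ _ _ _) (mY i)).
move=> y a v; rewrite !mean_slice_cos// !(IH (ltnW kN)); congr (_ + M * _); exact: XY.
Qed.

(** Induction on the number of coordinates on which [H] is evaluated at the
    random vector, the other ones entering only through a cosine; each step is
    an instance of [transfer_coordinate]. *)
Lemma equal_law : mean P (fun w => H (X ^~ w)) = mean P (fun w => H (Y ^~ w)).
Proof.
have := mean_mix (leqnn N) (fun=> 0) (fun=> 0) 0.
have E V : (fun w => H (mix N V (fun=> 0) w) * cos (0 + phase N (fun=> 0) V w)) =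
    (fun w => H (V ^~ w)).
  apply/funext => w; rewrite /phase big1 ?addr0 ?cos0 ?mulr1.
    by congr H; apply/funext => j; rewrite /mix ltn_ord.
  by move=> j _; rewrite ltn_ord mul0r.
by rewrite !E.
Qed.

End joint_law.

(** * Norms of random vectors *)

Section vector_norm.
Context {R : realType} {X : normedModType R} {N : nat}.
Variable xi : 'I_N -> X.

Definition vnorm (x : 'I_N -> R) : R := `|\sum_j x j *: xi j|.

Let K : R := \sum_j `|xi j|.

Lemma vnorm_le x : vnorm x <= K * \sum_j `|x j|.
Proof.
apply: le_trans (ler_norm_sum _ _ _) _; rewrite mulr_sumr; apply: ler_sum => j _.
rewrite normrZ mulrC ler_wpM2r//.
by rewrite /K (bigD1 j)//= lerDl sumr_ge0.
Qed.

Lemma vnorm_lipschitz x y : `|vnorm x - vnorm y| <= K * \sum_j `|x j - y j|.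
Proof.
apply: le_trans (ler_dist_dist _ _) _; rewrite -sumrB.
under eq_bigr do rewrite -scalerBl.
exact: (vnorm_le (fun j => x j - y j)).
Qed.

Lemma vnorm_sup_ge0 : 0 <= K. Proof. by rewrite sumr_ge0. Qed.

Context {d : measure_display} {T : measurableType d}.

Lemma measurable_vnorm (F : 'I_N -> T -> R) : (forall j, measurable_fun [set: T] (F j)) ->
  measurable_fun [set: T] (fun t => vnorm (F ^~ t)).
Proof.
by move=> mF; apply: (measurable_lipschitz vnorm_sup_ge0 vnorm_lipschitz).
Qed.

Lemma norm2_vnorm_le (m : {measure set T -> \bar R}) (F : 'I_N -> T -> R) :
  (forall j, measurable_fun [set: T] (F j)) ->
  (norm2 m (fun t => vnorm (F ^~ t)) <= \sum_j `|xi j|%:E * norm2 m (F j))%E.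
Proof.
move=> mF; have m1 j : measurable_fun [set: T] (fun t => `|xi j| * `|F j t|).
  by apply: measurable_funM => //; exact: measurableT_comp.
apply: (@le_trans _ _ (norm2 m (fun t => \sum_j `|xi j| * `|F j t|)%R)).
  apply: le_norm2; [exact: measurable_vnorm|exact: measurable_sum|].
  move=> t; rewrite /vnorm normr_id [leRHS]ger0_norm ?sumr_ge0//.
  apply: le_trans (ler_norm_sum _ _ _) _.
  by apply: ler_sum => j _; rewrite normrZ mulrC.
apply: le_trans (norm2_sum _ _ m1) _; apply: lee_sum => j _.
rewrite norm2Z; last exact: measurableT_comp.
rewrite normr_id lee_wpmul2l// le_norm2//; first exact: measurableT_comp.
by move=> t; rewrite normr_id.
Qed.

Lemma Lfun2_vnorm (m : {measure set T -> \bar R}) (F : 'I_N -> T -> R) :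
  (forall j, F j \in Lfun m 2%:E) -> (fun t => vnorm (F ^~ t)) \in Lfun m 2%:E.
Proof.
move=> LF; apply/Lfun2P; split.
  by apply: measurable_vnorm => j; exact: Lfun2_measurable (LF j).
apply: le_lt_trans (norm2_vnorm_le m (fun j => Lfun2_measurable (LF j))) _.
apply: lte_sum_pinfty => j _; rewrite lte_mul_pinfty//.
by have /Lfun2P[] := LF j.
Qed.

End vector_norm.

Section equal_law_norm.
Context {R : realType} {d : measure_display} {T : measurableType d}.
Variable P : probability T R.
Context {X : normedModType R}.
Variables (G : T -> R) (tau : R).
Hypothesis mG : measurable_fun [set: T] G.
Hypothesis tau0 : 0 < tau.
Hypothesis charG : forall v, mean P (fun w => cos (v * G w)) = expR (- (2^-1 * (tau * v ^+ 2))).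
Variables (N : nat) (xi : 'I_N -> X).

Let half_equal (Y Z : 'I_N -> T -> R) :
  (forall j, Y j \in Lfun P 2%:E) -> (forall j, Z j \in Lfun P 2%:E) ->
  (forall theta u, mean P (fun w => cos (theta + \sum_j u j * Y j w)) =
    mean P (fun w => cos (theta + \sum_j u j * Z j w))) ->
  (norm2 P (fun w => vnorm xi (Y ^~ w)) <= norm2 P (fun w => vnorm xi (Z ^~ w)))%E.
Proof.
move=> LY LZ YZ.
have mY j := Lfun2_measurable (LY j); have mZ j := Lfun2_measurable (LZ j).
have LV := Lfun2_vnorm xi LZ; have mV := Lfun2_measurable LV.
have /Lfun2P[_ fV] := LV.
have fE : (norm2 P (fun w => vnorm xi (Z ^~ w)) \is a fin_num)%E.
  by rewrite ge0_fin_numE// norm2_ge0.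
rewrite -(fineK fE).
(* the norm truncated at [k], whose square is bounded and Lipschitz *)
pose tr k a : R := Num.min k%:R a.
have tr0 k x : 0 <= tr k (vnorm xi x) by rewrite le_min ler0n normr_ge0.
have mtr k (V : 'I_N -> T -> R) : (forall j, measurable_fun [set: T] (V j)) ->
    measurable_fun [set: T] (fun w => tr k (vnorm xi (V ^~ w))).
  by move=> mV'; apply: measurable_minr => //; exact: measurable_vnorm.
apply: (@norm2_fatou _ _ _ P (fun k w => tr k (vnorm xi (Y ^~ w)))).
- by move=> k; exact: mtr.
- by rewrite fine_ge0// norm2_ge0.
- move=> w; apply: cvg_near_cst; near=> k; apply/min_idPr.
  near: k; exact: nbhs_infty_ger.
near=> k; rewrite (fineK fE).
have trM (x : 'I_N -> R) : `|tr k (vnorm xi x) ^+ 2| <= k%:R ^+ 2.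
  by rewrite ger0_norm ?sqr_ge0// ler_sqr ?nnegrE// ge_min lexx.
have trL (x y : 'I_N -> R) : `|tr k (vnorm xi x) ^+ 2 - tr k (vnorm xi y) ^+ 2| <=
    (2 * k%:R * \sum_j `|xi j|) * \sum_j `|x j - y j|.
  rewrite subr_sqr normrM mulrC -mulrA ler_pM//.
    rewrite ger0_norm ?addr_ge0// mulr_natl mulr2n lerD// ge_min lexx//.
  apply: le_trans (vnorm_lipschitz xi x y); rewrite /tr.
  move: (vnorm xi x) (vnorm xi y) => a b; rewrite /Num.min.
  by case: ltP => ha; case: ltP => hb; rewrite ?subrr ?normr0// ler_norml;
    have := ler_norm (a - b); have := ler_norm (b - a); rewrite (distrC b);
    move: ha hb; move: (`|a - b|) => c; move=> *; apply/andP; split; lra.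
have := equal_law mG tau0 charG (L := 2 * k%:R * \sum_j `|xi j|)
  _ trM trL mY mZ YZ.
have K0 : 0 <= 2 * k%:R * \sum_j `|xi j| by rewrite !mulr_ge0// sumr_ge0.
move=> /(_ K0) E; apply: (@le_trans _ _ (norm2 P (fun w => tr k (vnorm xi (Z ^~ w))))).
  have Lk (V : 'I_N -> T -> R) : (forall j, measurable_fun [set: T] (V j)) ->
      (fun w => tr k (vnorm xi (V ^~ w))) \in Lfun P 2%:E.
    move=> mV'; apply: (@Lfun2_bounded _ _ _ _ k%:R); first exact: mtr.
    by move=> w; rewrite ger0_norm// ge_min lexx.
  rewrite !norm2E -!(mean_EFin (has_mean_sqr _)) ?E//; exact: Lk.
apply: le_norm2; [exact: mtr|by []|move=> w].
by rewrite (ger0_norm (tr0 _ _)) [leRHS]ger0_norm ?normr_ge0// ge_min lexx orbT.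
Unshelve. all: by end_near. Qed.

(** The truncations [min k ||.||] are bounded and Lipschitz along with their
    squares; then [k] tends to infinity. *)
Lemma norm2_equal_law (Y Z : 'I_N -> T -> R) :
  (forall j, Y j \in Lfun P 2%:E) -> (forall j, Z j \in Lfun P 2%:E) ->
  (forall theta u, mean P (fun w => cos (theta + \sum_j u j * Y j w)) =
    mean P (fun w => cos (theta + \sum_j u j * Z j w))) ->
  norm2 P (fun w => vnorm xi (Y ^~ w)) = norm2 P (fun w => vnorm xi (Z ^~ w)).
Proof. by move=> LY LZ YZ; apply/eqP; rewrite eq_le !half_equal. Qed.

End equal_law_norm.

(** * Restricting the integrands decreases the norm *)

Lemma ae_forall_ord (R : realType) (d : measure_display) (T : measurableType d)
    (m : {measure set T -> \bar R}) (N : nat) (Q : 'I_N -> T -> Prop) :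
  (forall k, {ae m, forall x, Q k x}) -> {ae m, forall x k, Q k x}.
Proof.
move=> H; have : {ae m, forall x i, forall k : 'I_N, k = i :> nat -> Q k x}.
  apply: ae_foralln => i; have [iN|iN] := ltnP i N.
    by apply: filterS (H (Ordinal iN)) => x Qx k ki; rewrite (_ : k = Ordinal iN)//; exact: val_inj.
  by apply: aeW => x k ki; move: iN; rewrite -ki leqNgt ltn_ord.
by apply: filterS => x Qx k; exact: (Qx k).
Qed.

Section wiener_families.
Context {R : realType} {n : nat} {d : measure_display} {Omega : measurableType d}.
Context {P : probability Omega R}.
Local Notation T := (space_time R n).
Local Notation mu := (@half_measure R n).
Variable W : set T -> {RV P >-> R}.
Hypothesis HW : gaussian_random_measure W.
Local Notation wi := (wiener_integral W).

Lemma wiener_integral0 : {ae P, forall w, wi (fun=> 0) w = 0}.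
Proof.
apply: (wiener_unique HW (h := fun=> 0)) => //; last exact: is_wiener0.
apply: wiener_integralP => //; exact: Lfun2_0.
Qed.

Lemma wiener_integral_sum (N : nat) (F : 'I_N -> T -> R) (u : 'I_N -> R) :
  (forall k, F k \in Lfun mu 2%:E) ->
  {ae P, forall w, wi (fun p => \sum_k u k * F k p) w = \sum_k u k * wi (F k) w}.
Proof.
move=> LF.
pose S (r : seq 'I_N) p := \sum_(k <- r) u k * F k p.
have LS r : S r \in Lfun mu 2%:E by apply: Lfun2_sum => k; exact: Lfun2Z.
suff H r : {ae P, forall w, wi (S r) w = \sum_(k <- r) u k * wi (F k) w}.
  exact: (H (index_enum 'I_N)).
elim: r => [|k r IH].
  rewrite (_ : S [::] = fun=> 0); last by apply/funext => p; rewrite /S big_nil.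
  by apply: filterS wiener_integral0 => w ->; rewrite big_nil.
have := wiener_integral_comb HW (u k) 1 (LF k) (LS r).
rewrite (_ : (fun p => _) = S (k :: r)); last first.
  by apply/funext => p; rewrite /S big_cons mul1r.
by apply: filterS2 IH => w IH ->; rewrite big_cons mul1r IH.
Qed.

Lemma mean_cos_family (N : nat) (F : 'I_N -> T -> R) theta (u : 'I_N -> R) :
  (forall k, F k \in Lfun mu 2%:E) ->
  mean P (fun w => cos (theta + \sum_k u k * wi (F k) w)) =
  cos theta * expR (- (2^-1 * fine (norm2 mu (fun p => \sum_k u k * F k p)) ^+ 2)).
Proof.
move=> LF; have L : (fun p => \sum_k u k * F k p) \in Lfun mu 2%:E.
  by apply: Lfun2_sum => k; exact: Lfun2Z.
rewrite -(mean_cos_wiener HW theta L); apply: mean_ae_eq.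
- apply: (measurableT_comp (@measurable_cosR R)); apply: measurable_funD => //.
  apply: measurable_sum => k; apply: measurable_funM => //; exact: (measurable_wiener HW).
- apply: (measurableT_comp (@measurable_cosR R)); apply: measurable_funD => //.
  exact: (measurable_wiener HW).
- by apply: filterS (wiener_integral_sum u LF) => w ->.
Qed.

Context {X : normedModType R}.

Lemma wiener_null h : h \in Lfun mu 2%:E -> norm2 mu h = 0%E ->
  {ae P, forall w, wi h w = 0}.
Proof.
move=> Lh h0; apply: norm2_eq0; first exact: (measurable_wiener HW).
apply/eqP; rewrite eq_le norm2_ge0 andbT -h0; exact: (norm2_wiener_le HW).
Qed.

(** The smoothing variable required by [norm2_equal_law] can be taken to be the
    integral of any [F k] with nonzero norm; if all norms vanish, both families
    are almost surely zero. *)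
Lemma isonormal_norm (N : nat) (F F' : 'I_N -> T -> R) (xi : 'I_N -> X) :
  (forall k, F k \in Lfun mu 2%:E) -> (forall k, F' k \in Lfun mu 2%:E) ->
  (forall u : 'I_N -> R, norm2 mu (fun p => \sum_k u k * F k p) =
    norm2 mu (fun p => \sum_k u k * F' k p)) ->
  norm2 P (fun w => vnorm xi (fun k => wi (F k) w)) =
  norm2 P (fun w => vnorm xi (fun k => wi (F' k) w)).
Proof.
move=> LF LF' FF'.
have mw h : h \in Lfun mu 2%:E -> measurable_fun [set: Omega] (wi h).
  exact: (measurable_wiener HW).
have [[k Fk0]|Fnull] := pselect (exists k, norm2 mu (F k) != 0%E); last first.
  have FE k : norm2 mu (F k) = norm2 mu (F' k).
    have E (H : 'I_N -> T -> R) :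
        (fun p => \sum_i (i == k)%:R * H i p) = H k.
      apply/funext => p; rewrite (bigD1 k)//= eqxx mul1r big1 ?addr0// => i ik.
      by rewrite (negbTE ik) mul0r.
    by have := FF' (fun i => (i == k)%:R); rewrite !E.
  have Z k : norm2 mu (F k) = 0%E.
    by apply: contrapT => /eqP k0; apply: Fnull; exists k.
  have H (F1 : 'I_N -> T -> R) : (forall k, F1 k \in Lfun mu 2%:E) ->
      (forall k, norm2 mu (F1 k) = 0%E) ->
      {ae P, forall w, vnorm xi (fun k => wi (F1 k) w) = 0}.
    move=> L1 Z1; have : {ae P, forall w k, wi (F1 k) w = 0}.
      apply/ae_forall_ord => k; exact: wiener_null.
    apply: filterS => w w0; rewrite /vnorm big1 ?normr0// => k _.
    by rewrite w0 scale0r.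
  have Z' k : norm2 mu (F' k) = 0%E by rewrite -FE.
  apply: norm2_ae_eq.
  - by apply: measurable_vnorm => k; exact: mw.
  - by apply: measurable_vnorm => k; exact: mw.
  - by apply: filterS2 (H _ LF Z) (H _ LF' Z') => w -> ->.
have tau0 : 0 < fine (norm2 mu (F k)) ^+ 2.
  rewrite exprn_gt0// fine_gt0// lt0e Fk0 norm2_ge0/=.
  by have /Lfun2P[] := LF k.
have charG v : mean P (fun w => cos (v * wi (F k) w)) =
    expR (- (2^-1 * (fine (norm2 mu (F k)) ^+ 2 * v ^+ 2))).
  have := @mean_cos_family 1 (fun=> F k) 0 (fun=> v) (fun=> LF k).
  rewrite cos0 mul1r; under eq_fun do rewrite big_ord1 add0r.
  move=> ->; congr (expR (- (_ * _))).
  rewrite (_ : (fun p => _) = fun p => v * F k p); last first.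
    by apply/funext => p; rewrite big_ord1.
  rewrite norm2Z; last exact: Lfun2_measurable (LF k).
  have fF : norm2 mu (F k) \is a fin_num.
    by rewrite ge0_fin_numE ?norm2_ge0//; have /Lfun2P[] := LF k.
  by rewrite fineM// exprMn -normrX ger0_norm ?sqr_ge0// mulrC.
apply: (norm2_equal_law (mw _ (LF k)) tau0 charG).
- by move=> j; exact: (Lfun2_wiener HW).
- by move=> j; exact: (Lfun2_wiener HW).
- by move=> theta u; rewrite !mean_cos_family// FF'.
Qed.

(** [\1_S = (1 + eps) / 2] for the sign [eps] that is [1] on [S] and [-1] off
    [S], and multiplying the family [F] by [eps] changes no norm of a linear
    combination. *)
Lemma norm2_wiener_restrict (N : nat) (F : 'I_N -> T -> R) (xi : 'I_N -> X) (S : set T) :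
  measurable S -> (forall k, F k \in Lfun mu 2%:E) ->
  (norm2 P (fun w => vnorm xi (fun k => wi (fun p => (\1_S p * F k p)%R) w)) <=
   norm2 P (fun w => vnorm xi (fun k => wi (F k) w)))%E.
Proof.
move=> mS LF; pose eps (p : T) : R := 2 * \1_S p - 1.
have eps2 p : eps p ^+ 2 = 1.
  by rewrite /eps indicE; case: (_ \in _); rewrite /= ?mulr1 ?mulr0; ring.
pose F' k p := eps p * F k p.
have meps : measurable_fun [set: T] eps.
  by apply: measurable_funB => //; apply: measurable_funM => //.
have LF' k : F' k \in Lfun mu 2%:E.
  apply: (Lfun2_le _ (LF k)).
    by apply: measurable_funM => //; exact: Lfun2_measurable (LF k).
  move=> p; rewrite /F' normrM -[leRHS]mul1r ler_wpM2r//.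
  by rewrite -ler_sqr ?nnegrE// real_normK ?num_real// eps2 expr1n.
have LS k : (fun p => \1_S p * F k p) \in Lfun mu 2%:E by exact: Lfun2_indic.
have E : norm2 P (fun w => vnorm xi (fun k => wi (F k) w)) =
    norm2 P (fun w => vnorm xi (fun k => wi (F' k) w)).
  apply: isonormal_norm => // u; rewrite !norm2E; congr sqrte.
  apply: eq_integral => p _; congr (_%:E).
  rewrite [in RHS](eq_bigr (fun k => eps p * (u k * F k p))); last by move=> k _; rewrite mulrCA.
  by rewrite -mulr_sumr exprMn eps2 mul1r.
have mw h : h \in Lfun mu 2%:E -> measurable_fun [set: Omega] (wi h).
  exact: (measurable_wiener HW).
pose a w : R := 2^-1 * vnorm xi (fun k => wi (F k) w).
pose b w : R := 2^-1 * vnorm xi (fun k => wi (F' k) w).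
have mv F1 : (forall k, F1 k \in Lfun mu 2%:E) ->
    measurable_fun [set: Omega] (fun w => vnorm xi (fun k => wi (F1 k) w)).
  by move=> L1; apply: measurable_vnorm => k; exact: mw.
have ma : measurable_fun [set: Omega] a by apply: measurable_funM => //; exact: mv.
have mb : measurable_fun [set: Omega] b by apply: measurable_funM => //; exact: mv.
have : {ae P, forall w k, wi (fun p => \1_S p * F k p) w =
    2^-1 * wi (F k) w + 2^-1 * wi (F' k) w}.
  apply/ae_forall_ord => k; have := wiener_integral_comb HW 2^-1 2^-1 (LF k) (LF' k).
  rewrite (_ : (fun p => _) = (fun p => \1_S p * F k p))//.
  by apply/funext => p; rewrite /F' /eps; field.
move=> hw; apply: (@le_trans _ _ (norm2 P (a \+ b))).
  rewrite (@norm2_ae_eq _ _ _ P _ (fun w => vnorm xi (fun k =>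
    2^-1 * wi (F k) w + 2^-1 * wi (F' k) w))).
  - apply: le_norm2.
    + apply: measurable_vnorm => k; apply: measurable_funD.
        by apply: measurable_funM => //; exact: mw.
      by apply: measurable_funM => //; exact: mw.
    + exact: measurable_funD.
    + move=> w; rewrite [leRHS]ger0_norm ?addr_ge0 ?mulr_ge0 ?invr_ge0 ?normr_ge0//.
      rewrite /vnorm normr_id /a /b /vnorm.
      under eq_bigr do rewrite scalerDl -!scalerA.
      rewrite big_split/= -!scaler_sumr; apply: le_trans (ler_normD _ _) _.
      by rewrite !normrZ !ger0_norm ?invr_ge0.
  - exact: (mv (fun k p => \1_S p * F k p)%R).
  - apply: measurable_vnorm => k; apply: measurable_funD.
      by apply: measurable_funM => //; exact: mw.
    by apply: measurable_funM => //; exact: mw.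
  - apply: filterS hw => w hw; congr (vnorm _ _); apply/funext => k; exact: hw.
apply: le_trans (norm2D _ ma mb) _; rewrite !norm2Z; try exact: mv.
rewrite -E ger0_norm ?invr_ge0// -ge0_muleDl ?lee_fin ?invr_ge0//.
by rewrite -EFinD (_ : 2^-1 + 2^-1 = 1) ?mul1e//; field.
Qed.

(** Either [xi ord0] is a combination of the other vectors, and its coefficient
    can be distributed over theirs, or that coefficient vanishes almost
    everywhere. *)
Lemma wiener_dependence (N : nat) (F : 'I_N -> T -> R) (xi : 'I_N -> X) :
  (forall k, F k \in Lfun mu 2%:E) ->
  {ae mu, forall p, \sum_k F k p *: xi k = 0} ->
  {ae P, forall w, \sum_k wi (F k) w *: xi k = 0}.
Proof.
elim: N F xi => [|N IH] F xi LF F0.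
  by apply: aeW => w; rewrite big_ord0.
have [[c cE]|nc] := pselect (exists c : 'I_N -> R, xi ord0 = \sum_j c j *: xi (lift ord0 j)).
  pose F' j p := 1 * F (lift ord0 j) p + c j * F ord0 p.
  have LF' j : F' j \in Lfun mu 2%:E by apply: Lfun2D; exact: Lfun2Z.
  have : {ae mu, forall p, \sum_j F' j p *: xi (lift ord0 j) = 0}.
    apply: filterS F0 => p; rewrite big_ord_recl => p0; rewrite -[RHS]p0 [in RHS]cE.
    rewrite scaler_sumr -big_split/=; apply: eq_bigr => j _.
    by rewrite /F' scalerDl mul1r addrC scalerA mulrC.
  move=> /(IH _ _ LF').
  have : {ae P, forall w j, wi (F' j) w = 1 * wi (F (lift ord0 j)) w + c j * wi (F ord0) w}.
    by apply/ae_forall_ord => j; exact: wiener_integral_comb.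
  apply: filterS2 => w wE w0; rewrite -[RHS]w0 big_ord_recl [X in _ *: X + _]cE.
  rewrite scaler_sumr -big_split/=; apply: eq_bigr => j _.
  by rewrite wE scalerDl mul1r addrC scalerA mulrC.
have Fz : {ae mu, forall p, F ord0 p = 0}.
  apply: filterS F0 => p; rewrite big_ord_recl => p0; apply: contrapT => /eqP Fp.
  apply: nc; exists (fun j => - (F ord0 p)^-1 * F (lift ord0 j) p).
  apply: (scalerI Fp); rewrite scaler_sumr.
  rewrite (eq_bigr (fun j => - (F (lift ord0 j) p *: xi (lift ord0 j)))).
    by rewrite sumrN; apply/eqP; rewrite -addr_eq0 p0.
  by move=> j _; rewrite scalerA -scaleNr mulrA mulrN divff// mulN1r.
have : {ae mu, forall p, \sum_j F (lift ord0 j) p *: xi (lift ord0 j) = 0}.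
  by apply: filterS2 F0 Fz => p; rewrite big_ord_recl => + p0; rewrite p0 scale0r add0r.
move=> /(IH _ _ (fun j => LF _)).
have : {ae P, forall w, wi (F ord0) w = 0}.
  have := wiener_integral_ae_eq HW (LF ord0) (Lfun2_0 _) Fz.
  by apply: filterS2 wiener_integral0 => w -> ->.
by apply: filterS2 => w w0 E; rewrite big_ord_recl w0 scale0r add0r.
Qed.

End wiener_families.

(** * The energy of a vector-valued function *)

Section energy.
Context {R : realType} {n : nat} {d : measure_display} {Omega : measurableType d}.
Context {P : probability Omega R}.
Local Notation T := (space_time R n).
Local Notation mu := (@half_measure R n).
Variable W : set T -> {RV P >-> R}.
Hypothesis HW : gaussian_random_measure W.
Context {X : completeNormedModType R}.
Local Notation wi := (wiener_integral W).
Implicit Types (f g : T -> X) (S : set T).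

Definition energy (f : T -> X) : \bar R := norm2 P (fun w => `|stoch_integral W f w|).

Lemma sqrte_cone_energy f x : sqrte (cone_energy W f x) = energy (restr (cone x) f).
Proof. by rewrite /energy norm2E /cone_energy unlock. Qed.

Lemma cone_energyE f x : cone_energy W f x = (energy (restr (cone x) f) ^+ 2)%E.
Proof. by rewrite /energy norm2_sqr /cone_energy unlock. Qed.

Lemma stoch_integralP f : in_L2_tensor f ->
  exists (m : nat) (F : 'I_m -> T -> R) (xi : 'I_m -> X), tensor_decomp f F xi /\
    stoch_integral W f = fun w => \sum_(k < m) wi (F k) w *: xi k.
Proof.
move=> [m [F [xi FE]]]; rewrite /stoch_integral; set Q := [set Z | _].
have : Q (xget (cst 0) Q).
  by apply: xgetPex; exists (fun w => \sum_(k < m) wi (F k) w *: xi k); exists m, F, xi.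
by [].
Qed.

(** The difference of the two decompositions is a vanishing tensor. *)
Lemma stoch_integral_unique (f : T -> X) m (F : 'I_m -> T -> R) (xi : 'I_m -> X)
    m' (F' : 'I_m' -> T -> R) (xi' : 'I_m' -> X) :
  tensor_decomp f F xi -> tensor_decomp f F' xi' ->
  {ae P, forall w, \sum_(k < m) wi (F k) w *: xi k = \sum_(k < m') wi (F' k) w *: xi' k}.
Proof.
move=> [LF fF] [LF' fF'].
pose G (j : 'I_(m + m')) := match fintype.split j with inl k => F k | inr k => F' k end.
pose zeta (j : 'I_(m + m')) := match fintype.split j with inl k => xi k | inr k => - xi' k end.
have LG j : G j \in Lfun mu 2%:E by rewrite /G; case: fintype.split.
have sum_split (I : (T -> R) -> R) :
    \sum_j I (G j) *: zeta j = \sum_k I (F k) *: xi k - \sum_k I (F' k) *: xi' k.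
  rewrite big_split_ord/= -sumrN; congr (_ + _).
    by apply: eq_bigr => k _; rewrite /G /zeta (unsplitK (inl k)).
  by apply: eq_bigr => k _; rewrite /G /zeta (unsplitK (inr k)) scalerN.
have : {ae mu, forall p, \sum_j G j p *: zeta j = 0}.
  apply: filterS2 fF fF' => p E E'.
  by rewrite (sum_split (fun h => h p)) -E -E' subrr.
move=> /(wiener_dependence HW LG); apply: filterS => w.
by rewrite (sum_split (fun h => wi h w)) => /eqP; rewrite subr_eq0 => /eqP.
Qed.

Let mwi m (F : 'I_m -> T -> R) k : (forall k, F k \in Lfun mu 2%:E) ->
  measurable_fun [set: Omega] (wi (F k)).
Proof. by move=> LF; exact: (measurable_wiener HW). Qed.

Lemma energyE f m (F : 'I_m -> T -> R) (xi : 'I_m -> X) : tensor_decomp f F xi ->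
  energy f = norm2 P (fun w => vnorm xi (fun k => wi (F k) w)).
Proof.
move=> fF; have [|m' [F' [xi' [fF' E]]]] := @stoch_integralP f; first by exists m, F, xi.
rewrite /energy E; case: (fF) (fF') => [LF _] [LF' _]; apply: norm2_ae_eq.
- by apply: (@measurable_vnorm _ _ _ xi' _ _ (fun k => wi (F' k))) => k; exact: mwi.
- by apply: measurable_vnorm => k; exact: mwi.
- by apply: filterS (stoch_integral_unique fF fF') => w; rewrite /vnorm => ->.
Qed.

Lemma energy_ge0 f : (0 <= energy f)%E. Proof. exact: norm2_ge0. Qed.

Lemma energy_lty f : in_L2_tensor f -> (energy f < +oo)%E.
Proof.
move=> [m [F [xi fF]]]; rewrite (energyE fF); have [LF _] := fF.
by have /Lfun2P[] := Lfun2_vnorm xi (fun k => Lfun2_wiener HW (LF k)).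
Qed.

Lemma tensor_decomp_restr f m (F : 'I_m -> T -> R) (xi : 'I_m -> X) S : measurable S ->
  tensor_decomp f F xi -> tensor_decomp (restr S f) (fun k p => \1_S p * F k p) xi.
Proof.
move=> mS [LF fE]; split; first by move=> k; exact: Lfun2_indic.
apply: filterS fE => p; rewrite /restr => ->; rewrite scaler_sumr.
by apply: eq_bigr => k _; rewrite scalerA.
Qed.

Lemma tensor_restr f S : measurable S -> in_L2_tensor f -> in_L2_tensor (restr S f).
Proof.
move=> mS [m [F [xi fF]]]; exists m, (fun k p => \1_S p * F k p), xi.
exact: tensor_decomp_restr.
Qed.

Lemma energy_restr f S : measurable S -> in_L2_tensor f ->
  (energy (restr S f) <= energy f)%E.
Proof.
move=> mS [m [F [xi fF]]]; rewrite (energyE fF) (energyE (tensor_decomp_restr mS fF)).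
by have [LF _] := fF; exact: norm2_wiener_restrict.
Qed.

Lemma energyD f g : in_L2_tensor f -> in_L2_tensor g ->
  in_L2_tensor (fun p => f p + g p) /\ (energy (fun p => (f p + g p)%R) <= energy f + energy g)%E.
Proof.
move=> [m [F [xi fF]]] [m' [F' [xi' gF]]].
have [LF fE] := fF; have [LF' gE] := gF.
pose G (j : 'I_(m + m')) := match fintype.split j with inl k => F k | inr k => F' k end.
pose zeta (j : 'I_(m + m')) := match fintype.split j with inl k => xi k | inr k => xi' k end.
have LG j : G j \in Lfun mu 2%:E by rewrite /G; case: fintype.split.
have sum_split (I : (T -> R) -> R) :
    \sum_j I (G j) *: zeta j = \sum_k I (F k) *: xi k + \sum_k I (F' k) *: xi' k.
  rewrite big_split_ord/=; congr (_ + _).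
    by apply: eq_bigr => k _; rewrite /G /zeta (unsplitK (inl k)).
  by apply: eq_bigr => k _; rewrite /G /zeta (unsplitK (inr k)).
have fgG : tensor_decomp (fun p => f p + g p) G zeta.
  split => //; apply: filterS2 fE gE => p -> ->.
  by rewrite (sum_split (fun h => h p)).
split; first by exists (m + m')%N, G, zeta.
rewrite (energyE fgG) (energyE fF) (energyE gF).
have m1 : measurable_fun [set: Omega] (fun w => vnorm xi (fun k => wi (F k) w)).
  by apply: measurable_vnorm => k; exact: mwi.
have m2 : measurable_fun [set: Omega] (fun w => vnorm xi' (fun k => wi (F' k) w)).
  by apply: measurable_vnorm => k; exact: mwi.
apply: le_trans (norm2D _ m1 m2); apply: le_norm2.
- by apply: measurable_vnorm => k; exact: mwi.
- exact: measurable_funD.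
move=> w; rewrite [leRHS]ger0_norm ?addr_ge0 ?normr_ge0//.
by rewrite /vnorm normr_id (sum_split (fun h => wi h w)) ler_normD.
Qed.

Lemma energyZ f (c : R) : in_L2_tensor f ->
  in_L2_tensor (fun p => c *: f p) /\ energy (fun p => c *: f p) = (`|c|%:E * energy f)%E.
Proof.
move=> [m [F [xi fF]]]; have [LF fE] := fF.
have cF : tensor_decomp (fun p => c *: f p) F (fun k => c *: xi k).
  split => //; apply: filterS fE => p ->; rewrite scaler_sumr.
  by apply: eq_bigr => k _; rewrite !scalerA mulrC.
split; first by exists m, F, (fun k => c *: xi k).
rewrite (energyE fF) (energyE cF) -(normr_id c) -norm2Z; last first.
  by apply: measurable_vnorm => k; exact: mwi.
congr (norm2 P _); apply/funext => w; rewrite /vnorm -normrZ scaler_sumr.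
by congr `|_|; apply: eq_bigr => k _; rewrite !scalerA mulrC.
Qed.

(** The integrals of the finitely many coefficients tend to [0] by dominated
    convergence. *)
Lemma energy_restr_cvg0 f (S : nat -> set T) : (forall i, measurable (S i)) ->
  (forall p, \forall i \near \oo, ~ S i p) -> in_L2_tensor f ->
  energy (restr (S i) f) @[i --> \oo] --> 0%E.
Proof.
move=> mS S0 [m [F [xi fF]]]; have [LF fE] := fF.
apply: (@cvge0_squeeze _ _ (fun i => \sum_(k < m) `|xi k|%:E *
    norm2 mu (fun p => \1_(S i) p * F k p)%R)%E) => //.
- by move=> i; exact: energy_ge0.
- move=> i; have fSF := tensor_decomp_restr (mS i) fF.
  have [LSF _] := fSF.
  rewrite (energyE fSF); apply: le_trans (norm2_vnorm_le _ _ _) _.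
    by move=> k; exact: (measurable_wiener HW).
  by apply: lee_sum => k _; rewrite lee_wpmul2l//; exact: (norm2_wiener_le HW).
rewrite [X in _ --> X](_ : _ = \sum_(k < m) 0)%E; last by rewrite big1.
apply: cvg_nnesum => [k _|k _].
  by apply: nearW => i; rewrite mule_ge0// norm2_ge0.
rewrite -(mule0 `|xi k|%:E); apply: cvgeZl => //.
have mF := Lfun2_measurable (LF k).
apply: (norm2_dominated _ (LF k)).
- by move=> i; apply: measurable_funM.
- move=> i p; rewrite normrM -[leRHS]mul1r ler_wpM2r//.
  by rewrite indicE; case: (_ \in _); rewrite ?normr1 ?normr0.
- move=> p; apply: cvg_near_cst; apply: filterS (S0 p) => i Sip.
  by rewrite indicE memNset// mul0r.
Qed.

End energy.

(** * Euclidean distance, cones and boxes *)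

Section euclidean_geometry.
Context {R : realType} {n : nat}.
Implicit Types (x y z : euclidean R n) (r : R).

Lemma edist_ge0 x y : 0 <= edist x y. Proof. exact: sqrtr_ge0. Qed.

Lemma edistC x y : edist x y = edist y x.
Proof. by congr Num.sqrt; apply: eq_bigr => i _; rewrite -sqrrN opprB. Qed.

Let sum_sqr_ge0 (a : 'I_n -> R) : 0 <= \sum_i a i ^+ 2.
Proof. by apply: sumr_ge0 => i _; exact: sqr_ge0. Qed.

(** Expand [\sum_i (t * a i - s * b i) ^+ 2 >= 0], where [s] and [t] are the
    norms. *)
Lemma cauchy_schwarz (a b : 'I_n -> R) :
  \sum_i a i * b i <= Num.sqrt (\sum_i a i ^+ 2) * Num.sqrt (\sum_i b i ^+ 2).
Proof.
set s := Num.sqrt (\sum_i a i ^+ 2); set t := Num.sqrt (\sum_i b i ^+ 2).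
have s0 : 0 <= s by exact: sqrtr_ge0.
have t0 : 0 <= t by exact: sqrtr_ge0.
have s2 : s ^+ 2 = \sum_i a i ^+ 2 by rewrite sqr_sqrtr.
have t2 : t ^+ 2 = \sum_i b i ^+ 2 by rewrite sqr_sqrtr.
have null (c : 'I_n -> R) : \sum_i c i ^+ 2 = 0 -> forall i, c i = 0.
  move=> c0 i; apply/eqP; rewrite -sqrf_eq0 eq_le sqr_ge0 andbT -[leRHS]c0.
  by rewrite (bigD1 i)//= lerDl sumr_ge0// => j _; exact: sqr_ge0.
have [se|s1] := eqVneq s 0.
  rewrite big1 ?mulr_ge0// => i _; rewrite (null a) ?mul0r//.
  by rewrite -s2 se expr0n.
have [te|t1] := eqVneq t 0.
  rewrite big1 ?mulr_ge0// => i _; rewrite (null b) ?mulr0//.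
  by rewrite -t2 te expr0n.
have st : 0 < 2 * (s * t) by rewrite !mulr_gt0// lt_def ?s1 ?t1.
have : 0 <= \sum_i (t * a i - s * b i) ^+ 2 by exact: sum_sqr_ge0.
rewrite (_ : \sum_i _ = 2 * (s * t) * (s * t - \sum_i a i * b i)).
  by rewrite pmulr_rge0// subr_ge0.
rewrite (_ : 2 * (s * t) * _ = t ^+ 2 * s ^+ 2 + s ^+ 2 * t ^+ 2 -
  2 * (s * t) * \sum_i a i * b i); last by ring.
rewrite [X in t ^+ 2 * X]s2 [X in s ^+ 2 * X]t2 !mulr_sumr -big_split/= -sumrB.
by apply: eq_bigr => i _; ring.
Qed.

Lemma edist_triangle y x z : edist x z <= edist x y + edist y z.
Proof.
rewrite -ler_sqr ?nnegrE ?addr_ge0 ?edist_ge0//.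
have E2 u v : edist u v ^+ 2 = \sum_i ((tnth u i : R) - (tnth v i : R)) ^+ 2.
  by rewrite sqr_sqrtr// sumr_ge0// => i _; exact: sqr_ge0.
rewrite sqrrD !E2.
have := cauchy_schwarz (fun i => (tnth x i : R) - tnth y i) (fun i => (tnth y i : R) - tnth z i).
rewrite -/(edist x y) -/(edist y z) => CS.
rewrite (_ : \sum_i _ = \sum_(i < n) ((tnth x i : R) - (tnth y i : R)) ^+ 2 +
  (\sum_(i < n) ((tnth x i : R) - (tnth y i : R)) * ((tnth y i : R) - (tnth z i : R))) *+ 2 +
  \sum_(i < n) ((tnth y i : R) - (tnth z i : R)) ^+ 2).
  by rewrite lerD2r lerD2l ler_pMn2r.
rewrite -sumrMnl -!big_split/=; apply: eq_bigr => i _.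
by rewrite -sqrrD addrA subrK.
Qed.

Lemma ler_coord_edist x y i : `|(tnth x i : R) - (tnth y i : R)| <= edist x y.
Proof.
rewrite -sqrtr_sqr ler_sqrt// (bigD1 i)//= lerDl.
by apply: sumr_ge0 => j _; exact: sqr_ge0.
Qed.

Lemma edist_le_sum x y : edist x y <= \sum_(i < n) `|(tnth x i : R) - (tnth y i : R)|.
Proof.
have S0 : 0 <= \sum_(i < n) `|(tnth x i : R) - (tnth y i : R)| by exact: sumr_ge0.
rewrite -ler_sqr ?nnegrE ?edist_ge0// sqr_sqrtr; last first.
  by rewrite sumr_ge0// => i _; exact: sqr_ge0.
rewrite expr2 mulr_suml.
apply: ler_sum => i _; rewrite -(real_normK (num_real (_ - _))) expr2 ler_wpM2l//.
by rewrite (bigD1 i)//= lerDl sumr_ge0.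
Qed.

Lemma edist_le_coord x y c : (forall i, `|(tnth x i : R) - (tnth y i : R)| <= c) ->
  edist x y <= n%:R * c.
Proof.
move=> xyc; apply: le_trans (edist_le_sum x y) _.
by rewrite -[X in X%:R * _]card_ord mulr_natl -sumr_const; apply: ler_sum.
Qed.

Definition segment x y (theta : R) : euclidean R n :=
  [tuple ((tnth x i : R) + theta * ((tnth y i : R) - (tnth x i : R)) : measurableTypeR R) | i < n].

Lemma edist_segmentl x y theta : edist x (segment x y theta) = `|theta| * edist x y.
Proof.
rewrite /edist -[X in X * _]sqrtr_sqr -sqrtrM ?sqr_ge0//; congr Num.sqrt.
by rewrite mulr_sumr; apply: eq_bigr => i _; rewrite tnth_mktuple; ring.
Qed.

Lemma edist_segmentr x y theta : edist (segment x y theta) y = `|1 - theta| * edist x y.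
Proof.
rewrite /edist -[X in X * _]sqrtr_sqr -sqrtrM ?sqr_ge0//; congr Num.sqrt.
by rewrite mulr_sumr; apply: eq_bigr => i _; rewrite tnth_mktuple; ring.
Qed.

Lemma measurable_coord i : measurable_fun [set: euclidean R n] (fun y => tnth y i : R).
Proof. exact: measurable_tnth. Qed.

Lemma measurable_edist x : measurable_fun [set: euclidean R n] (edist x).
Proof.
apply: (measurableT_comp (f := @Num.sqrt R)).
  by apply: continuous_measurable_fun; exact: sqrt_continuous.
apply: measurable_sum => i; apply: measurable_funX; apply: measurable_funB => //.
exact: measurable_coord.
Qed.

Lemma measurable_eball x r : measurable (eball x r).
Proof.
rewrite (_ : eball x r = edist x @^-1` `]-oo, r[%classic).
  by rewrite -[X in measurable X]setTI; exact: measurable_edist.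
by apply/seteqP; split => y; rewrite /eball/= in_itv.
Qed.

Lemma measurable_cone x : measurable (cone x).
Proof.
have mf : measurable_fun [set: space_time R n] (fun p => (p.2 : R) - edist x p.1).
  apply: measurable_funB; first exact: measurable_snd.
  by apply: (measurableT_comp (measurable_edist x)); exact: measurable_fst.
rewrite (_ : cone x = snd @^-1` `]0, +oo[%classic `&`
    (fun p => (p.2 : R) - edist x p.1) @^-1` `]0, +oo[%classic).
  apply: measurableI.
    by rewrite -[X in measurable X]setTI; exact: measurable_snd.
  by rewrite -[X in measurable X]setTI; exact: mf.
by apply/seteqP; split => p; rewrite /cone /upper_half/= !in_itv/= !andbT subr_gt0.
Qed.

End euclidean_geometry.

Section box_volume.
Context {R : realType}.

Definition box n (a : 'I_n -> R) (l : R) : set (euclidean R n) :=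
  [set y | forall i, a i <= (tnth y i : R) < a i + l].

Lemma measurable_box n (a : 'I_n -> R) l : measurable (box a l).
Proof.
rewrite (_ : box a l = \bigcap_(i in [set: 'I_n])
    ((fun y => tnth y i : R) @^-1` `[a i, a i + l[%classic)).
  apply: fin_bigcap_measurable => // i _; rewrite -[X in measurable X]setTI; exact: measurable_coord.
apply/seteqP; split => y.
  by move=> H i _; rewrite /= in_itv/=; exact: H.
by move=> H i; have := H i I; rewrite /= in_itv.
Qed.

Lemma lebesgue_box n (a : 'I_n -> R) l : 0 <= l ->
  lebesgue_tuple n (box a l) = (l ^+ n)%:E.
Proof.
move=> l0; elim: n a => [|n IH] a.
  rewrite /= diracE mem_set ?expr0// => i; by case: i.
rewrite /= /pushforward.
rewrite (_ : @tcons R n @^-1` box a l =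
    `[a ord0, a ord0 + l[%classic `*` box (fun i => a (lift ord0 i)) l); last first.
  apply/seteqP; split => -[t y]; rewrite /box/= in_itv/=.
    move=> H; split; first exact: (H ord0).
    by move=> i; have := H (lift ord0 i); rewrite tnthS.
  move=> [H0 H] i; have [j ->|->//] := unliftP ord0 i.
  by rewrite tnthS; exact: H.
rewrite product_measure1E//; last exact: measurable_box.
rewrite [X in (X * _)%E]lebesgue_measure_itv/= lte_fin ltrDl.
have [l1|l1] := ltP 0 l; last first.
  have -> : l = 0 by apply/eqP; rewrite eq_le l0 l1.
  by rewrite mul0e exprS mul0r.
by rewrite IH -EFinB addrAC subrr add0r -EFinM -exprS.
Qed.

Lemma lebesgue_eball_le n (x : euclidean R n) r : 0 <= r ->
  (lebesgue_tuple n (eball x r) <= ((2 * r) ^+ n)%:E)%E.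
Proof.
move=> r0; rewrite -(lebesgue_box (fun i => (tnth x i : R) - r)) ?mulr_ge0//.
apply: le_measure; rewrite ?inE; [exact: measurable_eball|exact: measurable_box|].
move=> y xyr i; have := le_lt_trans (ler_coord_edist x y i) xyr.
rewrite ltr_norml => /andP[]; move: (tnth x i : R) (tnth y i : R) => u v; lra.
Qed.

Lemma lebesgue_eball_gt0 n (x : euclidean R n) r : 0 < r -> (0 < lebesgue_tuple n (eball x r))%E.
Proof.
move=> r0; pose l := r / n.+1%:R.
have l0 : 0 < l by rewrite divr_gt0.
apply: (@lt_le_trans _ _ (lebesgue_tuple n (box (fun i => tnth x i : R) l))).
  by rewrite lebesgue_box ?ltW// lte_fin exprn_gt0.
apply: le_measure; rewrite ?inE; [exact: measurable_box|exact: measurable_eball|].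
move=> y H; apply: (@le_lt_trans _ _ (n%:R * l)).
  apply: edist_le_coord => i; have := H i.
  by move: (tnth x i : R) (tnth y i : R) => u v uv; rewrite ler_norml; lra.
rewrite [ltRHS](_ : r = n.+1%:R * l); last by rewrite /l mulrC divfK.
by rewrite ltr_pM2r// ltr_nat.
Qed.

End box_volume.

(** * Dyadic cubes and cells *)

Section dyadic_cubes.
Context {R : realType} {n : nat}.

(** The side of the cubes of level [i] is [2 ^ i]; the exponential handles
    negative levels. *)
Definition side (i : int) : R := expR (i%:~R * ln 2).

Let ln2 : 0 < ln 2 :> R. Proof. by rewrite ln_gt0// ltr1n. Qed.

Lemma side_gt0 i : 0 < side i. Proof. exact: expR_gt0. Qed.

Lemma side_ge0 i : 0 <= side i. Proof. exact: ltW (side_gt0 i). Qed.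

Lemma sideD i j : side (i + j) = side i * side j.
Proof. by rewrite /side intrD mulrDl expRD. Qed.

Lemma sideS i : side (i + 1) = 2 * side i.
Proof. by rewrite sideD [side 1]/side mul1r lnK ?posrE// mulrC. Qed.

Lemma le_side i j : i <= j -> side i <= side j.
Proof. by move=> ij; rewrite ler_expR ler_wpM2r ?ler_int// ltW. Qed.

Lemma side_nat i (k : nat) : side (i + k%:Z) = (2 ^ k)%:R * side i.
Proof. by rewrite sideD mulrC [side k]/side -pmulrn expRM_natl lnK ?posrE// natrX. Qed.

Definition level (s : R) : int := Num.floor (ln s / ln 2).

Lemma level_le s i : 0 < s -> (i <= level s) = (side i <= s).
Proof.
by move=> s0; rewrite floor_ge_int ler_pdivlMr// -[in RHS](@lnK _ s) ?posrE// ler_expR.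
Qed.

Lemma level_eq s i : 0 < s -> (level s == i) = (side i <= s < side (i + 1)).
Proof.
move=> s0; rewrite -level_le// ltNge -level_le// -ltNge eq_le andbC.
by congr (_ && _); rewrite ltzD1.
Qed.

Lemma level_bounds s : 0 < s -> side (level s) <= s < side (level s + 1).
Proof. by move=> s0; rewrite -level_eq. Qed.

Definition key := (int * {ffun 'I_n -> int})%type.
Implicit Types (q c : key) (x y z : euclidean R n).

Definition corner q (j : 'I_n) : R := (q.2 j)%:~R * side q.1.

Definition cube q : set (euclidean R n) := box (corner q) (side q.1).

Definition cube_key (i : int) x : key :=
  (i, [ffun j => Num.floor ((tnth x j : R) / side i)]).

Lemma measurable_cube q : measurable (cube q). Proof. exact: measurable_box. Qed.

Lemma lebesgue_cube q : lebesgue_tuple n (cube q) = (side q.1 ^+ n)%:E.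
Proof. exact: lebesgue_box (side_ge0 _). Qed.

Lemma cubeP q x : cube q x <-> cube_key q.1 x = q.
Proof.
have E j : (corner q j <= (tnth x j : R) < corner q j + side q.1) =
    (Num.floor ((tnth x j : R) / side q.1) == q.2 j).
  rewrite floor_eq ler_pdivlMr ?side_gt0// ltr_pdivrMr ?side_gt0//.
  by rewrite intrD mulrDl mul1r.
split=> [qx|H j].
  rewrite [RHS]surjective_pairing; congr pair; apply/ffunP => j; rewrite ffunE.
  by apply/eqP; rewrite -E; exact: qx.
rewrite E (_ : q.2 = (cube_key q.1 x).2); first by rewrite ffunE.
by rewrite H.
Qed.

Lemma cube_key_cube i x : cube (cube_key i x) x. Proof. exact/cubeP. Qed.

Definition center q : euclidean R n := [tuple (corner q j : measurableTypeR R) | j < n].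

Lemma cube_center q : cube q (center q).
Proof. by move=> j; rewrite tnth_mktuple lexx ltrDl side_gt0. Qed.

(** Along each axis the end points of the larger interval are integer multiples
    of the smaller side, so two intervals that meet are nested. *)
Lemma cube_nested q q' x : cube q x -> cube q' x -> q.1 <= q'.1 -> cube q `<=` cube q'.
Proof.
move=> qx q'x qq' z qz j.
have [k kE] : exists k : nat, q'.1 = q.1 + k%:Z.
  exists `|q'.1 - q.1|%N; rewrite gez0_abs ?subr_ge0//.
  by rewrite addrCA subrr addr0.
have := qx j; have := q'x j; have := qz j; rewrite /corner kE side_nat.
have s0 := side_gt0 q.1; move: (side q.1) s0 => s s0.
move: (tnth x j : R) (tnth z j : R) => a b /andP[b1 b2] /andP[c1 c2] /andP[a1 a2].
have m1 : q'.2 j * (2 ^ k)%N%:Z <= q.2 j.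
  rewrite -ltzD1 -(ltr_int R) intrD intrM -(ltr_pM2r s0) mulrDl mul1r.
  by apply: le_lt_trans a2; rewrite -mulrA.
have m2 : q.2 j + 1 <= (q'.2 j + 1) * (2 ^ k)%N%:Z.
  rewrite lezD1 -(ltr_int R) intrM intrD -(ltr_pM2r s0).
  by apply: le_lt_trans a1 _; rewrite -mulrA mulrDl mul1r.
move: m1; rewrite -(ler_int R) intrM -(ler_pM2r s0) => m1.
move: m2; rewrite -(ler_int R) intrM !intrD -(ler_pM2r s0) => m2.
apply/andP; split.
  by apply: le_trans b1; apply: le_trans m1; rewrite -mulrA.
apply: lt_le_trans b2 _; rewrite mulrDl mul1r in m2; apply: le_trans m2 _.
by rewrite -mulrA mulrDl mul1r.
Qed.

Lemma floor_dist (a b : R) (k : nat) : `|a - b| < k%:R ->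
  `|Num.floor a - Num.floor b| <= k%:Z.
Proof.
have H (u v : R) : u - v < k%:R -> Num.floor u - Num.floor v <= k%:Z.
  move=> uv; rewrite lerBlDr -ltzD1 -(ltr_int R) !intrD.
  have := floor_le u; have := floorD1_gt v; rewrite intrD.
  move: ((Num.floor u)%:~R : R) ((Num.floor v)%:~R : R) => p q; rewrite -pmulrn; lra.
rewrite ltr_norml => /andP[ab1 ab2]; rewrite ler_norml H// andbT.
rewrite lerNl opprB H//; lra.
Qed.

Definition near (M : nat) c q := c.1 = q.1 /\ forall j, `|c.2 j - q.2 j| <= M%:Z.

Lemma cube_key_near M i x y : edist x y < M%:R * side i ->
  near M (cube_key i x) (cube_key i y).
Proof.
move=> xy; split => // j; rewrite !ffunE; apply: floor_dist.
rewrite -mulrBl normrM (gtr0_norm (_ : 0 < (side i)^-1)) ?invr_gt0 ?side_gt0//.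
by rewrite ltr_pdivrMr ?side_gt0//; exact: le_lt_trans (ler_coord_edist x y j) xy.
Qed.

Definition neighbours (M : nat) c : seq key :=
  [seq (c.1, [ffun j => c.2 j + (nat_of_ord (g j))%:Z - M%:Z]) |
     g : {ffun 'I_n -> 'I_(2 * M).+1} <- enum {: {ffun 'I_n -> 'I_(2 * M).+1}}].

Lemma size_neighbours M c : size (neighbours M c) = ((2 * M).+1 ^ n)%N.
Proof. by rewrite size_map -cardE card_ffun !card_ord. Qed.

Lemma mem_neighbours M c q : near M c q -> q \in neighbours M c.
Proof.
move=> [cq H].
have B j : (absz (q.2 j - c.2 j + M%:Z)%R < (2 * M).+1)%N.
  by have := H j; lia.
apply/mapP; exists [ffun j => Ordinal (B j)]; first by rewrite mem_enum.
rewrite [LHS]surjective_pairing cq; congr pair; apply/ffunP => j; rewrite !ffunE/=.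
by have := H j; lia.
Qed.

Lemma edist_near M c q x y : near M c q -> cube c x -> cube q y ->
  edist x y <= n%:R * (M.+1%:R * side q.1).
Proof.
move=> [cq H] cx qy; apply: edist_le_coord => j.
have := cx j; have := qy j; rewrite /corner cq; have := H j.
rewrite ler_norml -!(ler_int R) intrD !intrN -pmulrn => /andP[].
have := side_gt0 q.1; move: (side q.1) ((q.2 j)%:~R : R) ((c.2 j)%:~R : R) => s u v s0.
rewrite -[M.+1]addn1 natrD; move: (M%:R : R) => m mv vm.
move: (tnth x j : R) (tnth y j : R) => a b /andP[b1 b2] /andP[a1 a2].
rewrite ler_norml; apply/andP; split; nra.
Qed.

End dyadic_cubes.

Section cells.
Context {R : realType} {n : nat}.
Variable L : R.
Hypothesis L0 : 0 < L.
Local Notation T := (space_time R n).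

(** The dyadic cell of a point of the half-space: a level comparable to its
    height and the cube of that level above which it lies. *)
Definition cell (p : T) : key := cube_key (level ((p.2 : R) / L)) p.1.

Lemma cell_height p : upper_half p ->
  L * side (cell p).1 <= (p.2 : R) < L * (2 * side (cell p).1).
Proof.
move=> p0; have s0 : 0 < (p.2 : R) / L by rewrite divr_gt0.
have := level_bounds s0; rewrite sideS /cell/= ler_pdivlMr// ltr_pdivrMr//.
by rewrite mulrC [X in _ < X]mulrC.
Qed.

(** There are countably many cells, and each is a product of a cube and an
    interval. *)
Lemma measurable_cells (D : set (@key n)) : measurable (upper_half `&` cell @^-1` D).
Proof.
pose A (q : @key n) : set T := cube q `*` `[L * side q.1, L * side (q.1 + 1)[%classic.
have mA q : measurable (A q).
  by apply: measurableX => //; exact: measurable_cube.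
have AE q p : A q p -> upper_half p /\ cell p = q.
  move=> [qx]; rewrite /= in_itv/= => /andP[p1 p2].
  have p0 : 0 < (p.2 : R) by apply: lt_le_trans p1; rewrite mulr_gt0 ?side_gt0.
  split => //; rewrite /cell (_ : level _ = q.1); first exact/cubeP.
  apply/eqP; rewrite level_eq ?divr_gt0// ler_pdivlMr// ltr_pdivrMr//.
  by rewrite !(mulrC _ L) p1 p2.
pose V (q : @key n) : set T := if `[< D q >] then A q else set0.
rewrite (_ : _ `&` _ = \bigcup_m oapp V set0 (choice.unpickle m)).
  apply: bigcup_measurable => m _; case: choice.unpickle => [q|]; last exact: measurable0.
  by rewrite /V /=; case: asboolP => _; [exact: mA|exact: measurable0].
apply/seteqP; split => [p [p0 Dp]|p [m _]].
  exists (choice.pickle (cell p)); first exact: I.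
  rewrite choice.pickleK /= /V (asboolT Dp); split; first exact: cube_key_cube.
  by have := cell_height p0; rewrite -sideS /= in_itv.
case: choice.unpickle => [q|] //; rewrite /V /=; case: asboolP => // Dq Aq.
by have [p0 pq] := AE _ _ Aq; split => //=; rewrite pq.
Qed.

End cells.

(** * The energy of the restriction to a set *)

Section localisation.
Context {R : realType} {n : nat} {d : measure_display} {Omega : measurableType d}.
Context {P : probability Omega R}.
Local Notation T := (space_time R n).
Local Notation mu := (@half_measure R n).
Variable W : set T -> {RV P >-> R}.
Hypothesis HW : gaussian_random_measure W.
Context {X : completeNormedModType R}.
Variables (f : T -> X) (G : set (euclidean R n)).
Hypothesis Gf : forall x, G x -> in_L2_tensor (restr (cone x) f).
Implicit Types (A B S : set T) (x y z : euclidean R n).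

Definition mass A : \bar R := energy W (restr A f).

Lemma restrI A B : restr A (restr B f) = restr (A `&` B) f.
Proof. by apply/funext => p; rewrite /restr scalerA indicI. Qed.

Lemma restr_sub A B : A `<=` B -> restr A f = restr A (restr B f).
Proof. by move=> AB; rewrite restrI setIidl. Qed.

Lemma tensor_cone A x : measurable A -> A `<=` cone x -> G x -> in_L2_tensor (restr A f).
Proof. by move=> mA Ax Gx; rewrite (restr_sub Ax); apply: tensor_restr => //; exact: Gf. Qed.

Lemma le_mass A B x : measurable A -> measurable B -> A `<=` B -> B `<=` cone x -> G x ->
  (mass A <= mass B)%E.
Proof.
move=> mA mB AB Bx Gx; rewrite /mass (restr_sub AB).
by apply: energy_restr => //; exact: (tensor_cone mB Bx).
Qed.

Lemma mass_lty A x : measurable A -> A `<=` cone x -> G x -> (mass A < +oo)%E.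
Proof. by move=> mA Ax Gx; apply: (energy_lty HW); exact: (tensor_cone mA Ax). Qed.

Lemma restrU A B : A `&` B = set0 -> restr (A `|` B) f = (fun p => restr A f p + restr B f p).
Proof.
move=> AB; apply/funext => p; rewrite /restr -scalerDl; congr (_ *: _).
rewrite !indicE; have [pA|pA] := pselect (A p).
  rewrite (mem_set pA) mem_set; last by left.
  by rewrite memNset ?addr0// => pB; have : (A `&` B) p by []; rewrite AB.
rewrite (memNset pA) add0r; have [pB|pB] := pselect (B p).
  by rewrite !mem_set//; right.
by rewrite !memNset// => -[].
Qed.

Lemma mass_disjointU A B : A `&` B = set0 -> in_L2_tensor (restr A f) ->
  in_L2_tensor (restr B f) ->
  in_L2_tensor (restr (A `|` B) f) /\ (mass (A `|` B) <= mass A + mass B)%E.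
Proof. by move=> AB tA tB; rewrite /mass (restrU AB); exact: energyD. Qed.

(** Peel off one cone at a time; the part of [A] in the cone at [z] has no more
    energy than the cone itself. *)
Lemma mass_cover (zs : seq (euclidean R n)) A : measurable A ->
  (forall z, z \in zs -> G z) -> (forall p, A p -> exists2 z, z \in zs & cone z p) ->
  in_L2_tensor (restr A f) /\ (mass A <= \sum_(z <- zs) mass (cone z))%E.
Proof.
elim: zs A => [|z zs IH] A mA Gz Az.
  have -> : A = set0 by apply/seteqP; split => // p /Az[].
  have r0 : restr set0 f = fun=> 0.
    by apply/funext => p; rewrite /restr indic0 scale0r.
  have F0 (k : 'I_0) : T -> R by case: k.
  have xi0 (k : 'I_0) : X by case: k.
  have D : tensor_decomp (restr set0 f) F0 xi0.
    by split => [[]//|]; apply: aeW => p; rewrite r0 big_ord0.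
  split; first by exists 0%N, F0, xi0.
  rewrite big_nil /mass (energyE HW D) norm2E.
  rewrite (eq_integral (fun=> 0%E)) ?integral0 ?sqrte0// => w _.
  by rewrite /vnorm big_ord0 normr0 expr0n.
have Gz1 : G z by apply: Gz; rewrite mem_head.
have mz := measurable_cone z.
have [//|||t2 le2] := IH (A `\` cone z); first exact: measurableD.
  by move=> z' z's; apply: Gz; rewrite inE z's orbT.
  move=> p [/Az[z' + z'p] nz]; rewrite inE => /orP[/eqP zz|z's]; last by exists z'.
  by rewrite zz in z'p.
have mAz : measurable (A `&` cone z) by exact: measurableI.
have t1 := tensor_cone mAz (@subIsetr _ _ _) Gz1.
have [|t3 le3] := mass_disjointU _ t1 t2.
  by apply/seteqP; split => // p [[_ ?] [_ ?]].
rewrite -{1 2}(setUIDK A (cone z)); split=> //.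
apply: le_trans le3 _; rewrite big_cons; apply: leeD le2.
exact: (le_mass mAz mz (@subIsetr _ _ _) (@subset_refl _ _) Gz1).
Qed.

Lemma mass_U A B x : measurable A -> measurable B -> A `<=` cone x -> B `<=` cone x -> G x ->
  (mass (A `|` B) <= mass A + mass B)%E.
Proof.
move=> mA mB Ax Bx Gx; have mBA : measurable (B `\` A) by exact: measurableD.
have BAx : B `\` A `<=` cone x by move=> p [/Bx].
have AB0 : A `&` (B `\` A) = set0 by apply/seteqP; split => // p [? []].
have AB : A `|` B = A `|` (B `\` A).
  apply/seteqP; split => p; last by move=> [?|[? _]]; [left|right].
  by move=> [?|?]; have [?|?] := pselect (A p); [left|left|left|right].
have [_] := mass_disjointU AB0 (tensor_cone mA Ax Gx) (tensor_cone mBA BAx Gx).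
rewrite AB; move=> /le_trans; apply; rewrite leeD2l//.
by apply: (le_mass mBA mB _ Bx Gx) => p [].
Qed.

Lemma mass_cvg0 (S : nat -> set T) x : (forall i, measurable (S i)) ->
  (forall i, S i `<=` cone x) -> (forall p, \forall i \near \oo, ~ S i p) -> G x ->
  mass (S i) @[i --> \oo] --> 0%E.
Proof.
move=> mS Sx S0 Gx; have := energy_restr_cvg0 HW mS S0 (Gf Gx).
rewrite (_ : (fun i => _) = (fun i => mass (S i)))//.
by apply/funext => i; rewrite /mass -(restr_sub (Sx i)).
Qed.

End localisation.

(** * Sets avoiding the heavy cubes *)

Section stopping_cubes.
Context {R : realType} {n : nat} {d : measure_display} {Omega : measurableType d}.
Context {P : probability Omega R}.
Local Notation T := (space_time R n).
Variable W : set T -> {RV P >-> R}.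
Hypothesis HW : gaussian_random_measure W.
Context {X : completeNormedModType R}.
Variables (f : T -> X) (G : set (euclidean R n)).
Hypothesis Gf : forall x, G x -> in_L2_tensor (restr (cone x) f).
Hypothesis n1 : (1 <= n)%N.
Implicit Types (A B S : set T) (x y z : euclidean R n) (q c : @key n) (k : int).
Local Notation mass := (mass W f).

(** The least height of the cells of level [0].  It is twice a bound of the diameter
    of the cubes of level [0], so that small cubes fit between a point of a cone
    and the boundary of the ball attached to it. *)
Definition height_unit : R := (2 * n)%:R.

(** The distance from the foot of [p0] to the point reached in [cell_above] is less
    than [5/2] times [height_unit], that is [5 * n] sides. *)
Definition reach : nat := (5 * n)%N.
Definition neighbour_count : nat := ((2 * reach).+1 ^ n)%N.

Let L := height_unit.

Lemma height_unit_gt0 : 0 < height_unit.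
Proof. by rewrite ltr0n muln_gt0. Qed.
Local Hint Resolve height_unit_gt0 : core.

Definition heavy k q := forall z, cube q z -> G z -> ((side k)%:E < mass (cone z))%E.

Definition heavy_cell k c := exists2 q, near reach c q & heavy k q.

Definition heavy_region k : set T := upper_half `&` cell height_unit @^-1` heavy_cell k.

Lemma light_near k c q : ~ heavy_cell k c -> near reach c q ->
  exists z, [/\ cube q z, G z & (mass (cone z) <= (side k)%:E)%E].
Proof.
move=> nc cq; apply: contrapT => H; apply: nc; exists q => // z qz Gz.
by rewrite ltNge; apply/negP => zk; apply: H; exists z.
Qed.

(** With [rho = L * side j], where [j] is the level of [p0], move from [x] towards
    the foot [y] of [p = (y, t)] by the proportion [rho / (2 * t)].  This costs
    at most [rho / 2], so the cube [q] reached is near the cell of [p0], and it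
    leaves a distance less than [t - rho / 2] to [y]; as [q] has diameter at
    most [rho / 2], the whole of [q] lies in the ball [B(y, t)]. *)
Lemma cell_above (p0 p : T) x (q := cube_key (cell L p0).1
    (segment x p.1 (L * side (cell L p0).1 / (2 * (p.2 : R))))) z :
  cone x p0 -> cone x p -> (cell L p0).1 <= (cell L p).1 ->
  near reach (cell L p0) q /\ (cube q z -> cone z p).
Proof.
set j := (cell L p0).1; set rho := L * side j => -[u0 xp0] [u xp] jp.
have /andP[_ h0] := cell_height height_unit_gt0 u0.
have /andP[h _] := cell_height height_unit_gt0 u.
have s0 : 0 < side j :> R by exact: side_gt0.
have rho0 : 0 < rho by rewrite mulr_gt0.
have rho_p : rho <= p.2.
  by apply: le_trans h; rewrite ler_wpM2l ?(ltW height_unit_gt0)//; exact: le_side.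
have rhoE : rho / 2 = n%:R * side j by rewrite /rho /L /height_unit natrM; field.
have h0' : (p0.2 : R) < 2 * rho by apply: lt_le_trans h0 _; rewrite /rho mulrCA.
pose t := (p.2 : R); rewrite -/t in xp rho_p; have t0 : 0 < t by exact: u.
have th0 : 0 <= rho / (2 * t) by rewrite divr_ge0 ?mulr_ge0 ?(ltW rho0)// ltW.
have th1 : rho / (2 * t) <= 1 by rewrite ler_pdivrMr ?mulr_gt0// mul1r; lra.
have tht : rho / (2 * t) * t = rho / 2 by field; rewrite gt_eqF.
have dx : edist x (segment x p.1 (rho / (2 * t))) <= rho / 2.
  by rewrite edist_segmentl ger0_norm// -tht ler_wpM2l// ltW.
have dy : edist (segment x p.1 (rho / (2 * t))) p.1 < t - rho / 2.
  have th2 : rho / (2 * t) < 1 by rewrite ltr_pdivrMr ?mulr_gt0// mul1r; lra.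
  rewrite edist_segmentr ger0_norm ?subr_ge0//.
  rewrite (_ : t - rho / 2 = (1 - rho / (2 * t)) * t); last by rewrite mulrBl mul1r tht.
  by rewrite ltr_pM2l// subr_gt0.
split; last first.
  move=> qz; split; first exact: u.
  rewrite /= -/t; apply: le_lt_trans (edist_triangle (segment x p.1 (rho / (2 * t))) z p.1) _.
  rewrite -[ltRHS](subrK (rho / 2)) addrC.
  apply: ltr_leD => //; rewrite rhoE.
  have := edist_near (M := 0) (c := q) (q := q) _ qz (cube_key_cube _ _).
  by rewrite mul1r; apply; split => // i; rewrite subrr normr0.
rewrite [cell L p0](_ : _ = cube_key j p0.1)//; apply: cube_key_near.
apply: le_lt_trans (edist_triangle x _ _) _; rewrite edistC.
apply: (@lt_le_trans _ _ (2 * rho + rho / 2)).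
  by apply: ltr_leD dx; exact: lt_trans h0'.
by rewrite /rho /L /height_unit /reach !natrM; lra.
Qed.

(** Take [p0] of lowest level in [S].  Its cell is not near a heavy cube, so each
    of the cubes near it contains a good [z] of small energy, and by
    [cell_above] the cones at these [z] cover [S]. *)
Lemma mass_light_truncated k S x (j : int) : measurable S -> G x ->
  (forall p, S p -> cone x p) -> (forall p, S p -> ~ heavy_region k p) ->
  (forall p, S p -> j <= (cell L p).1) ->
  (mass S <= (neighbour_count%:R * side k)%:E)%E.
Proof.
move=> mS Gx Sx Sk Sj.
have [[p1 Sp1]|S0] := pselect (exists p, S p); last first.
  have [||_] := @mass_cover _ _ _ _ _ W HW _ f G Gf [::] S mS.
  - by [].
  - by move=> p Sp; exfalso; apply: S0; exists p.
  by rewrite big_nil => /le_trans; apply; rewrite lee_fin mulr_ge0// side_ge0.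
(* a point of lowest level exists since the levels in [S] are bounded below *)
have exm : exists m : nat, `[< exists2 p, S p & (cell L p).1 = j + m%:Z >].
  exists `|(cell L p1).1 - j|%N; apply/asboolP; exists p1 => //.
  by have := Sj _ Sp1; lia.
have [m0 /asboolP[p0 Sp0 p0m] m0min] := ex_minnP exm.
have pmin p : S p -> (cell L p0).1 <= (cell L p).1.
  move=> Sp; have jp := Sj _ Sp.
  have : (m0 <= `|(cell L p).1 - j|)%N.
    by apply: m0min; apply/asboolP; exists p => //; lia.
  by rewrite p0m; lia.
have nc : ~ heavy_cell k (cell L p0).
  by move=> hc; apply: (Sk _ Sp0); split => //; have [] := Sx _ Sp0.
pose ns := [seq q <- neighbours reach (cell L p0) | `[< near reach (cell L p0) q >]].
have /choice[zf zfP] : forall q, exists z, near reach (cell L p0) q ->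
    [/\ cube q z, G z & (mass (cone z) <= (side k)%:E)%E].
  move=> q; have [cq|ncq] := pselect (near reach (cell L p0) q); last by exists x.
  by have [z zP] := light_near nc cq; exists z.
have nsP q : q \in ns -> near reach (cell L p0) q.
  by rewrite mem_filter => /andP[/asboolP].
have [||_] := @mass_cover _ _ _ _ _ W HW _ f G Gf (map zf ns) S mS.
- by move=> _ /mapP[q /nsP/zfP[_ ? _] ->].
- move=> p Sp; pose q := cube_key (cell L p0).1
    (segment x p.1 (L * side (cell L p0).1 / (2 * (p.2 : R)))).
  have [cq zp] := cell_above (zf q) (Sx _ Sp0) (Sx _ Sp) (pmin _ Sp).
  have [zq _ _] := zfP _ cq; exists (zf q); last exact: zp.
  by apply: map_f; rewrite mem_filter mem_neighbours// andbT; exact/asboolP.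
move=> /le_trans; apply; rewrite big_map big_seq.
apply: (@le_trans _ _ (\sum_(q <- ns | q \in ns) (side k)%:E)%E).
  by apply: lee_sum => q /nsP/zfP[].
rewrite -big_seq sumEFin lee_fin big_const_seq iter_addr_0 count_predT.
rewrite -[leLHS]mulr_natl ler_wpM2r ?side_ge0// ler_nat /neighbour_count -(size_neighbours reach (cell L p0)).
by rewrite size_filter count_size.
Qed.

(** The part of [S] of level below [-i] has an energy tending to [0]. *)
Lemma mass_light k S x : measurable S -> G x ->
  (forall p, S p -> cone x p) -> (forall p, S p -> ~ heavy_region k p) ->
  (mass S <= (neighbour_count%:R * side k)%:E)%E.
Proof.
move=> mS Gx Sx Sk.
pose H (i : nat) : set T := upper_half `&` cell L @^-1` [set c | - i%:Z <= c.1].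
have mH i : measurable (H i) by exact: measurable_cells.
have mSH i : measurable (S `&` H i) by exact: measurableI.
have mSD i : measurable (S `\` H i) by exact: measurableD.
have SDx i : S `\` H i `<=` cone x by move=> p [/Sx].
apply/lee_addgt0Pr => e e0.
have : mass (S `\` H i) @[i --> \oo] --> 0%E.
  apply: (mass_cvg0 HW Gf mSD SDx _ Gx) => p.
  exists `|(cell L p).1|%N => // i /= ip [Sp]; apply.
  by split; [have [] := Sx _ Sp|rewrite /preimage /=; lia].
move=> /cvge0_near/(_ e0)[i _ /(_ i (leqnn i)) ie].
rewrite -(setUIDK S (H i)).
apply: le_trans (mass_U HW Gf (mSH i) (mSD i) _ (SDx i) Gx) _.
  by move=> p [/Sx].
apply: leeD ie; apply: (mass_light_truncated (j := - i%:Z) (mSH i) Gx).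
- by move=> p [/Sx].
- by move=> p [/Sk].
- by move=> p [_ []].
Qed.

End stopping_cubes.

(** * Maximal heavy cubes *)

(** The integral of a nonnegative function is a supremum over the simple
    functions below it, so it is monotone on all functions. *)
Lemma ge0_le_integral_any (R : realType) (d : measure_display) (T : measurableType d)
    (m : {measure set T -> \bar R}) (D : set T) (f g : T -> \bar R) :
  (forall x, D x -> 0 <= f x)%E -> (forall x, D x -> f x <= g x)%E ->
  (\int[m]_(x in D) f x <= \int[m]_(x in D) g x)%E.
Proof.
move=> f0 fg; have g0 x : D x -> (0 <= g x)%E by move=> Dx; exact: le_trans (f0 _ Dx) (fg _ Dx).
rewrite !ge0_integralE//; apply: le_ereal_sup => _ [h hf <-]; exists h => // x.
apply: le_trans (hf x) _; rewrite !patchE; case: ifPn => //; rewrite inE; exact: fg.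
Qed.

Section maximal_cubes.
Context {R : realType} {n : nat} {d : measure_display} {Omega : measurableType d}.
Context {P : probability Omega R}.
Local Notation T := (space_time R n).
Variable W : set T -> {RV P >-> R}.
Hypothesis HW : gaussian_random_measure W.
Context {X : completeNormedModType R}.
Variables (f : T -> X) (G : set (euclidean R n)).
Hypothesis Gf : forall x, G x -> in_L2_tensor (restr (cone x) f).
Hypothesis n1 : (1 <= n)%N.
Hypothesis mG : measurable G.
Hypothesis nG : lebesgue_tuple n (~` G) = 0%E.
Hypothesis f1 : (T1_norm W f < +oo)%E.
Implicit Types (x y z : euclidean R n) (q c : @key n) (k : int).
Local Notation mass := (mass W f).
Local Notation heavy := (heavy W f G).
Local Notation heavy_cell := (heavy_cell W f G).
Local Notation heavy_region := (heavy_region W f G).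
Local Notation reach := (@reach n).
Local Notation height_unit := (@height_unit R n).
Local Notation leb := (lebesgue_tuple n).

Lemma mass_cone x : mass (cone x) = sqrte (cone_energy W f x).
Proof. by rewrite sqrte_cone_energy. Qed.

Lemma lebesgue_cube_good q : leb (cube q `&` G) = (side q.1 ^+ n)%:E.
Proof.
have mq : measurable (cube (R := R) q) by exact: measurable_cube.
rewrite -lebesgue_cube -[in RHS](setUIDK (cube (R := R) q) G) measureU.
- rewrite [X in (_ + X)%E](_ : _ = 0%E) ?adde0//.
  apply: (subset_measure0 (measurableD mq mG) (measurableC mG) _ nG).
  by move=> x [].
- exact: measurableI.
- exact: measurableD.
- by apply/seteqP; split => // x [[_ ?] [_ ?]].
Qed.

Lemma cube_good q : exists2 z, cube q z & G z.
Proof.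
apply: contrapT => H; have := lebesgue_cube_good q.
rewrite (_ : cube q `&` G = set0) ?measure0.
  by move=> [] /esym/eqP; rewrite expf_eq0 gt_eqF ?side_gt0// andbF.
by apply/seteqP; split => // z [qz Gz]; apply: H; exists z.
Qed.

Lemma heavy_le k k' q : k <= k' -> heavy k' q -> heavy k q.
Proof.
move=> kk hq z qz Gz; apply: le_lt_trans (hq z qz Gz).
by rewrite lee_fin le_side.
Qed.

Lemma heavy_cell_le k k' c : k <= k' -> heavy_cell k' c -> heavy_cell k c.
Proof. by move=> kk [q cq hq]; exists q => //; exact: heavy_le kk hq. Qed.

(** [side k] times the indicator function of the good points of [q] is below the
    energy of the cones. *)
Lemma heavy_volume k q : heavy k q -> ((side k * side q.1 ^+ n)%:E <= T1_norm W f)%E.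
Proof.
move=> hq; have mqG : measurable (cube q `&` G).
  by apply: measurableI => //; exact: measurable_cube.
rewrite EFinM -lebesgue_cube_good -integral_cst//= integral_mkcond.
apply: ge0_le_integral_any => x _.
  by rewrite patchE; case: ifP => // _; rewrite lee_fin side_ge0.
rewrite patchE; case: ifPn => [|_]; last exact: sqrte_ge0.
by rewrite inE -mass_cone => -[qx Gx]; apply/ltW/hq.
Qed.

(** Heavy cubes of a given threshold have bounded volume, hence bounded level;
    therefore maximal ones exist. *)
Lemma heavy_level k : exists b : int, forall q, heavy k q -> q.1 <= b.
Proof.
have f0 : (0 <= T1_norm W f)%E by apply: integral_ge0 => x _; exact: sqrte_ge0.
have fE : T1_norm W f \is a fin_num by rewrite ge0_fin_numE.
(* the summand [1] keeps [t] positive and puts large sides above [1] *)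
pose t := 1 + fine (T1_norm W f) / side k.
have t0 : 0 < t by rewrite ltr_wpDr// divr_ge0 ?side_ge0// fine_ge0.
exists (level t) => q /heavy_volume; rewrite -(fineK fE) lee_fin mulrC.
rewrite -ler_pdivlMr ?side_gt0// => h; rewrite level_le// leNgt; apply/negP => tq.
have q1 : 1 <= side q.1 :> R.
  by apply: le_trans (ltW tq); rewrite lerDl divr_ge0 ?side_ge0// fine_ge0.
have : side q.1 <= side q.1 ^+ n :> R by rewrite -[leLHS]expr1 ler_weXn2l.
by move: tq h; rewrite /t; lra.
Qed.

Definition maximal k q := heavy k q /\
  forall q', heavy k q' -> q.1 < q'.1 -> ~ (cube q `<=` cube (R := R) q').

(** The heavy cubes above [q] are those containing its center, one for each level. *)
Lemma maximal_exists k q : heavy k q ->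
  exists r, [/\ maximal k r, q.1 <= r.1 & cube q `<=` cube (R := R) r].
Proof.
move=> hq; have [b hb] := heavy_level k; pose x : euclidean R n := center q.
have qx : cube q x by exact: cube_center.
pose I (m : nat) := `[< heavy k (cube_key (q.1 + m%:Z) x) >].
have I0 : exists m, I m.
  by exists 0%N; apply/asboolP; rewrite addr0 (_ : cube_key _ _ = q)//; exact/cubeP.
have Ib m : I m -> (m <= `|b - q.1|)%N by move=> /asboolP/hb/=; lia.
have [m /asboolP hm mmax] := ex_maxnP I0 Ib.
have rx := cube_key_cube (q.1 + m%:Z) x.
exists (cube_key (q.1 + m%:Z) x); split=> /=; [split=> // q' hq' lt_q' sub|by lia|].
  have q'x : cube q' x by apply: sub.
  have E : cube_key (q.1 + `|q'.1 - q.1|%N%:Z) x = q'.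
    rewrite (_ : q.1 + _ = q'.1); first exact/cubeP.
    by move: lt_q' => /=; lia.
  have : I `|q'.1 - q.1|%N by apply/asboolP; rewrite E.
  by move=> /mmax; move: lt_q' => /=; lia.
by apply: (cube_nested qx rx) => /=; lia.
Qed.

Lemma maximal_unique k q r x : maximal k q -> maximal k r -> cube q x -> cube r x -> q = r.
Proof.
wlog qr : q r / q.1 <= r.1.
  move=> H mq mr qx rx; have [qr|/ltW rq] := leP q.1 r.1; first exact: H.
  by apply/esym; exact: H.
move=> [hq mq] [hr _] qx rx; move: qr; rewrite le_eqVlt => /orP[/eqP qr|qr].
  by move/cubeP : (qx) => <-; move/cubeP : (rx) => <-; rewrite qr.
by exfalso; apply: (mq _ hr qr); exact: (cube_nested qx rx (ltW qr)).
Qed.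

(** Each of the finitely many cubes near [c] contains a good point, whose cone has
    finite energy. *)
Lemma not_heavy c : exists k, ~ heavy_cell k c.
Proof.
suff [k Hk] : exists k, forall q, q \in neighbours reach c -> ~ heavy k q.
  by exists k => -[q cq]; apply: Hk; exact: mem_neighbours.
elim: (neighbours reach c) => [|q s [k Hk]]; first by exists 0.
have [z qz Gz] := cube_good q.
have zoo := mass_lty HW Gf (measurable_cone z) (@subset_refl _ _) Gz.
have z0 : (0 <= mass (cone z))%E by exact: energy_ge0.
have zE : mass (cone z) \is a fin_num by rewrite ge0_fin_numE.
pose t := 1 + fine (mass (cone z)).
have t0 : 0 < t by rewrite ltr_wpDr// fine_ge0.
pose k' := level t + 1.
have [kk'|/ltW k'k] := leP k k'.
  exists k' => r; rewrite inE => /orP[/eqP->|rs]; last by move=> /(heavy_le kk'); exact: Hk.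
  move=> /(_ z qz Gz); rewrite -(fineK zE) lte_fin; apply/negP; rewrite -leNgt.
  have /andP[_] := level_bounds t0; rewrite -/k' => /ltW; apply: le_trans.
  by rewrite lerDr.
exists k => r; rewrite inE => /orP[/eqP->|]; last exact: Hk.
move=> /(heavy_le k'k)/(_ z qz Gz); rewrite -(fineK zE) lte_fin; apply/negP; rewrite -leNgt.
have /andP[_] := level_bounds t0; rewrite -/k' => /ltW; apply: le_trans.
by rewrite lerDr.
Qed.

Definition piece_cells k r : set (@key n) := [set c |
  ~ heavy_cell (k + 1) c /\ exists q, [/\ near reach c q, heavy k q, q.1 <= r.1 &
    cube q `<=` cube (R := R) r]].

Definition piece k r : set T := upper_half `&` cell height_unit @^-1` piece_cells k r.

Lemma measurable_piece k r : measurable (piece k r).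
Proof. by apply: measurable_cells; exact: height_unit_gt0. Qed.

Lemma piece_light k r p : piece k r p -> ~ heavy_region (k + 1) p.
Proof. by move=> [_ [nh _]] [_]. Qed.

(** At the last threshold for which the cell of [p] is near a heavy cube. *)
Lemma piece_cover k p : heavy_region k p -> exists k' r, maximal k' r /\ piece k' r p.
Proof.
move=> [p0 hp]; set c := cell height_unit p in hp *.
have hp' : heavy_cell k c by [].
have [k1 nk1] := not_heavy c.
have kk1 : k < k1 by rewrite ltNge; apply/negP => /heavy_cell_le/(_ hp').
have exm : exists m : nat, `[< ~ heavy_cell (k + m%:Z) c >].
  exists `|k1 - k|%N; apply/asboolP; rewrite (_ : k + _ = k1)//; lia.
have [[|m] /asboolP nm mmin] := ex_minnP exm; first by rewrite addr0 in nm.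
have [q cq hq] : heavy_cell (k + m%:Z) c.
  apply: contrapT => nh; have /mmin : `[< ~ heavy_cell (k + m%:Z) c >] by exact/asboolP.
  by rewrite ltnn.
have [r [mr qr sub]] := maximal_exists hq.
exists (k + m%:Z), r; split=> //; split=> //; split; last by exists q.
by rewrite -/c (_ : k + m%:Z + 1 = k + m.+1%:Z)//; lia.
Qed.

(** A ball [B(y, t)] attached to a point of a piece reaches from the center of [r]
    to the center of a heavy cube [q] below [r] ([n] sides of [r]), on to [y]
    ([n * (reach + 1)] sides of [q]), and then [t < 4 * n] sides of [q]. *)
Definition dilation : R := (n * (reach + 6))%:R.

Lemma dilation_gt0 : 0 < dilation.
Proof. by rewrite ltr0n muln_gt0 n1/= addnS. Qed.

Definition radius (r : @key n) : R := dilation * side r.1.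

Lemma radius_gt0 r : 0 < radius r.
Proof. by rewrite mulr_gt0 ?side_gt0 ?dilation_gt0. Qed.

Lemma piece_tent k r : piece k r `<=` tent (eball (center r) (radius r)).
Proof.
move=> p [p0 [_ [q [cq _ qr sub]]]]; split=> // w pw.
have /andP[_ ht] := cell_height (@height_unit_gt0 R n n1) p0.
have qc : (cell height_unit p).1 = q.1 by case: cq.
have yc : cube (cell height_unit p) p.1 by exact: cube_key_cube.
have cy := edist_near cq yc (cube_center q).
have rr := edist_near (M := 0) (c := r) (q := r) _ (sub _ (cube_center q)) (cube_center r).
have {}rr : edist (center q) (center r) <= n%:R * (1 * side r.1) :> R.
  by apply: rr; split => // i; rewrite subrr normr0.
have sqr : side q.1 <= side r.1 :> R by exact: le_side.
have t1 := edist_triangle p.1 (center r) w.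
have t2 := edist_triangle (center q) (center r) p.1.
rewrite (edistC (center q) p.1) (edistC (center r) (center q)) in t2.
rewrite /eball/=; apply: le_lt_trans t1 _.
have nr : 0 < n%:R :> R by rewrite ltr0n.
have m1 : n%:R * (reach.+1%:R * side q.1) <= n%:R * (reach.+1%:R * side r.1) :> R.
  by rewrite !ler_wpM2l.
have m2 : (p.2 : R) < 4 * (n%:R * side r.1).
  apply: lt_le_trans ht _; rewrite qc /height_unit natrM.
  rewrite (_ : 2 * n%:R * (2 * side q.1) = 4 * (n%:R * side q.1)); last by ring.
  by rewrite !ler_wpM2l.
have pw' : edist p.1 w < (p.2 : R) by exact: pw.
rewrite /radius /dilation natrM natrD.
rewrite -[reach.+1]addn1 natrD in m1 cy.
move: (edist p.1 w) (p.2 : R) (edist (center r) p.1) (edist (center q) (center r))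
  (edist p.1 (center q)) t2 cy rr m1 m2 pw' => a1 a2 a3 a4 a5.
move: (side r.1) (side q.1) (reach%:R) => s u rr t2 cy h3 m1 m2 pw'.
nra.
Qed.

End maximal_cubes.

(** * The atomic decomposition *)

(** A finite sum of distinct powers of two is less than twice the largest one. *)
Lemma sum_side_lt (R : realType) (K : int) (s : seq int) : uniq s ->
  (forall k, k \in s -> k <= K) -> \sum_(k <- s) side (R := R) k <= side (K + 1).
Proof.
have [m] := ubnP (size s); elim: m K s => // m IH K s sm us sK.
have [->|s0] := eqVneq s [::]; first by rewrite big_nil side_ge0.
have [k ks kmax] : exists2 k, k \in s & forall j, j \in s -> j <= k.
  case: s s0 {sm us sK} => // a s _; elim: s a => [|b s IHs] a.
    by exists a; rewrite ?mem_head// => j; rewrite inE => /eqP->.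
  have [k kb kmax] := IHs b.
  have [ak|/ltW ka] := leP a k.
    exists k; first by rewrite in_cons kb orbT.
    by move=> j; rewrite in_cons => /orP[/eqP->//|/kmax].
  exists a; rewrite ?mem_head// => j; rewrite in_cons => /orP[/eqP->//|/kmax jk].
  exact: le_trans jk ka.
rewrite (perm_big _ (perm_to_rem ks)) big_cons.
have H : \sum_(j <- rem k s) side (R := R) j <= side (k - 1 + 1).
  apply: IH; rewrite ?rem_uniq//.
    by rewrite size_rem//; move: sm s0; case: (s).
  move=> j; rewrite mem_rem_uniq// inE => /andP[jk /kmax]; rewrite le_eqVlt (negbTE jk)/=.
  by lia.
rewrite subrK in H; apply: (@le_trans _ _ (side (k + 1))).
  by rewrite sideS mulr_natl mulr2n lerD2l.
by apply: le_side; rewrite lerD2r; exact: sK.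
Qed.

Lemma sum_side_le (R : realType) (E : R) (s : seq int) : uniq s ->
  (forall k, k \in s -> side k <= E) -> 0 < E -> \sum_(k <- s) side k <= 2 * E.
Proof.
move=> us sE E0; apply: le_trans (_ : _ <= side (level E + 1)) _.
  by apply: sum_side_lt => // k /sE; rewrite -level_le.
by rewrite sideS ler_wpM2l//; have /andP[] := level_bounds E0.
Qed.

(** Off the null set [~` G] the bound [g] may be replaced by [+oo]. *)
Lemma le_integral_good (R : realType) (d : measure_display) (T : measurableType d)
    (m : {measure set T -> \bar R}) (D G : set T) (f g : T -> \bar R) :
  measurable D -> measurable G -> m (~` G) = 0%E -> measurable_fun [set: T] g ->
  (forall x, 0 <= g x)%E -> (forall x, D x -> 0 <= f x)%E ->
  (forall x, G x -> D x -> f x <= g x)%E ->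
  (\int[m]_(x in D) f x <= \int[m]_(x in D) g x)%E.
Proof.
move=> mD mG nG mg g0 f0 fg; pose h x := if x \in G then g x else +oo%E.
have mh : measurable_fun [set: T] h.
  apply: measurable_fun_ifT => //.
  apply: (measurable_fun_bool true); rewrite setTI (_ : _ @^-1` _ = G)//.
  by apply/seteqP; split => x /=; [move/set_mem|exact: mem_set].
apply: (@le_trans _ _ (\int[m]_(x in D) h x)%E).
  apply: ge0_le_integral_any => // x Dx; rewrite /h; case: ifPn; last by rewrite leey.
  by rewrite inE => Gx; exact: fg.
rewrite (@ge0_ae_eq_integral _ _ _ m D h g) //.
- exact: measurable_funTS.
- exact: measurable_funTS.
- by move=> x _; rewrite /h; case: ifP.
- exists (~` G); split => //; first exact: measurableC.
  by move=> x /= nx Gx; apply: nx => _; rewrite /h mem_set.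
Qed.

Section atomic_decomposition.
Context {R : realType} {n : nat} {d : measure_display} {Omega : measurableType d}.
Context {P : probability Omega R}.
Local Notation T := (space_time R n).
Variable W : set T -> {RV P >-> R}.
Hypothesis HW : gaussian_random_measure W.
Context {X : completeNormedModType R}.
Variables (f : T -> X) (G : set (euclidean R n)).
Hypothesis Gf : forall x, G x -> in_L2_tensor (restr (cone x) f).
Hypothesis n1 : (1 <= n)%N.
Hypothesis mG : measurable G.
Hypothesis nG : lebesgue_tuple n (~` G) = 0%E.
Hypothesis f1 : (T1_norm W f < +oo)%E.
Local Notation mass := (mass W f).
Local Notation maximal := (maximal W f G).
Local Notation heavy_region := (heavy_region W f G).
Local Notation leb := (lebesgue_tuple n).
Local Notation radius := (@radius R n).
Local Notation dilation := (@dilation R n).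
Implicit Types (x : euclidean R n) (m : nat).


(** An enumeration of the pairs of a threshold and a maximal cube, by the [m]
    with [selected m]. *)
Variables (pos : nat -> int) (top : nat -> @key n) (selected : nat -> bool).
Hypothesis selectedP : forall m, selected m -> maximal (pos m) (top m).
Hypothesis selected_inj : forall m m', selected m -> selected m' ->
  pos m = pos m' -> top m = top m' -> m = m'.
Hypothesis selected_surj : forall k r, maximal k r ->
  exists m, [/\ selected m, pos m = k & top m = r].

Definition region m : set T := if selected m then piece W f G (pos m) (top m) else set0.
Definition part m : set T := seqDU region m.
Definition ball_of m : set (euclidean R n) := eball (center (top m)) (radius (top m)).
Definition ball_bound m : R := (2 * radius (top m)) ^+ n.
Definition mass_bound m : R := (@neighbour_count n)%:R * side (pos m + 1).
Definition weight m : R := mass_bound m * ball_bound m.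
Definition coefficient m : R := if selected m then weight m else 0.
Definition atom m : T -> X := fun p => (weight m)^-1 *: restr (part m) f p.

Lemma measurable_region m : measurable (region m).
Proof. by rewrite /region; case: ifP => // _; exact: measurable_piece. Qed.

Lemma measurable_part m : measurable (part m).
Proof. by apply: measurableD; [exact: measurable_region|apply: bigsetU_measurable => i _; exact: measurable_region]. Qed.

Lemma part_region m : part m `<=` region m. Proof. by move=> p []. Qed.

Lemma part_selected m p : part m p -> selected m /\ piece W f G (pos m) (top m) p.
Proof. by move=> /part_region; rewrite /region; case: ifP. Qed.

Lemma mass_bound_gt0 m : 0 < mass_bound m.
Proof. by rewrite mulr_gt0 ?side_gt0// ltr0n /neighbour_count expn_gt0. Qed.

Lemma ball_bound_gt0 m : 0 < ball_bound m.
Proof. by rewrite exprn_gt0// mulr_gt0// radius_gt0. Qed.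

Lemma weight_gt0 m : 0 < weight m.
Proof. by rewrite mulr_gt0 ?mass_bound_gt0 ?ball_bound_gt0. Qed.

Lemma coefficient_ge0 m : 0 <= coefficient m.
Proof. by rewrite /coefficient; case: ifP => // _; rewrite ltW ?weight_gt0. Qed.

Lemma coefficient_atom m p : coefficient m *: atom m p = restr (part m) f p.
Proof.
rewrite /coefficient; case: ifPn => sm.
  by rewrite /atom scalerA divff ?scale1r// gt_eqF ?weight_gt0.
rewrite scale0r /restr indicE memNset ?scale0r// => /part_selected[ms].
by rewrite ms in sm.
Qed.

Lemma measurable_part_cone m x : measurable (part m `&` cone x).
Proof. by apply: measurableI; [exact: measurable_part|exact: measurable_cone]. Qed.

Lemma part_outside m x : ~ ball_of m x -> part m `&` cone x = set0.
Proof.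
move=> nx; apply/seteqP; split => // p [/part_selected[_ mp] [p0 xp]]; apply: nx.
have [_] := piece_tent n1 mp; apply; by rewrite /eball/= edistC.
Qed.

Lemma mass0 x : G x -> mass set0 = 0%E.
Proof.
move=> Gx; apply/eqP; rewrite eq_le energy_ge0 andbT.
have [||_] := @mass_cover _ _ _ _ _ W HW _ f G Gf [::] set0 measurable0; rewrite ?big_nil//.
Qed.

Lemma mass_part m x : G x ->
  (mass (part m `&` cone x) <= (mass_bound m)%:E)%E.
Proof.
move=> Gx; apply: (mass_light HW Gf n1 (measurable_part_cone m x) Gx).
  by move=> p [].
by move=> p [/part_selected[_ /piece_light]].
Qed.

Lemma mass_part_ball m x : G x -> (mass (part m `&` cone x) <=
  if selected m then (mass_bound m)%:E * (\1_(ball_of m) x)%:E else 0)%E.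
Proof.
move=> Gx; case: ifPn => sm; last first.
  rewrite (_ : part m `&` cone x = set0) ?(mass0 Gx)//.
  by apply/seteqP; split => // p [/part_selected[ms]]; rewrite ms in sm.
have [xm|xm] := pselect (ball_of m x).
  by rewrite indicE mem_set// mule1; exact: mass_part.
by rewrite part_outside// (mass0 Gx) indicE memNset// mule0.
Qed.

(** The weight is the bound of the energy times a bound of the volume of the ball;
    so the squared energy of the atom is at most the inverse squared of that
    volume bound. *)
Lemma atomP m : T1_atom W (atom m).
Proof.
have mB : measurable (ball_of m) by exact: measurable_eball.
have E x : restr (cone x) (atom m) =
    (fun p => (weight m)^-1 *: restr (part m `&` cone x) f p).
  apply/funext => p; rewrite /restr /atom /restr !scalerA; congr (_ *: _).
  by rewrite indicI /=; ring.
have tx x : G x -> in_L2_tensor (restr (part m `&` cone x) f).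
  by move=> Gx; apply: (tensor_cone Gf (measurable_part_cone m x) _ Gx) => p [].
exists (center (top m)), (radius (top m)); split.
- by rewrite radius_gt0.
- move=> p p0 np; rewrite /atom /restr indicE memNset ?scale0r ?scaler0//.
  by move=> /part_selected[_ /(piece_tent n1)].
- exists (~` G); split => //; first exact: measurableC.
  move=> x /= nx Gx; apply: nx => _; rewrite E.
  by have [] := energyZ HW (weight m)^-1 (tx _ Gx).
pose c : R := (ball_bound m)^-1 ^+ 2.
have c0 : 0 <= c by exact: sqr_ge0.
have B0 : (0 < leb (ball_of m))%E by apply: lebesgue_eball_gt0; exact: radius_gt0.
have BV : (leb (ball_of m) <= (ball_bound m)%:E)%E.
  by apply: lebesgue_eball_le; rewrite ltW ?radius_gt0.
have BE : leb (ball_of m) \is a fin_num.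
  by rewrite ge0_fin_numE// (le_lt_trans BV) ?ltry.
apply: (@le_trans _ _ (\int[leb]_(x in ball_of m) c%:E)%E).
  apply: (le_integral_good mB mG nG) => //.
  - by move=> x _; rewrite cone_energyE expe_ge0// energy_ge0.
  move=> x Gx _; rewrite cone_energyE E.
  have [_ ->] := energyZ HW (weight m)^-1 (tx _ Gx).
  rewrite ger0_norm ?invr_ge0 ?(ltW (weight_gt0 m))//.
  have : ((weight m)^-1%:E * mass (part m `&` cone x) <= ((ball_bound m)^-1)%:E)%E.
    apply: (@le_trans _ _ ((weight m)^-1 * mass_bound m)%:E).
      rewrite EFinM lee_wpmul2l ?mass_part// lee_fin invr_ge0 ltW ?weight_gt0//.
    rewrite lee_fin /weight invfM mulrAC mulVf ?mul1r// gt_eqF ?mass_bound_gt0//.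
  move=> le; rewrite /c EFin_expe.
  have e0 : (0 <= (weight m)^-1%:E * mass (part m `&` cone x))%E.
    by rewrite mule_ge0 ?energy_ge0// lee_fin invr_ge0 ltW ?weight_gt0.
  by rewrite !expe2; exact: lee_pmul.
rewrite integral_cst//= -/(ball_of m) -(fineK BE) inver.
move: B0 BV; rewrite -(fineK BE) lte_fin lee_fin; move: (fine _) => b b0 bV.
rewrite gt_eqF// -EFinM lee_fin /c -ler_pdivlMr//.
have Vb : (ball_bound m)^-1 <= b^-1 by rewrite lef_pV2 ?posrE ?ball_bound_gt0.
by rewrite expr2 ler_pM// invr_ge0 ltW ?ball_bound_gt0.
Qed.

(** Up to a dimensional constant the coefficient is [side (pos m)] times the
    volume of the cube. *)
Lemma coefficient_integral m : selected m -> (coefficient m)%:E =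
  ((2 * (@neighbour_count n)%:R * (2 * dilation) ^+ n)%:E *
   \int[leb]_x (side (pos m) * \1_(cube (top m) `&` G) x)%:E)%E.
Proof.
move=> sm; rewrite /coefficient sm /weight /mass_bound /ball_bound /radius.
rewrite (eq_integral (fun x => (side (pos m))%:E * (\1_(cube (top m) `&` G) x)%:E)%E)//.
have mq : measurable (cube (R := R) (top m) `&` G).
  by apply: measurableI => //; exact: measurable_cube.
rewrite ge0_integralZl ?lee_fin ?side_ge0//; last exact/measurable_EFinP.
rewrite integral_indic// setIT.
rewrite [X in (_ * (_ * X))%E](_ : _ = (side (top m).1 ^+ n)%:E); last first.
  exact: (lebesgue_cube_good mG nG).
rewrite -!EFinM; congr (_%:E).
rewrite (_ : (2 * (dilation * side (top m).1)) ^+ n =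
  (2 * dilation) ^+ n * side (top m).1 ^+ n); last by rewrite mulrA exprMn.
by rewrite sideS; ring.
Qed.

(** Above [x] the selected indices have distinct thresholds, all below the energy
    of the cone at [x]. *)
Lemma sum_selected_le (N : nat) x :
  (\sum_(0 <= m < N) (if selected m then (2^-1 * (side (pos m) * \1_(cube (top m) `&` G) x))%:E else 0)
    <= mass (cone x))%E.
Proof.
have [Gx|nGx] := pselect (G x); last first.
  rewrite big1 ?energy_ge0// => m _; rewrite indicE memNset ?mulr0 ?if_same//.
  by case.
have zoo := mass_lty HW Gf (measurable_cone x) (@subset_refl _ _) Gx.
have z0 : (0 <= mass (cone x))%E by exact: energy_ge0.
have zE : mass (cone x) \is a fin_num by rewrite ge0_fin_numE.
pose ok m := selected m && `[< cube (top m) x >].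
(* two maximal cubes of the same threshold containing [x] coincide *)
have okP m m' : ok m -> ok m' -> pos m = pos m' -> m = m'.
  move=> /andP[sm /asboolP mx] /andP[sm' /asboolP mx'] mm'.
  apply: selected_inj => //.
  have := selectedP sm'; rewrite -mm' => Mm'.
  exact: (maximal_unique (selectedP sm) Mm' mx mx').
pose s := [seq m <- iota 0 N | ok m].
have us : uniq (map pos s).
  rewrite map_inj_in_uniq ?filter_uniq ?iota_uniq// => m m'.
  by rewrite !mem_filter => /andP[om _] /andP[om' _]; exact: okP.
have sE k : k \in map pos s -> side k <= fine (mass (cone x)).
  move=> /mapP[m]; rewrite mem_filter => /andP[/andP[sm /asboolP mx] _] ->.
  have [/(_ x mx Gx) + _] := selectedP sm.
  by rewrite -(fineK zE) lte_fin => /ltW.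
rewrite (eq_bigr (fun m => (if ok m then 2^-1 * side (pos m) else 0)%:E)); last first.
  move=> m _; rewrite /ok; case: selected => //=; case: asboolP => mx.
    by rewrite indicE mem_set// mulr1.
  by rewrite indicE memNset ?mulr0// => -[].
rewrite sumEFin -(fineK zE) lee_fin /index_iota subn0 -big_mkcond -big_filter -/s.
rewrite -mulr_sumr ler_pdivrMl// -(big_map pos xpredT side).
have [/eqP E0|E0] := eqVneq (fine (mass (cone x))) 0.
  rewrite (_ : map pos s = [::]) ?big_nil ?mulr_ge0 ?fine_ge0//.
  case: (map pos s) sE => // k ? /(_ k (mem_head _ _)); rewrite (eqP E0) leNgt.
  by rewrite side_gt0.
by apply: sum_side_le => //; rewrite lt_def E0 fine_ge0.
Qed.

(** The sum of the coefficients is the integral of a measurable function that lies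
    below the energy, up to a constant. *)
Lemma sum_coefficient_le : (\sum_(0 <= m <oo) (coefficient m)%:E <=
  (4 * (@neighbour_count n)%:R * (2 * dilation) ^+ n)%:E * T1_norm W f)%E.
Proof.
pose g m (x : euclidean R n) : \bar R := (if selected m then
  (2^-1 * (side (pos m) * \1_(cube (top m) `&` G) x))%:E else 0)%E.
have g0 m x : (0 <= g m x)%E.
  by rewrite /g; case: ifP => // _; rewrite lee_fin !mulr_ge0 ?side_ge0 ?invr_ge0.
have mq m : measurable (cube (R := R) (top m) `&` G).
  by apply: measurableI => //; exact: measurable_cube.
have mg m : measurable_fun setT (g m).
  rewrite /g; case: selected; last exact: measurable_cst.
  by apply/measurable_EFinP; do 2! apply: measurable_funM => //.
pose K : R := 4 * (@neighbour_count n)%:R * (2 * dilation) ^+ n.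
have K0 : 0 <= K.
  by rewrite /K !mulr_ge0// exprn_ge0// mulr_ge0// ltW ?dilation_gt0.
have E m : (coefficient m)%:E = (K%:E * \int[leb]_x g m x)%E.
  case: (boolP (selected m)) => sm; last first.
    by rewrite /coefficient /g (negbTE sm) integral0 mule0.
  rewrite coefficient_integral// /g sm.
  have -> : (\int[leb]_x (2^-1 * (side (pos m) * \1_(cube (top m) `&` G) x))%:E =
      2^-1%:E * \int[leb]_x (side (pos m) * \1_(cube (top m) `&` G) x)%:E)%E.
    rewrite -ge0_integralZl ?lee_fin ?invr_ge0//.
    - by apply/measurable_EFinP; apply: measurable_funM.
    - by move=> x _; rewrite lee_fin mulr_ge0 ?side_ge0.
  by rewrite muleA -EFinM; congr (_%:E * _)%E; rewrite /K; field.
rewrite (eq_eseriesr (fun m _ => E m)) nneseriesZl//; last first.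
  by move=> m _; apply: integral_ge0.
rewrite lee_wpmul2l ?lee_fin// -integral_nneseries//.
apply: ge0_le_integral_any => x _; first exact: nneseries_ge0.
rewrite -mass_cone; apply: lime_le.
  by apply: is_cvg_nneseries.
by apply: nearW => N; exact: sum_selected_le.
Qed.

Definition remainder (N : nat) : set T := ~` \bigcup_(m < N) part m.

Lemma measurable_remainder N : measurable (remainder N).
Proof.
apply: measurableC; apply: bigcup_measurable => m _; exact: measurable_part.
Qed.

Lemma restr_remainder N :
  f \- (fun p => \sum_(m < N) coefficient m *: atom m p) = restr (remainder N) f.
Proof.
apply/funext => p /=; rewrite (eq_bigr (fun m : 'I_N => restr (part m) f p)); last first.
  by move=> m _; exact: coefficient_atom.
rewrite /restr; have [[m mN mp]|H] := pselect ((\bigcup_(m < N) part m) p); last first.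
  rewrite [\1_(remainder N) p]indicE mem_set// scale1r big1 ?subr0// => m _.
  by rewrite indicE memNset ?scale0r// => mp; apply: H; exists m => //=.
rewrite [\1_(remainder N) p]indicE memNset ?scale0r; last by apply; exists m.
rewrite (bigD1 (Ordinal mN))//= indicE mem_set// scale1r big1 ?addr0 ?subrr// => i im.
rewrite indicE memNset ?scale0r// => ip.
have /trivIsetP/(_ i m I I) := trivIset_seqDU region.
by rewrite -val_eqE/= in im; move=> /(_ im)/seteqP[/(_ p (conj ip mp))].
Qed.

Lemma remainder_light k p : (forall m, ~ part m p) -> ~ heavy_region k p.
Proof.
move=> np /(piece_cover HW Gf n1 mG nG f1)[k' [r [kr rp]]].
have [m [sm mk mr]] := selected_surj kr.
have : (\bigcup_m region m) p by exists m => //; rewrite /region sm mk mr.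
by rewrite seqDU_bigcup_eq => -[i _]; exact: np.
Qed.

(** What no piece covers avoids every heavy region, hence has energy at most
    [N * side k] for every [k]. *)
Lemma mass_remainder_all x : G x -> (mass (~` (\bigcup_m part m) `&` cone x) <= 0)%E.
Proof.
move=> Gx; apply/lee_addgt0Pr => e e0; rewrite add0e.
have N0 : 0 < (@neighbour_count n)%:R :> R by rewrite ltr0n /neighbour_count expn_gt0.
pose k := level (e / (@neighbour_count n)%:R).
have eN : 0 < e / (@neighbour_count n)%:R by rewrite divr_gt0.
have mR : measurable (~` (\bigcup_m part m) `&` cone x).
  apply: measurableI; last exact: measurable_cone.
  by apply: measurableC; apply: bigcup_measurable => m _; exact: measurable_part.
apply: le_trans (mass_light (k := k) HW Gf n1 mR Gx _ _) _.
- by move=> p [].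
- move=> p [np _]; apply: remainder_light => // m mp; by apply: np; exists m.
- rewrite lee_fin mulrC -ler_pdivlMr//.
  by have /andP[] := level_bounds eN.
Qed.

Definition local_bound (m : nat) (x : euclidean R n) : \bar R :=
  if selected m then ((mass_bound m)%:E * (\1_(ball_of m) x)%:E)%E else 0%E.

Lemma local_bound_ge0 m x : (0 <= local_bound m x)%E.
Proof.
by rewrite /local_bound; case: ifP => // _; rewrite mule_ge0// lee_fin ltW ?mass_bound_gt0.
Qed.

(** Remove the parts one by one, with [mass_part_ball]; what is left after [K]
    steps decreases to the set that no part covers. *)
Lemma mass_remainder N x : G x -> (mass (remainder N `&` cone x) <=
  \sum_(N <= m <oo) local_bound m x)%E.
Proof.
move=> Gx; have mc := measurable_cone x.
have mR K : measurable (remainder K `&` cone x).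
  by apply: measurableI => //; exact: measurable_remainder.
have step K : (mass (remainder (N + K) `&` cone x) <=
    local_bound (N + K) x + mass (remainder (N + K.+1) `&` cone x))%E.
  have sub A : A `&` cone x `<=` cone x by move=> p [].
  apply: (@le_trans _ _ (mass ((part (N + K) `&` cone x) `|`
      (remainder (N + K.+1) `&` cone x)))).
    apply: (le_mass HW Gf (mR _) _ _ _ Gx).
    - by apply: measurableU => //; exact: measurable_part_cone.
    - move=> p [Rp xp]; have [pp|npp] := pselect (part (N + K)%N p); [by left|right].
      split => // -[m]; rewrite /= addnS ltnS leq_eqVlt => /orP[/eqP->//|mK] mp.
      by apply: Rp; exists m.
    - by move=> p [[]|[]].
  apply: le_trans (mass_U HW Gf (measurable_part_cone _ x) (mR _) (sub _) (sub _) Gx) _.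
  by rewrite leeD2r//; exact: mass_part_ball.
have sum K : (mass (remainder N `&` cone x) <=
    \sum_(N <= m < N + K) local_bound m x + mass (remainder (N + K) `&` cone x))%E.
  elim: K => [|K IH]; first by rewrite addn0 big_geq// add0e.
  apply: le_trans IH _; rewrite addnS big_nat_recr/= ?leq_addr//.
  by rewrite -addeA leeD2l// -addnS; exact: step.
apply/lee_addgt0Pr => e e0.
(* what later parts still cover; it decreases to the empty set *)
pose D K := (remainder K `&` \bigcup_m part m) `&` cone x.
have mD K : measurable (D K).
  apply: measurableI => //; apply: measurableI; first exact: measurable_remainder.
  by apply: bigcup_measurable => m _; exact: measurable_part.
have D0 : mass (D K) @[K --> \oo] --> 0%E.
  apply: (mass_cvg0 HW Gf mD _ _ Gx) => [K p [] //|p].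
  have [[m _ mp]|H] := pselect ((\bigcup_m part m) p); last first.
    by apply: nearW => K [[]].
  by exists m.+1 => // K /= mK [[Rp _] _]; apply: Rp; exists m.
have [K0 _ HK] := cvge0_near D0 e0.
apply: le_trans (sum K0) _.
apply: leeD.
  by apply: nneseries_lim_ge => m _ _; exact: local_bound_ge0.
have mA : measurable (~` (\bigcup_m part m) `&` cone x).
  apply: measurableI => //.
  by apply: measurableC; apply: bigcup_measurable => m _; exact: measurable_part.
apply: (@le_trans _ _ (mass ((~` (\bigcup_m part m) `&` cone x) `|` D (N + K0)%N))).
  apply: (le_mass HW Gf (mR _) _ _ _ Gx).
  - exact: measurableU.
  - move=> p [Rp xp]; have [pp|npp] := pselect ((\bigcup_m part m) p); [right|left];
    by split => //; split.
  - by move=> p [[]|[]].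
apply: le_trans (mass_U HW Gf mA (mD _) _ _ Gx) _; try by move=> p [].
rewrite -[X in (_ <= X)%E]add0e; apply: leeD; first exact: mass_remainder_all.
by apply: HK; rewrite /= leq_addl.
Qed.

(** The integral of the [m]-th local bound is at most the [m]-th coefficient, so
    the remainder is dominated by the tail of a convergent series. *)
Lemma sum_atoms : T1_sums_to W (fun m p => coefficient m *: atom m p) f.
Proof.
have mB m : measurable (ball_of m) by exact: measurable_eball.
have mlb m : measurable_fun setT (local_bound m).
  rewrite /local_bound; case: selected; last exact: measurable_cst.
  by apply: emeasurable_funM => //; apply/measurable_EFinP.
have lbi m : (\int[leb]_x local_bound m x <= (coefficient m)%:E)%E.
  rewrite /local_bound /coefficient; case: ifP => _; last by rewrite integral0.
  rewrite ge0_integralZl ?lee_fin ?(ltW (mass_bound_gt0 m))//; last exact/measurable_EFinP.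
  rewrite integral_indic// setIT /weight [leRHS]EFinM.
  apply: lee_wpmul2l; first by rewrite lee_fin ltW ?mass_bound_gt0.
  by apply: lebesgue_eball_le; rewrite ltW ?radius_gt0.
have sfin : (\sum_(0 <= m <oo) (coefficient m)%:E < +oo)%E.
  apply: le_lt_trans sum_coefficient_le _; rewrite lte_mul_pinfty// ?lee_fin//.
  by rewrite !mulr_ge0// exprn_ge0// mulr_ge0// ltW ?dilation_gt0.
have tail := nneseries_tail_cvg sfin (fun m _ => coefficient_ge0 m).
apply: (cvge0_squeeze _ _ tail) => [N|N].
  by apply: integral_ge0 => x _; exact: sqrte_ge0.
rewrite restr_remainder.
have lb0 m x : (0 <= local_bound (m + N) x)%E by exact: local_bound_ge0.
apply: (@le_trans _ _ (\int[leb]_x (\sum_(0 <= m <oo) local_bound (m + N) x))%E).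
  apply: (le_integral_good measurableT mG nG) => //.
  - by apply: ge0_emeasurable_sum.
  - by move=> x; apply: nneseries_ge0 => m _ _; exact: local_bound_ge0.
  - by move=> x _; exact: sqrte_ge0.
  move=> x Gx _; rewrite sqrte_cone_energy restrI setIC (@nneseries_addn _ (fun m => local_bound m x)); last first.
    by move=> m; exact: local_bound_ge0.
  exact: mass_remainder.
rewrite integral_nneseries//.
rewrite -[leRHS](@nneseries_addn _ (fun m => (coefficient m)%:E)); last by move=> m; rewrite lee_fin coefficient_ge0.
by apply: lee_nneseries => // m _ _; exact: integral_ge0.
Qed.

End atomic_decomposition.

(** * The theorem *)

(** An enumeration by all natural numbers that may leave gaps, so that a finite or
    empty set is no special case. *)
Lemma countable_enumeration (T : countType) (x0 : T) (D : set T) :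
  exists (e : nat -> T) (s : nat -> bool), [/\ forall m, s m -> D (e m),
    forall m m', s m -> s m' -> e m = e m' -> m = m' &
    forall x, D x -> exists2 m, s m & e m = x].
Proof.
pose e m := odflt x0 (choice.unpickle m).
exists e, (fun m => (choice.pickle (e m) == m) && `[< D (e m) >]); split.
- by move=> m /andP[_ /asboolP].
- by move=> m m' /andP[/eqP em _] /andP[/eqP em' _] E; rewrite -em -em' E.
- move=> x Dx; have E : e (choice.pickle x) = x by rewrite /e choice.pickleK.
  by exists (choice.pickle x) => //; rewrite E eqxx; exact/asboolP.
Qed.

Theorem theorem11 (R : realType) (n : nat) (d : measure_display)
    (Omega : measurableType d) (P : probability Omega R)
    (W : set (space_time R n) -> {RV P >-> R})
    (X : completeNormedModType R) :
  (1 <= n)%N -> gaussian_random_measure W ->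
  exists C : R, forall f : space_time R n -> X, T1_function W f ->
    exists (a : nat -> space_time R n -> X) (lam : nat -> R),
      [/\ forall k, T1_atom W (a k),
          T1_sums_to W (fun k p => lam k *: a k p) f &
          (\sum_(0 <= k <oo) `|lam k|%:E <= C%:E * T1_norm W f)%E].
Proof.
move=> n1 HW; exists (4 * (@neighbour_count n)%:R * (2 * @dilation R n) ^+ n).
move=> f [[N [mN N0 fN]] f1]; pose G := ~` N.
have mG : measurable G by exact: measurableC.
have nG : lebesgue_tuple n (~` G) = 0%E by rewrite setCK.
have Gf x : G x -> in_L2_tensor (restr (cone x) f).
  by move=> Gx; apply: contrapT => nx; exact: Gx (fN _ nx).
have [e [s [sM s_inj s_surj]]] := countable_enumeration (0, (0, [ffun=> 0]))
  [set kr : int * @key n | maximal W f G kr.1 kr.2].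
pose pos m := (e m).1; pose top m := (e m).2.
have inj m m' : s m -> s m' -> pos m = pos m' -> top m = top m' -> m = m'.
  move=> sm sm' pp tt; apply: s_inj => //.
  by rewrite (surjective_pairing (e m)) (surjective_pairing (e m')) -/(pos m) pp -/(top m) tt.
have surj k r : maximal W f G k r -> exists m, [/\ s m, pos m = k & top m = r].
  by move=> kr; have [m sm em] := s_surj (k, r) kr; exists m; rewrite /pos /top em.
exists (atom W f G pos top s), (coefficient (R := R) pos top s); split.
- by move=> m; exact: atomP.
- exact: sum_atoms.
- rewrite (eq_eseriesr (g := fun m => (coefficient pos top s m)%:E)).
    exact: (sum_coefficient_le HW Gf mG nG sM inj).
  by move=> m _; rewrite ger0_norm// coefficient_ge0.
Qed.
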